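(* Let $d\ge1$, let $V:\mathbb T^d\to\mathbb R$ be smooth and even, and let $F^\circ\in\mathcal P\cap C^\infty_c(\mathbb D)$. For $N\ge1$ let $F_N$ be the solution of the Liouville equation on $\mathbb D^N$ $$\partial_t F_N+\sum_{j=1}^Nv_j\cdot\nabla_{x_j}F_N=\frac1N\sum_{1\le j\ne l\le N}\nabla V(x_j-x_l)\cdot\nabla_{v_j}F_N,\qquad F_N|_{t=0}=(F^\circ)^{\otimes N},$$ let $F_N^1(z)=\int_{\mathbb D^{N-1}}F_N(z,z_2,\dots,z_N)\,dz_2\dots dz_N$ be its first marginal, and let $F$ be the solution of the Vlasov equation $$\partial_tF+v\cdot\nabla_xF=(\nabla V\ast F)\cdot\nabla_vF,\qquad F|_{t=0}=F^\circ.$$ Then for all $t\ge0$ and $\delta>0$, $$\|F_N^{1;t}-F^t\|_{W^{-2-\delta,1}(\mathbb D)}\le\frac1N\,C_\delta e^{C_\delta t^{1+\delta}},$$ where the constant $C_\delta$ only depends on $d$, $\delta$, $\|\nabla V\|_{W^{2+\delta,\infty}(\mathbb T^d)}$, $\|F^\circ\|_{L^{1+\delta}(\mathbb D)}$ and $\operatorname{supp}F^\circ$.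
   Context: $\mathbb T^d=\mathbb R^d/\mathbb Z^d$, $\mathbb D=\mathbb T^d\times\mathbb R^d$, points are $z=(x,v)$; $\mathcal P$ denotes probability densities on $\mathbb D$. $(\nabla V\ast F)(x)=\int_{\mathbb D}\nabla V(x-y)F(y,v)\,dy\,dv$. The superscript $t$ denotes evaluation at time $t$. Norm convention: $\|G\|_{W^{-r,1}}=\sup\{\int\phi\, G:\ \phi\in C_b^\infty,\ \|\phi\|_{W^{r,\infty}}\le1\}$ (norm of the dual of $W^{r,\infty}$, with the usual fractional Sobolev spaces for non-integer $r$). *)

(* Defs.v *)
From HB Require Import structures.
From mathcomp Require Import all_boot all_order all_algebra.
From mathcomp Require Import all_classical all_reals all_analysis.

Set Implicit Arguments.
Unset Strict Implicit.
Unset Printing Implicit Defensive.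

Import Order.TTheory GRing.Theory Num.Theory.
Import numFieldNormedType.Exports.

Local Open Scope classical_set_scope.
Local Open Scope ring_scope.

Section cons_measure.
Local Open Scope ereal_scope.
Context d (T : measurableType d) (R : realType) (n : nat).
Variable mu : {sigma_finite_measure set T -> \bar R}.
Variable nu : {sigma_finite_measure set (n.-tuple T) -> \bar R}.

Let consT (p : T * n.-tuple T) : n.+1.-tuple T := [the n.+1.-tuple T of p.1 :: p.2].

Let measurable_consT : measurable_fun [set: T * n.-tuple T] consT.
Proof. exact: (measurable_cons measurable_fst measurable_snd). Qed.

Definition cons_measure : set (n.+1.-tuple T) -> \bar R :=
  pushforward (mu \x nu) consT.

Let cons_measure0 : cons_measure set0 = 0.
Proof. by rewrite /cons_measure /pushforward preimage_set0 measure0. Qed.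

Let cons_measure_ge0 A : 0 <= cons_measure A.
Proof. exact: measure_ge0. Qed.

Let cons_measure_sigma_additive : semi_sigma_additive cons_measure.
Proof.
move=> F mF tF mUF; rewrite /cons_measure /pushforward preimage_bigcup.
apply: measure_semi_sigma_additive.
- by move=> k; rewrite -[X in measurable X]setTI; exact: measurable_consT.
- apply/trivIsetP => /= i j _ _ ij; rewrite -preimage_setI.
  by move/trivIsetP : tF => /(_ _ _ _ _ ij) ->//; rewrite preimage_set0.
- by rewrite -preimage_bigcup -[X in measurable X]setTI; exact: measurable_consT.
Qed.

HB.instance Definition _ := isMeasure.Build _ _ _ cons_measure
  cons_measure0 cons_measure_ge0 cons_measure_sigma_additive.

Let cons_measure_sigma_finite : sigma_finite setT cons_measure.
Proof.
have [F UF Foo] : sigma_finite setT (mu \x nu).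
  have /sigma_finiteP[A [UA ndA Aoo]] := sigma_finiteT mu.
  have /sigma_finiteP[B [UB ndB Boo]] := sigma_finiteT nu.
  exists (fun k => A k `*` B k).
    rewrite -setXTT UA UB predeqE => -[x y]; split.
      move=> [/= [k _ Akx] [l _ Bly]]; exists (maxn k l) => //; split.
      - by move: x Akx; exact/subsetPset/ndA/leq_maxl.
      - by move: y Bly; exact/subsetPset/ndB/leq_maxr.
    by move=> [k _ []/= ? ?]; split; exists k.
  move=> k; have [? ?] := Aoo k; have [? ?] := Boo k.
  split; first exact: measurableX.
  by rewrite product_measure1E// lte_mul_pinfty// ge0_fin_numE.
pose g (t : n.+1.-tuple T) : T * n.-tuple T := (thead t, [tuple of behead t]).
have mg : measurable_fun setT g.
  by apply: measurable_fun_pair; [exact: measurable_tnth|exact: measurable_behead].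
have gK p : g (consT p) = p.
  by case: p => x t; rewrite /g /consT theadE; congr pair; apply: val_inj.
exists (fun k => g @^-1` F k); first by rewrite -preimage_bigcup -UF preimage_setT.
move=> k; have [mFk Fkoo] := Foo k; split.
  by rewrite -[X in measurable X]setTI; exact: mg.
rewrite /cons_measure /pushforward -comp_preimage.
by rewrite (_ : g \o consT = id) ?preimage_id//; apply/funext => p; exact: gK.
Qed.

HB.instance Definition _ := Measure_isSigmaFinite.Build _ _ _ cons_measure
  cons_measure_sigma_finite.

End cons_measure.

(* n-fold product of mu, the library having only products of two measures. *)
Fixpoint power_measure d (T : measurableType d) (R : realType)
    (mu : {sigma_finite_measure set T -> \bar R}) (n : nat) :
    {sigma_finite_measure set (n.-tuple T) -> \bar R} :=
  match n with
  | 0 => [the {sigma_finite_measure set (0.-tuple T) -> \bar R} of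
           \d_([tuple] : 0.-tuple T)]
  | m.+1 => cons_measure mu (power_measure mu m)
  end.

Section circle_measure.
Local Open Scope ereal_scope.
Variable R : realType.

(* Fundamental domain of the circle R/Z. *)
Definition unit_interval : set (measurableTypeR R) := `[0%R, 1%R[%classic.

Lemma measurable_unit_interval : measurable unit_interval.
Proof. exact: measurable_itv. Qed.

Definition line_measure : {sigma_finite_measure set (measurableTypeR R) -> \bar R} :=
  lebesgue_measure.

Lemma unit_interval_lty : line_measure unit_interval < +oo.
Proof.
by rewrite /line_measure /= /unit_interval lebesgue_measure_itv/= lte01 -EFinB ltry.
Qed.

Definition circle_measure : {sigma_finite_measure set (measurableTypeR R) -> \bar R} :=
  mfrestr measurable_unit_interval unit_interval_lty.

End circle_measure.

(* The phase space D^n = (T^d x R^d)^n is represented by pairs (x, v) of n x d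
   matrices, row j holding the position and the velocity of particle j.
   Functions on the torus are represented by Z^d-periodic functions on R^d, so
   functions on D^n are functions on [phase R n d] that are periodic in x. *)
Notation phase R n d := ('M[R]_(n, d) * 'M[R]_(n, d))%type.

Definition particle (R : realType) (n d : nat) (z : phase R n d) (j : 'I_n) :
  phase R 1 d := (row j z.1, row j z.2).

Definition torus_periodic (R : realType) (n d : nat) (f : 'M[R]_(n, d) -> R) :
  Prop := forall k : 'M[int]_(n, d), periodic f (map_mx intr k).

Definition phase_periodic (R : realType) (n d : nat) (f : phase R n d -> R) :
  Prop := forall v : 'M[R]_(n, d), torus_periodic (fun x => f (x, v)).

Section phase_measure.
Variables (R : realType) (n d : nat).

Local Notation coords := ((n * d).-tuple (measurableTypeR R)).

Definition mx_of_coords (t : coords) : 'M[R]_(n, d) :=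
  vec_mx (\row_(i < n * d) (tnth t i : R)).

Definition phase_of_coords (w : coords * coords) : phase R n d :=
  (mx_of_coords w.1, mx_of_coords w.2).

(* Lebesgue measure on D^n = [0,1)^(nd) x R^(nd), in coordinates. *)
Definition phase_measure : {measure set (coords * coords) -> \bar R} :=
  (power_measure (circle_measure R) (n * d)
   \x power_measure (line_measure R) (n * d))%E.

Definition phase_integral (f : phase R n d -> R) : R :=
  \int[phase_measure]_w f (phase_of_coords w).

Definition phase_Lnorm (p : R) (f : phase R n d -> R) : \bar R :=
  Lnorm phase_measure p%:E (fun w => (f (phase_of_coords w))%:E).

Definition probability_density (f : phase R n d -> R) : Prop :=
  [/\ phase_periodic f,
      forall z, 0 <= f z,
      measurable_fun [set: coords * coords] (f \o phase_of_coords) &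
      (\int[phase_measure]_w (f (phase_of_coords w))%:E = 1)%E].

End phase_measure.

Section smoothness.
Variables (R : realType) (E : normedModType R) (I : Type).
(* [e i] is the i-th coordinate direction of E. *)
Variable e : I -> E.

Definition partials (s : seq I) (f : E -> R) : E -> R :=
  foldr (fun i (g : E -> R) => fun x => 'D_(e i) g x) f s.

Definition smooth (f : E -> R) : Prop :=
  forall s : seq I, continuous (partials s f) /\
    forall (x : E) (i : I), derivable (partials s f) x (e i).

Definition smooth_bounded (f : E -> R) : Prop :=
  smooth f /\ forall s : seq I, exists M : R, forall x, `|partials s f x| <= M.

(* The norm of W^{r,oo}, r >= 0, on smooth functions, for which essential suprema
   are suprema: with r = k + theta, k integer and 0 <= theta < 1, this is the
   Slobodeckij norm, i.e. the C^{k,theta} Hoelder norm (C^k norm if theta = 0).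
   For a periodic function, the Hoelder quotient may be computed on R^d since
   the distance on the torus is attained by suitable representatives. *)
Definition sup_norm_upto (k : nat) (f : E -> R) : \bar R :=
  ereal_sup [set y | exists s x, (size s <= k)%N /\ y = `|partials s f x|%:E].

Definition hoelder_seminorm (k : nat) (theta : R) (f : E -> R) : \bar R :=
  ereal_sup [set y | exists s x x', [/\ size s = k, x != x' &
    y = (`|partials s f x - partials s f x'| / `|x - x'| `^ theta)%:E]].

Definition sobolev_norm (r : R) (f : E -> R) : \bar R :=
  let k := Num.truncn r in
  let theta := r - k%:R in
  (sup_norm_upto k f +
   if theta == 0%R then 0 else hoelder_seminorm k theta f)%E.

End smoothness.

Definition torus_dir (R : realType) (d : nat) (i : 'I_d) : 'rV[R]_d :=
  delta_mx ord0 i.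

Definition x_dir (R : realType) (n d : nat) (j : 'I_n) (i : 'I_d) : phase R n d :=
  (delta_mx j i, 0).

Definition v_dir (R : realType) (n d : nat) (j : 'I_n) (i : 'I_d) : phase R n d :=
  (0, delta_mx j i).

Definition phase_dir (R : realType) (d : nat) (a : 'I_d + 'I_d) : phase R 1 d :=
  match a with inl i => x_dir R ord0 i | inr i => v_dir R ord0 i end.

Definition potential_gradient (R : realType) (d : nat) (V : 'rV[R]_d -> R)
  (x : 'rV[R]_d) : 'rV[R]_d := \row_i 'D_(torus_dir R i) V x.

Definition gradient_sobolev_norm (R : realType) (d : nat) (r : R)
    (V : 'rV[R]_d -> R) : \bar R :=
  \big[maxe/0%E]_(i < d)
    sobolev_norm (@torus_dir R d) r (fun x => potential_gradient V x ord0 i).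

Definition phase_support (R : realType) (d : nat) (f : phase R 1 d -> R) :
  set (phase R 1 d) := closure [set z | f z != 0].

(* Every point of the torus has a representative in [0,1]^d: the support in D is
   the image of this set under the quotient map. *)
Definition compactly_supported (R : realType) (d : nat) (f : phase R 1 d -> R) :
  Prop :=
  compact (phase_support f `&` [set z : phase R 1 d | forall i, 0 <= z.1 ord0 i <= 1]).

(* Norm of W^{-r,1}(D) as the dual of W^{r,oo}(D). *)
Definition negative_sobolev_norm (R : realType) (d : nat) (r : R)
    (G : phase R 1 d -> R) : \bar R :=
  ereal_sup [set y | exists phi : phase R 1 d -> R,
    [/\ phase_periodic phi,
        smooth_bounded (@phase_dir R d) phi,
        (sobolev_norm (@phase_dir R d) r phi <= 1)%E &
        y = (\int[phase_measure R 1 d]_w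
              (phi (phase_of_coords w) * G (phase_of_coords w))%:E)%E]].

Section evolution.
Variables (R : realType) (n d : nat).

(* Regularity of classical solutions: continuity on [0,oo) x D^n and joint
   differentiability for positive times. *)
Definition classical (F : R -> phase R n d -> R) : Prop :=
  [/\ forall t, 0 <= t -> phase_periodic (F t),
      {within [set tz : R * phase R n d | 0 <= tz.1],
        continuous (fun tz => F tz.1 tz.2)} &
      forall (t : R) (z : phase R n d), 0 < t ->
        differentiable (fun tz : R * phase R n d => F tz.1 tz.2) (t, z)].

Definition free_transport (F : R -> phase R n d -> R) (t : R) (z : phase R n d) : R :=
  'D_1 (fun s : R => F s z) t +
  \sum_(j < n) \sum_(i < d) z.2 j i * 'D_(x_dir R j i) (F t) z.

End evolution.

Definition Liouville_solution (R : realType) (N d : nat) (V : 'rV[R]_d -> R)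
    (F0 : phase R 1 d -> R) (F : R -> phase R N d -> R) : Prop :=
  [/\ classical F,
      forall (t : R) (z : phase R N d), 0 < t ->
        free_transport F t z =
        N%:R^-1 * \sum_(j < N) \sum_(l < N | l != j) \sum_(i < d)
          potential_gradient V (row j z.1 - row l z.1) ord0 i *
          'D_(v_dir R j i) (F t) z &
      forall z, F 0 z = \prod_(j < N) F0 (particle z j)].

Definition gradient_convolution (R : realType) (d : nat) (V : 'rV[R]_d -> R)
    (f : phase R 1 d -> R) (x : 'rV[R]_d) : 'rV[R]_d :=
  \row_i phase_integral
    (fun z => potential_gradient V (x - z.1) ord0 i * f z).

Definition Vlasov_solution (R : realType) (d : nat) (V : 'rV[R]_d -> R)
    (F0 : phase R 1 d -> R) (F : R -> phase R 1 d -> R) : Prop :=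
  [/\ classical F,
      forall t, 0 <= t -> probability_density (F t),
      forall (t : R) (z : phase R 1 d), 0 < t ->
        free_transport F t z =
        \sum_(i < d) gradient_convolution V (F t) z.1 ord0 i *
          'D_(v_dir R ord0 i) (F t) z &
      forall z, F 0 z = F0 z].

Definition first_marginal (R : realType) (n d : nat) (F : phase R n.+1 d -> R)
    (z : phase R 1 d) : R :=
  phase_integral (fun w : phase R n d =>
    F (col_mx z.1 w.1 : 'M[R]_(1 + n, d), col_mx z.2 w.2 : 'M[R]_(1 + n, d))).

(* Main.v *)
(* Along the Newton flow (X_j, V_j) the Liouville solution is constant, and along
   the flow (P, Q) of the mean-field force the Vlasov solution is constant; both
   flows preserve Lebesgue measure, being limits of symplectic Euler schemes, which
   are compositions of shears.  Testing F_N^1 - F against phi therefore amounts to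
   bounding E[1/N sum_j (phi(X_j, V_j) - phi(P(z_j), Q(z_j)))], where the z_j are
   independent with density F0.

   For the deviations a_j = X_j - P(z_j), b_j = V_j - Q(z_j), a Gronwall argument
   with fluctuations of averages of centered kernels gives E[1/N sum a^2 + b^2] <=
   e^(ct) / N.  This quadratic bound is enough for the second order Taylor terms of
   phi and of the force.  The linear terms E[1/N sum_j h(z_j) a_j], uniformly over
   |h| <= 1, satisfy up to O(1/N) a closed second order differential inequality:
   the average of a kernel over the particles is its mean, absorbed in h, plus a
   centered fluctuation, whose product with a_j is O(1/N) by Cauchy-Schwarz.  A
   contraction in the norm sup_t e^(-ct) |.| then yields the rate 1/N. *)

Require Import Defs.
From HB Require Import structures.
From mathcomp Require Import all_boot all_order all_algebra.
From mathcomp Require Import all_classical all_reals all_analysis.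
From mathcomp Require Import measurable_realfun perm ring lra.

Set Implicit Arguments.
Unset Strict Implicit.
Unset Printing Implicit Defensive.

Import Order.TTheory GRing.Theory Num.Theory.
Import numFieldNormedType.Exports.

Local Open Scope classical_set_scope.
Local Open Scope ring_scope.

(** * Calculus on the line *)

(** The flows are never differentiated in the initial data, so there is no Jacobian: invariance of
    integrals is proved for the Euler schemes, by Fubini and translation invariance, and passes to
    the limit for truncated integrands. The Vlasov solution being given, its force is a prescribed
    time-dependent field, and transporting the density back to time 0 rewrites it as an average over
    initial data, the form that is compared with the empirical force.

    The weak estimate closes because weights [h] with |h| <= 1 are stable under multiplication by
    the mean of a kernel divided by its bound. The linearized force on particle j also contains the
    deviations of the other particles; exchanging the two indices of the double sum gives them the
    weight 1 and moves [h] into the kernel.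

    One constant [rate] is both the Gronwall rate and the exponent of the weighted norm: as it is at
    least 4dL + 1, each double time integration contracts by at least 1/2. The resulting bound is
    exponential in t, and t <= 1 + t^(1 + delta) gives the stated form. *)

Section RealValuedDerive.
Context {R : realType} {V : normedModType R}.
Implicit Types (f g : V -> R) (x v : V).

Lemma dR_cst (c : R) x v : is_derive x v (fun=> c) 0.
Proof. exact: is_derive_cst. Qed.

Lemma dR_add f g x v (a b : R) : is_derive x v f a -> is_derive x v g b ->
  is_derive x v (fun y => f y + g y) (a + b).
Proof. by move=> ? ?; exact: is_deriveD. Qed.

Lemma dR_sub f g x v (a b : R) : is_derive x v f a -> is_derive x v g b ->
  is_derive x v (fun y => f y - g y) (a - b).
Proof. by move=> ? ?; exact: is_deriveB. Qed.

Lemma dR_mul f g x v (a b : R) : is_derive x v f a -> is_derive x v g b ->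
  is_derive x v (fun y => f y * g y) (a * g x + f x * b).
Proof.
move=> fa gb; have := is_deriveM fa gb; move/is_derive_eq; apply.
by rewrite /GRing.scale/= addrC [_ * a]mulrC.
Qed.

Lemma dR_scale c f x v (a : R) : is_derive x v f a ->
  is_derive x v (fun y => c * f y) (c * a).
Proof.
move=> h; have := dR_mul (dR_cst c x v) h; rewrite mul0r add0r; exact.
Qed.

Lemma dR_sum (I : Type) (s : seq I) (P : pred I) (f : I -> V -> R) (df : I -> R) x v :
  (forall i, P i -> is_derive x v (f i) (df i)) ->
  is_derive x v (fun y => \sum_(i <- s | P i) f i y) (\sum_(i <- s | P i) df i).
Proof.
move=> h; elim: s => [|i s ih].
  under eq_fun do rewrite big_nil; rewrite big_nil; exact: dR_cst.
under eq_fun do rewrite big_cons; rewrite big_cons.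
case: ifPn => Pi //; exact: dR_add (h _ Pi) ih.
Qed.

End RealValuedDerive.

Section OneDim.
Context {R : realType}.
Implicit Types (f g : R -> R) (t T a b c : R).

Lemma is_derive_within f (df : R -> R) a b :
  (forall t, a <= t <= b -> is_derive t 1 f (df t)) ->
  {within `[a, b], continuous f}.
Proof.
move=> h; apply: derivable_within_continuous => x; rewrite in_itv/= => xab.
by have := h _ xab; case.
Qed.

Lemma derive_le_diff f (df : R -> R) g (dg : R -> R) a b : a <= b ->
  {within `[a, b], continuous f} -> {within `[a, b], continuous g} ->
  (forall t, a < t < b -> is_derive t 1 f (df t)) ->
  (forall t, a < t < b -> is_derive t 1 g (dg t)) ->
  (forall t, a < t < b -> df t <= dg t) ->
  f b - f a <= g b - g a.
Proof.
move=> ab cf cg hf hg hle.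
have [->|nab] := eqVneq a b; first by rewrite !subrr.
have {}ab : a < b by rewrite lt_neqAle nab.
have h x : x \in `]a, b[%R -> is_derive x 1 (g \- f) (dg x - df x).
  rewrite in_itv/= => xab.
  have := hf _ xab; have := hg _ xab => ? ?; exact: is_deriveB.
have cgf : {within `[a, b], continuous (g \- f)}.
  by move=> x; apply: continuousB; [exact: cg|exact: cf].
have [x xab /= E] := MVT ab h cgf.
have : 0 <= (dg x - df x) * (b - a).
  rewrite mulr_ge0 ?subr_ge0 ?(ltW ab)//; apply: hle.
  by move: xab; rewrite in_itv.
rewrite -E; lra.
Qed.

Lemma norm_derive_le f (df : R -> R) g (dg : R -> R) a b : a <= b ->
  {within `[a, b], continuous f} -> {within `[a, b], continuous g} ->
  (forall t, a < t < b -> is_derive t 1 f (df t)) ->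
  (forall t, a < t < b -> is_derive t 1 g (dg t)) ->
  (forall t, a < t < b -> `|df t| <= dg t) ->
  `|f b - f a| <= g b - g a.
Proof.
move=> ab cf cg hf hg hle; rewrite ler_norml; apply/andP; split; last first.
  apply: derive_le_diff => // t tab; apply: le_trans (hle _ tab); exact: ler_norm.
rewrite lerNl.
have -> : - (f b - f a) = (\- f) b - (\- f) a by rewrite /=; ring.
apply: (@derive_le_diff _ (fun t => - df t) _ dg) => //.
- by move=> x; apply: continuousN; exact: cf.
- by move=> t tab; have := hf _ tab => ?; exact: is_deriveN.
- by move=> t tab; apply: le_trans (hle _ tab); rewrite -normrN; exact: ler_norm.
Qed.

Lemma is_derive_expR_lin c t : is_derive t 1 (fun s => expR (c * s)) (c * expR (c * t)).
Proof.
have h : is_derive t 1 (fun s : R => c * s) c.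
  by have := dR_scale c (is_derive_id t (1:R)); rewrite mulr1.
have := @is_derive1_comp R expR (fun s : R => c * s) t _ _ (is_derive_expR _) h.
by rewrite mulrC.
Qed.

Lemma is_derive_continuous f t (l : R) : is_derive t 1 f l -> {for t, continuous f}.
Proof. by case=> h _; apply/differentiable_continuous/derivable1_diffP. Qed.

Lemma continuous_within (f : R -> R) a b :
  (forall t, {for t, continuous f}) -> {within `[a, b], continuous f}.
Proof. by move=> h; apply: continuous_subspaceT. Qed.

Lemma continuous_expR_lin c : continuous (fun s : R => expR (c * s)).
Proof. by move=> t; apply: is_derive_continuous; exact: is_derive_expR_lin. Qed.

(** The shift by [a / c] makes the inequality homogeneous, so that (f + a/c) e^(-ct) is
    nonincreasing. *)
Lemma gronwall f (df : R -> R) c a T : 0 <= T -> 0 < c -> 0 <= a ->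
  {within `[0, T], continuous f} ->
  (forall t, 0 < t < T -> is_derive t 1 f (df t)) ->
  (forall t, 0 < t < T -> df t <= c * f t + a) ->
  f T <= (f 0 + a / c) * expR (c * T).
Proof.
move=> T0 c0 a0 cf hf hle.
pose g t := (f t + a / c) * expR (- c * t).
have cg : {within `[0, T], continuous g}.
  have c1 : {within `[0, T], continuous (f + cst (a / c))}.
    by apply: within_continuousD => //; exact/continuous_within/cst_continuous.
  have c2 := @continuous_within _ 0 T (@continuous_expR_lin (- c)).
  by move=> x; exact: (continuousM (c1 x) (c2 x)).
have hg t : 0 < t < T -> is_derive t 1 g (expR (- c * t) * (df t - c * f t - a)).
  move=> tT; have h := hf _ tT.
  have := dR_mul (dR_add h (dR_cst (a / c) t 1)) (is_derive_expR_lin (- c) t).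
  move=> /is_derive_eq; apply; rewrite addr0; field; lra.
have : g T - g 0 <= (0 : R) - 0.
  apply: (@derive_le_diff g _ (cst 0) (cst 0) 0 T T0 cg _ hg).
  - exact/continuous_within/cst_continuous.
  - move=> t tT /=; have := hle _ tT; move=> dle; rewrite pmulr_rle0 ?expR_gt0//; lra.
rewrite /g /= mulr0 expR0 mulr1 subrr subr_le0 mulNr expRN.
rewrite ler_pdivrMr ?expR_gt0// => H; apply: le_trans H.
by rewrite lerDl divr_ge0// ltW.
Qed.

(** Each time integration of e^(lam t) gains a factor 1/lam. This is the source of every contraction
    below, for the existence of trajectories and for the weak bounds. *)
Lemma second_derive_le f (df ddf : R -> R) (rho lam T : R) : 0 <= T -> 0 < lam -> 0 <= rho ->
  {within `[0, T], continuous f} -> {within `[0, T], continuous df} ->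
  (forall t, 0 < t < T -> is_derive t 1 f (df t)) ->
  (forall t, 0 < t < T -> is_derive t 1 df (ddf t)) ->
  f 0 = 0 -> df 0 = 0 ->
  (forall t, 0 < t < T -> `|ddf t| <= rho * expR (lam * t)) ->
  `|df T| <= rho / lam * expR (lam * T) /\ `|f T| <= rho / lam ^+ 2 * expR (lam * T).
Proof.
move=> T0 lam0 rho0 cf cdf hf hdf f0 df0 hle.
have aux (r t : R) : is_derive t 1 (fun s => r / lam * expR (lam * s)) (r * expR (lam * t)).
  have := dR_scale (r / lam) (is_derive_expR_lin lam t).
  by move=> /is_derive_eq; apply; field; lra.
have main (h dh : R -> R) r S : 0 <= r -> 0 <= S <= T -> {within `[0, T], continuous h} ->
    (forall t, 0 < t < T -> is_derive t 1 h (dh t)) -> h 0 = 0 ->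
    (forall t, 0 < t < T -> `|dh t| <= r * expR (lam * t)) ->
    `|h S| <= r / lam * expR (lam * S).
  move=> r0 /andP[S0 ST] ch hh h0 hb.
  have sub t : 0 < t < S -> 0 < t < T by move=> /andP[-> tS]/=; apply: lt_le_trans ST.
  have := @norm_derive_le h dh _ _ 0 S S0 _ _ (fun t tS => hh t (sub t tS)) (fun t _ => aux r t)
    (fun t tS => hb t (sub t tS)).
  rewrite h0 subr0 mulr0 expR0 mulr1 => H.
  apply: le_trans (H _ _) _; last by rewrite gerBl divr_ge0// ltW.
  - apply: continuous_subspaceW ch => x /=; rewrite !in_itv/= => /andP[-> xS]/=.
    exact: le_trans ST.
  - by apply: continuous_within => t; exact: is_derive_continuous (aux r t).
have hdS S : 0 <= S <= T -> `|df S| <= rho / lam * expR (lam * S).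
  move=> ST; exact: (main _ ddf).
split; first by apply: hdS; rewrite T0 lexx.
have -> : rho / lam ^+ 2 = rho / lam / lam by field; lra.
apply: (main _ df) => //; first by rewrite divr_ge0// ltW.
  by rewrite T0 lexx.
by move=> t /andP[t0 tT]; apply: hdS; rewrite !ltW.
Qed.

Lemma continuous_primitive f : continuous f ->
  exists g : R -> R, g 0 = 0 /\ forall t, is_derive t 1 g (f t).
Proof.
move=> cf.
pose I (a t : R) := (\int[lebesgue_measure]_(s in `[a, t]) f s)%R.
have intf a t : lebesgue_measure.-integrable `[a, t] (EFin \o f).
  apply: continuous_compact_integrable; first exact: segment_compact.
  exact: continuous_subspaceT.
have Iab a b t : a <= b -> b <= t -> b <= 0 -> I a t - I a 0 = I b t - I b 0.
  move=> ab bt b0.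
  have key u : b <= u -> I a u - I a b = I b u.
    move=> bu; rewrite /I Rintegral_itvB//.
    rewrite Rintegral_itv_obnd_cbnd//.
    apply: integrableS (intf a u) => // x /=; rewrite !in_itv/= => /andP[bx ->].
    by rewrite andbT (le_trans ab)// ltW.
  rewrite -(key t bt) -(key 0 b0); ring.
(* The base point must lie to the left of both 0 and t, hence depends on t; by [Iab] the difference
   does not, so that near t the fixed base point [a] can be used instead. *)
pose g t := I (- (`|t| + 1)) t - I (- (`|t| + 1)) 0.
exists g; split; first by rewrite /g subrr.
move=> t; pose a := - (`|t| + 2).
have at_ : a < t by rewrite /a ltrNl (le_lt_trans (ler_norm _))// normrN ltrDl.
have tt1 : t < t + 1 by rewrite ltrDl.
have [dI dIE] := continuous_FTC1_closed tt1 (intf a (t + 1)) at_ (cf t).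
have dgt : is_derive t 1 (fun s => I a s - I a 0) (f t).
  have h : is_derive t 1 (I a) (f t) by split; [exact: dI|rewrite -dIE derive1E].
  by have := dR_sub h (dR_cst (I a 0) t 1); rewrite subr0.
apply: near_eq_is_derive dgt; near=> s.
have sb : `|s| < `|t| + 1.
  have : `|t - s| < 1 by near: s; exact: nbhsx_ballx.
  have := ler_distD t s 0; rewrite !subr0 [`|s - t|]distrC; lra.
rewrite /g; apply: Iab; rewrite ?oppr_le0 ?addr_ge0//.
- rewrite /a; lra.
- by rewrite lerNl (le_trans (ler_norm _))// normrN lerDl.
Unshelve. all: by end_near. Qed.

End OneDim.

(** * Taylor estimates and bounds on periodic functions *)

Section DirectionalTaylor.
Context {R : realType} {E : normedModType R}.

Lemma is_derive_line (f : E -> R) (y v : E) (s : R) : derivable f (y + s *: v) v ->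
  is_derive s 1 (fun r : R => f (y + r *: v)) ('D_v f (y + s *: v)).
Proof.
move=> df.
have eqf : (fun h : R => h^-1 *: (f (y + (h *: 1 + s) *: v) - f (y + s *: v))) =
    (fun h : R => h^-1 *: (f (h *: v + (y + s *: v)) - f (y + s *: v))).
  apply/funext => h; congr (_ *: (f _ - _)).
  by rewrite [h *: 1]mulr1 scalerDl addrCA.
split; first by rewrite /derivable /= eqf.
by rewrite /derive /= eqf.
Qed.

Lemma MVT_line (f : E -> R) (y v : E) (c : R) : (forall x, derivable f x v) ->
  exists2 s, `|s| <= `|c| & f (y + c *: v) - f y = c * 'D_v f (y + s *: v).
Proof.
move=> df; pose g (r : R) := f (y + r *: v); pose dg (r : R) := 'D_v f (y + r *: v).
have hg (r : R) : is_derive r 1 g (dg r) by exact: is_derive_line.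
have g0 : g 0 = f y by rewrite /g scale0r addr0.
have [c0|c0] := leP 0 c.
  have [s s0c E1] := MVT_segment c0 (fun r _ => hg r) (is_derive_within (fun r _ => hg r)).
  move: s0c; rewrite in_itv/= => /andP[s0 sc].
  exists s; first by rewrite !ger0_norm.
  by rewrite -g0 E1 subr0 mulrC.
have [s s0c E1] := MVT_segment (ltW c0) (fun r _ => hg r) (is_derive_within (fun r _ => hg r)).
move: s0c; rewrite in_itv/= => /andP[cs s0].
exists s; first by rewrite !ler0_norm ?lerN2// ltW.
by rewrite -g0 -opprB E1 sub0r mulrN opprK mulrC.
Qed.

Context {I : Type}.
Variables (e : I -> E).

(** The increment is travelled one coordinate direction at a time: only the derivatives along the
    [e i] are at hand, not the differential. *)
Lemma taylor1 (f : E -> R) (M : R) : (forall x i, derivable f x (e i)) ->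
  (forall x i, `|'D_(e i) f x| <= M) ->
  forall (s : seq I) (c : I -> R) x,
  `|f (x + \sum_(i <- s) c i *: e i) - f x| <= M * \sum_(i <- s) `|c i|.
Proof.
move=> df hM; elim=> [|i s ih] c x.
  by rewrite !big_nil addr0 subrr normr0 mulr0.
rewrite !big_cons addrA.
have [r _ E1] := MVT_line x (c i) (df^~ i).
have -> : f (x + c i *: e i + \sum_(j <- s) c j *: e j) - f x =
  (f (x + c i *: e i) - f x) + (f (x + c i *: e i + \sum_(j <- s) c j *: e j) - f (x + c i *: e i)) by ring.
apply: le_trans (ler_normD _ _) _; rewrite mulrDr lerD//.
by rewrite E1 normrM mulrC ler_wpM2r.
Qed.

(** After the step along [e i], the first order terms of the other directions are taken at [x'];
    bringing them back to x costs M |c_i| A, where A is the sum of the other |c_j|. The new errors M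
    |c_i|^2 + M |c_i| A fit into the growth of the square. *)
Lemma taylor2 (f : E -> R) (M : R) : (forall x i, derivable f x (e i)) ->
  (forall x i j, derivable ('D_(e i) f) x (e j)) ->
  (forall x i j, `|'D_(e j) ('D_(e i) f) x| <= M) ->
  forall (s : seq I) (c : I -> R) x,
  `|f (x + \sum_(i <- s) c i *: e i) - f x - \sum_(i <- s) c i * 'D_(e i) f x| <=
    M * (\sum_(i <- s) `|c i|) ^+ 2.
Proof.
move=> df ddf hM; elim=> [|i s ih] c x.
  by rewrite !big_nil addr0 !subrr normr0 expr0n mulr0.
rewrite !big_cons addrA.
have M0 : 0 <= M by apply: le_trans (hM x i i).
have [r rc E1] := MVT_line x (c i) (df^~ i).
set x' := x + c i *: e i in E1 *.
have lipD j (w : R) : `|'D_(e j) f (x + w *: e i) - 'D_(e j) f x| <= M * `|w|.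
  have := @taylor1 ('D_(e j) f) M (ddf^~ j) (hM^~ j) [:: i] (fun=> w) x.
  by rewrite !big_seq1.
set S := \sum_(j <- s) c j *: e j; set A := \sum_(j <- s) `|c j|.
have A0 : 0 <= A by apply: sumr_ge0.
have -> : f (x' + S) - f x - (c i * 'D_(e i) f x + \sum_(j <- s) c j * 'D_(e j) f x) =
   (f (x' + S) - f x' - \sum_(j <- s) c j * 'D_(e j) f x') +
   c i * ('D_(e i) f (x + r *: e i) - 'D_(e i) f x) +
   \sum_(j <- s) c j * ('D_(e j) f x' - 'D_(e j) f x).
  under [X in _ = _ + X]eq_bigr do rewrite mulrBr.
  by rewrite sumrB mulrBr -E1; ring.
have h1 := ih c x'; rewrite -/S -/A in h1.
have h2 : `|c i * ('D_(e i) f (x + r *: e i) - 'D_(e i) f x)| <= M * `|c i| ^+ 2.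
  rewrite normrM expr2 mulrA [M * _]mulrC -mulrA; apply: ler_wpM2l => //.
  by apply: le_trans (lipD i r) _; apply: ler_wpM2l.
have h3 : `|\sum_(j <- s) c j * ('D_(e j) f x' - 'D_(e j) f x)| <= M * (`|c i| * A).
  apply: le_trans (ler_norm_sum _ _ _) _.
  rewrite mulrA mulr_sumr; apply: ler_sum => j _; rewrite normrM mulrC.
  by apply: ler_wpM2r => //; exact: lipD.
apply: le_trans (ler_normD _ _) _; apply: le_trans (lerD (ler_normD _ _) (lexx _)) _.
have : 0 <= M * (`|c i| * A) by rewrite !mulr_ge0.
lra.
Qed.

End DirectionalTaylor.

Section SobolevBounds.
Context {R : realType} {E : normedModType R} {I : Type}.
Variable e : I -> E.

(** [partials] differentiates along the last entry of the list first, so inductions that replace f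
    by one of its derivatives peel the list at its end. *)
Lemma partials_rcons s i (f : E -> R) : partials e (rcons s i) f = partials e s ('D_(e i) f).
Proof. by elim: s => //= j s ->. Qed.

Lemma sup_norm_uptoP k (f : E -> R) (M : R) : (sup_norm_upto e k f <= M%:E)%E ->
  forall s x, (size s <= k)%N -> `|partials e s f x| <= M.
Proof.
move=> h s x sk; rewrite -lee_fin; apply: le_trans h.
by apply: ereal_sup_ubound; exists s, x.
Qed.

(** The Hoelder seminorm is a supremum of nonnegative quotients; [i0] and [x0] exhibit one of them,
    whereas the supremum of an empty set would be -oo. *)
Lemma sup_norm_le_sobolev (r : R) (f : E -> R) (i0 : I) (x0 : E) : x0 != 0 ->
  (sup_norm_upto e (Num.truncn r) f <= sobolev_norm e r f)%E.
Proof.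
move=> x00; rewrite /sobolev_norm; case: ifP => _; first by rewrite adde0.
rewrite leeDl//; set k := Num.truncn r; set th := r - k%:R.
pose s := nseq k i0.
apply: (@le_trans _ _ (`|partials e s f x0 - partials e s f 0| / `|x0 - 0| `^ th)%:E).
  by rewrite lee_fin divr_ge0// powR_ge0.
by apply: ereal_sup_ubound; exists s, x0, 0; split => //; rewrite size_nseq.
Qed.

End SobolevBounds.

Section PeriodicBounds.
Context {R : realType} {d : nat}.
Local Notation rV := 'rV[R]_d.
Implicit Types g : rV -> R.

Lemma derive_periodic g v : torus_periodic g -> torus_periodic ('D_v g).
Proof.
move=> pg k x; apply: (congr1 (fun f : R -> R => lim (f @ 0^'))); apply/funext => h /=.
by rewrite addrA pg pg.
Qed.

Lemma smooth_derive g i : smooth (@torus_dir R d) g -> smooth (@torus_dir R d) ('D_(torus_dir R i) g).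
Proof. by move=> sg s; rewrite -partials_rcons; exact: sg. Qed.

(** Subtracting the integer parts of the coordinates moves any point into the compact unit cube. *)
Lemma periodic_bounded g : torus_periodic g -> continuous g -> exists B, forall x, `|g x| <= B.
Proof.
move=> pg cg.
have cK : compact [set v : rV | forall i, `[0%R, 1%R]%classic (v ord0 i)].
  by apply: (@rV_compact R d (fun=> `[0%R, 1%R]%classic)) => i; exact: segment_compact.
have cgK : {within [set v : rV | forall i, `[0%R, 1%R]%classic (v ord0 i)], continuous g}.
  exact: continuous_subspaceT.
have := compact_bounded (continuous_compact cgK cK).
move=> [M [Mr hM]]; exists (M + 1) => x.
pose k : 'rV[int]_d := \row_i (- Num.floor (x ord0 i)).
rewrite -(pg k x); apply: (hM (M + 1)); first by rewrite ltrDl.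
exists (x + map_mx intr k) => // i /=; rewrite in_itv/= !mxE rmorphN/=.
have := floor_itv (x ord0 i); rewrite intrD; lra.
Qed.

Lemma partials_bounded k g : torus_periodic g -> smooth (@torus_dir R d) g ->
  exists B, forall s x, size s = k -> `|partials (@torus_dir R d) s g x| <= B.
Proof.
elim: k g => [|k ih] g pg sg.
  have [B hB] := periodic_bounded pg (sg [::]).1.
  by exists B => s x /size0nil ->; exact: hB.
have /choice[B hB] : forall i, exists B, forall s x, size s = k ->
    `|partials (@torus_dir R d) s ('D_(torus_dir R i) g) x| <= B.
  by move=> i; apply: ih; [exact: derive_periodic|exact: smooth_derive].
exists (\sum_i `|B i|) => s x; case: (lastP s) => [//|s' i].
rewrite size_rcons => -[ss']; rewrite partials_rcons.
apply: le_trans (hB i s' x ss') _; apply: le_trans (ler_norm _) _.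
by rewrite (bigD1 i)//= lerDl sumr_ge0.
Qed.

Lemma partials_bounded_upto k g : torus_periodic g -> smooth (@torus_dir R d) g ->
  exists2 B, 0 <= B & forall s x, (size s <= k)%N -> `|partials (@torus_dir R d) s g x| <= B.
Proof.
move=> pg sg.
have /choice[B hB] : forall j, exists B, forall s x, size s = j -> `|partials (@torus_dir R d) s g x| <= B.
  by move=> j; exact: partials_bounded.
exists (\sum_(j < k.+1) `|B j|); first by apply: sumr_ge0.
move=> s x sk; apply: le_trans (hB _ s x erefl) _; apply: le_trans (ler_norm _) _.
by rewrite (bigD1 (inord (size s)))//= inordK// lerDl sumr_ge0.
Qed.

Lemma row_diff_sum (x x' : rV) : x = x' + \sum_(i < d) (x ord0 i - x' ord0 i) *: torus_dir R i.
Proof.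
apply/rowP => j; rewrite mxE summxE (bigD1 j)//= big1 ?addr0.
  by rewrite !mxE !eqxx mulr1 addrC subrK.
by move=> i ij; rewrite !mxE eqxx/= eq_sym (negbTE ij) mulr0.
Qed.

Lemma row_coord_le (x : rV) i : `|x ord0 i| <= `|x|.
Proof.
rewrite [leRHS]/Num.Def.normr/= mx_normrE.
exact: (le_bigmax _ (fun ij : 'I_1 * 'I_d => `|x ij.1 ij.2|) (ord0, i)).
Qed.

(** Finiteness gives meaning to [fine] of the norm in the constants. At distances at most 1 the
    Hoelder quotient is controlled by the Lipschitz bound, beyond by twice the supremum. *)
Lemma sobolev_norm_lty (r : R) g : 0 <= r -> torus_periodic g -> smooth (@torus_dir R d) g ->
  (sobolev_norm (@torus_dir R d) r g < +oo)%E.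
Proof.
move=> r0 pg sg; rewrite /sobolev_norm; set k := Num.truncn r; set th := r - k%:R.
have [B B0 hB] := partials_bounded_upto k.+1 pg sg.
have th0 : 0 <= th by rewrite /th subr_ge0; exact: (andP (truncn_itv r0)).1.
have th1 : th < 1 by rewrite /th ltrBlDr addrC natr1; exact: truncnS_gt.
apply: (@le_lt_trans _ _ (B%:E + (B * d%:R + 2 * B)%:E)%E); last by rewrite -EFinD ltry.
apply: leeD.
  by apply: ge_ereal_sup => _ [s [x [sk ->]]]; rewrite lee_fin; apply: hB; exact: leqW.
case: ifP => _; first by rewrite lee_fin addr_ge0// mulr_ge0.
apply: ge_ereal_sup => _ [s [x [x' [sk xx' ->]]]]; rewrite lee_fin.
have n0 : 0 < `|x - x'| by rewrite normr_gt0 subr_eq0.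
rewrite ler_pdivrMr ?powR_gt0//.
have [n1|n1] := leP `|x - x'| 1.
  apply: (@le_trans _ _ (B * (d%:R * `|x - x'|))).
    rewrite [X in partials _ _ _ X - _](row_diff_sum x x').
    have hBs (y : rV) i : `|'D_(torus_dir R i) (partials (@torus_dir R d) s g) y| <= B.
      by apply: (hB (i :: s)); rewrite /= sk.
    have := @taylor1 R _ _ (@torus_dir R d) (partials (@torus_dir R d) s g) B
      (fun x i => (sg s).2 x i) hBs (index_enum 'I_d) (fun i => x ord0 i - x' ord0 i) x'.
    move=> h; apply: le_trans h _.
    apply: ler_wpM2l => //; apply: (@le_trans _ _ (\sum_(i < d) `|x - x'|)).
      by apply: ler_sum => i _; have := row_coord_le (x - x') i; rewrite !mxE.
    by rewrite sumr_const card_ord mulr_natl.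
  rewrite mulrA mulrDl -[leLHS]addr0 lerD//; last by rewrite !mulr_ge0// powR_ge0.
  rewrite ler_wpM2l ?mulr_ge0//.
  by apply: ger1_powR; [rewrite n0 n1|exact: ltW].
apply: (@le_trans _ _ (2 * B)).
  by apply: le_trans (ler_normB _ _) _; rewrite mulrDl mul1r lerD// hB// sk.
have a1 : 1 <= `|x - x'| `^ th by rewrite -(powRr0 `|x - x'|); exact: (ler_powR (ltW n1) th0).
have p0 : 0 <= B * d%:R * `|x - x'| `^ th by rewrite !mulr_ge0// powR_ge0.
have p1 : 2 * B <= 2 * B * `|x - x'| `^ th by rewrite ler_peMr// mulr_ge0.
by rewrite mulrDl; lra.
Qed.

End PeriodicBounds.

(** * Second order differential equations *)

Section HalvingSequences.
Context {R : realType}.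

Lemma half_pow_lt (C e : R) : 0 < e -> exists k : nat, C / 2 ^+ k < e.
Proof.
move=> e0; exists (Num.truncn `|C / e|).+1.
rewrite ltr_pdivrMr ?exprn_gt0// mulrC -ltr_pdivrMr//.
apply: le_lt_trans (ler_norm _) _.
apply: lt_le_trans (truncnS_gt _) _.
rewrite -natrX ler_nat; apply/ltnW; exact: ltn_expl.
Qed.

(** The intervals with centre [u k] and radius 2C/2^k are nested; the limit is the supremum of their
    left ends. *)
Lemma half_cauchy (u : nat -> R) (C : R) :
  (forall k, `|u k.+1 - u k| <= C / 2 ^+ k) ->
  exists l, forall k, `|u k - l| <= 2 * C / 2 ^+ k.
Proof.
move=> h.
have C0 : 0 <= C by have := h 0%N; rewrite expr0 divr1; exact: le_trans.
pose r k : R := 2 * C / 2 ^+ k.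
have rS k : r k - r k.+1 = C / 2 ^+ k.
  by rewrite /r exprS; field; rewrite expf_neq0.
have step k : u k - r k <= u k.+1 - r k.+1 /\ u k.+1 + r k.+1 <= u k + r k.
  have := h k; rewrite -rS ler_norml; lra.
have homA : {homo (fun k => u k - r k) : m k / (m <= k)%N >-> m <= k}.
  by apply: homo_leq => // [x y z /le_trans|k]; [exact|have [] := step k].
have homB : {homo (fun k => u k + r k) : m k / (m <= k)%N >-> k <= m}.
  by apply: homo_leq => // [x y z /[swap] /le_trans|k]; [exact|have [] := step k].
have r0 k : 0 <= r k by rewrite /r divr_ge0 ?exprn_ge0// mulr_ge0.
have AB j k : u j - r j <= u k + r k.
  apply: (@le_trans _ _ (u (maxn j k) - r (maxn j k))); first exact/homA/leq_maxl.
  apply: (@le_trans _ _ (u (maxn j k) + r (maxn j k))); last exact/homB/leq_maxr.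
  have := r0 (maxn j k); lra.
pose A : set R := [set u k - r k | k in [set: nat]].
have A0 : A !=set0 by exists (u 0%N - r 0%N); exists 0%N.
have ubA k : ubound A (u k + r k) by move=> _ [j _ <-]; exact: AB.
exists (sup A) => k.
have h1 : u k - r k <= sup A.
  by apply: sup_upper_bound; [split => //; exists (u 0%N + r 0%N); exact: ubA|exists k].
have h2 : sup A <= u k + r k by apply: sup_le_ub => //; exact: ubA.
rewrite -/(r k) ler_norml; lra.
Qed.

End HalvingSequences.

Section MatrixContinuity.
Context {R : realType} {n d : nat} {T : topologicalType}.

Lemma mx_continuous_at (M : T -> 'M[R]_(n, d)) t :
  (forall i c, {for t, continuous (fun s => M s i c)}) -> {for t, continuous M}.
Proof.
move=> h; apply/cvgrPdist_lt => e e0.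
have : \forall s \near t, forall ic : 'I_n * 'I_d, `|M t ic.1 ic.2 - M s ic.1 ic.2| < e.
  apply: filter_forall => ic.
  by have /cvgrPdist_lt/(_ _ e0) := h ic.1 ic.2.
apply: filterS => s hs.
rewrite [X in X < _]/Num.Def.normr/= mx_normrE.
by apply/bigmax_ltP; split => // ic _; rewrite !mxE; exact: hs.
Qed.

Lemma mx_continuous (M : T -> 'M[R]_(n, d)) :
  (forall i c, continuous (fun s => M s i c)) -> continuous M.
Proof. by move=> h t; apply: mx_continuous_at => i c; exact: h. Qed.

End MatrixContinuity.

Section SecondOrderODE.
Context {R : realType} {n d : nat}.
Local Notation mx := 'M[R]_(n, d).
Implicit Types (E : R -> mx -> mx) (x y v w al : R -> mx) (B L s t T : R).

Definition regular_field B L E : Prop :=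
  [/\ forall t (x : mx) i c, `|E t x i c| <= B,
      forall t (x y : mx) D, (forall i c, `|x i c - y i c| <= D) ->
        forall i c, `|E t x i c - E t y i c| <= L * D &
      forall (x : mx) i c, continuous (fun t => E t x i c)].

(* The force is frozen at negative times, which makes trajectories C^1 curves
   on the whole line: no one-sided derivative is needed at the initial time. *)
Definition trajectory al (z : phase R n d) x v : Prop :=
  [/\ x 0 = z.1, v 0 = z.2,
      forall (t : R) i c, is_derive t 1 (fun s : R => x s i c) (v t i c) &
      forall (t : R) i c, is_derive t 1 (fun s : R => v s i c) (al t i c)].

Definition solves E (z : phase R n d) (x v : R -> mx) : Prop :=
  trajectory (fun t => E t (x (Num.max t 0))) z x v.

Lemma trajectory_exists al z : (forall i c, continuous (fun t => al t i c)) ->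
  exists x v, trajectory al z x v.
Proof.
move=> cal.
have /choice[G hG] : forall ic : 'I_n * 'I_d, exists g : R -> R, g 0 = 0 /\
    forall t : R, is_derive t 1 g (al t ic.1 ic.2).
  by move=> ic; exact: continuous_primitive.
have cG ic : continuous (G ic) by move=> t; apply: is_derive_continuous; exact: (hG ic).2.
have /choice[H hH] : forall ic : 'I_n * 'I_d, exists g : R -> R, g 0 = 0 /\
    forall t : R, is_derive t 1 g (z.2 ic.1 ic.2 + G ic t).
  move=> ic; apply: continuous_primitive => t.
  by apply: continuousD; [exact: cst_continuous|exact: cG].
exists (fun t => \matrix_(i, c) (z.1 i c + H (i, c) t)), (fun t => \matrix_(i, c) (z.2 i c + G (i, c) t)).
split.
- by apply/matrixP => i c; rewrite mxE (hH _).1 addr0.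
- by apply/matrixP => i c; rewrite mxE (hG _).1 addr0.
- move=> t i c; rewrite mxE.
  under eq_fun do rewrite mxE.
  by have := dR_add (dR_cst (z.1 i c) t 1) ((hH (i, c)).2 t); rewrite add0r.
- move=> t i c; under eq_fun do rewrite mxE.
  by have := dR_add (dR_cst (z.2 i c) t 1) ((hG (i, c)).2 t); rewrite add0r.
Qed.

Lemma trajectory_cont al z x v : trajectory al z x v -> forall i c,
  continuous (fun t => x t i c) /\ continuous (fun t => v t i c).
Proof.
by move=> [_ _ hx hv] i c; split=> t; [apply: is_derive_continuous; exact: hx|apply: is_derive_continuous; exact: hv].
Qed.

(** In the norm sup_t e^(-lam t)|.|, the map from accelerations to positions has norm at most
    1/lam^2. *)
Lemma trajectory_dist al be z x v y w (rho lam T : R) :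
  trajectory al z x v -> trajectory be z y w -> 0 <= T -> 0 < lam -> 0 <= rho ->
  (forall t i c, 0 < t < T -> `|al t i c - be t i c| <= rho * expR (lam * t)) ->
  forall i c, `|x T i c - y T i c| <= rho / lam ^+ 2 * expR (lam * T).
Proof.
move=> [x0 v0 hx hv] [y0 w0 hy hw] T0 lam0 rho0 hle i c.
apply: (@second_derive_le _ (fun t => x t i c - y t i c) (fun t => v t i c - w t i c)
  (fun t => al t i c - be t i c) _ _ _ T0 lam0 rho0 _ _ _ _ _ _ _).2.
- by apply: is_derive_within => t _; exact: dR_sub.
- by apply: is_derive_within => t _; exact: dR_sub.
- by rewrite x0 y0 subrr.
- by rewrite v0 w0 subrr.
- by move=> t; exact: hle.
Qed.

Lemma field_along_continuous B L E x : regular_field B L E ->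
  (forall i c, continuous (fun t => x t i c)) ->
  forall i c, continuous (fun t => E t (x t) i c).
Proof.
move=> [_ hL hC] cx i c t; apply/cvgrPdist_lt => e e0.
have [e' e'0 hLe] : exists2 e', 0 < e' & L * e' < e / 2.
  have a0 : 0 < `|L| + 1 by apply: ltr_wpDl.
  exists (e / 2 / (`|L| + 1)); first by rewrite !divr_gt0.
  rewrite mulrA ltr_pdivrMr// mulrC ltr_pM2l ?divr_gt0//.
  by apply: le_lt_trans (ler_norm _) _; rewrite ltrDl.
have n1 : \forall s \near nbhs (t : R), forall ic : 'I_n * 'I_d, `|x t ic.1 ic.2 - x s ic.1 ic.2| < e'.
  apply: filter_forall => ic.
  by have /cvgrPdist_lt/(_ _ e'0) := cx ic.1 ic.2 t.
have /cvgrPdist_lt/(_ (e / 2)) := hC (x t) i c t; rewrite divr_gt0// => /(_ isT) n2.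
near=> s.
have h1 : forall ic : 'I_n * 'I_d, `|x t ic.1 ic.2 - x s ic.1 ic.2| < e' by near: s.
have h2 : `|E t (x t) i c - E s (x t) i c| < e / 2 by near: s.
have h3 : `|E s (x t) i c - E s (x s) i c| <= L * e'.
  by apply: hL => j k; exact: ltW (h1 (j, k)).
have := ler_distD (E s (x t) i c) (E t (x t) i c) (E s (x s) i c); lra.
Unshelve. all: by end_near. Qed.

Lemma continuous_max0 (f : R -> R) : continuous f -> continuous (fun t => f (Num.max t 0)).
Proof.
move=> cf t; apply: continuous_comp; last exact: cf.
by apply: continuous_max; [exact: cvg_id|exact: cst_continuous].
Qed.

(** Picard iteration on all nonnegative times at once: with lam = 1 + 2L the factor L/lam^2 is at
    most 1/2, so that successive iterates differ by at most B e^(lam t)/2^k. *)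
Lemma solves_exists B L E : 0 <= B -> 0 <= L -> regular_field B L E ->
  forall z, exists x v, solves E z x v.
Proof.
move=> B0 L0 hE z; have [hB hL hC] := hE.
pose lam := 1 + 2 * L.
have lam0 : 0 < lam by rewrite /lam; lra.
have lam2 : L / lam ^+ 2 <= 1 / 2.
  rewrite ler_pdivrMr ?exprn_gt0// /lam; nra.
have lamB : B / lam ^+ 2 <= B.
  rewrite ler_pdivrMr ?exprn_gt0// ler_peMr// /lam; nra.
pose frozen (x : R -> mx) t := x (Num.max t 0).
have cfr x : (forall i c, continuous (fun t => x t i c)) ->
    forall i c, continuous (fun t => E t (frozen x t) i c).
  move=> cx; apply: field_along_continuous hE _ => i c.
  exact: (continuous_max0 (cx i c)).
(* [S] is the Picard map; its values on discontinuous paths are arbitrary. *)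
have /choice[S hS] : forall x, exists y : R -> mx, (forall i c, continuous (fun t => x t i c)) ->
    exists v, trajectory (fun t => E t (frozen x t)) z y v.
  move=> x.
  have [cx|ncx] := pselect (forall i c, continuous (fun t => x t i c)); last by exists x.
  by have [y [v h]] := trajectory_exists z (cfr _ cx); exists y => _; exists v.
have [X0 [V0 hX0]] : exists x v, trajectory (fun=> 0) z x v.
  apply: trajectory_exists => i c; exact: cst_continuous.
pose X k := iter k S X0.
have cX k : forall i c, continuous (fun t => X k t i c).
  elim: k => [|k ih] i c; first by have [] := trajectory_cont hX0 i c.
  by have [v hv] := hS _ ih; have [] := trajectory_cont hv i c.
have XS k : exists v, trajectory (fun t => E t (frozen (X k) t)) z (X k.+1) v := hS _ (cX k).
have fr (x : R -> mx) t : 0 < t -> frozen x t = x t.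
  by move=> t0; rewrite /frozen max_l// ltW.
have dX k : forall t i c, 0 <= t -> `|X k.+1 t i c - X k t i c| <= B * expR (lam * t) / 2 ^+ k.
  elim: k => [|k ih] t i c t0.
    have [v hv] := XS 0%N.
    apply: le_trans (trajectory_dist hv hX0 t0 lam0 B0 _ i c) _.
      move=> s j e /andP[s0 _]; rewrite mxE subr0; apply: le_trans (hB _ _ _ _) _.
      by rewrite ler_peMr// -expR0 ler_expR mulr_ge0// ltW.
    by rewrite expr0 divr1 ler_wpM2r// expR_ge0.
  have [v hv] := XS k; have [v' hv'] := XS k.+1.
  have Bk : 0 <= L * (B / 2 ^+ k) by rewrite mulr_ge0// divr_ge0// exprn_ge0.
  apply: le_trans (trajectory_dist hv' hv t0 lam0 Bk _ i c) _.
    move=> s j e /andP[s0 _]; rewrite !fr// -mulrA; apply: hL => p q.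
    by rewrite mulrAC; apply: ih; exact: ltW.
  rewrite [in leRHS]exprS.
  have -> : L * (B / 2 ^+ k) / lam ^+ 2 * expR (lam * t) = (B * expR (lam * t) / 2 ^+ k) * (L / lam ^+ 2).
    by field; rewrite expf_neq0//= lt0r_neq0.
  have -> : B * expR (lam * t) / (2 * 2 ^+ k) = (B * expR (lam * t) / 2 ^+ k) * (1 / 2).
    by field; rewrite expf_neq0.
  by apply: ler_wpM2l lam2; rewrite divr_ge0 ?exprn_ge0// mulr_ge0// expR_ge0.
have /choice[xi hxi] : forall t, exists y : mx, 0 <= t -> forall i c k,
    `|X k t i c - y i c| <= 2 * (B * expR (lam * t)) / 2 ^+ k.
  move=> t; have [t0|] := pselect (0 <= t); last by exists 0.
  have /choice[g hg] : forall ic : 'I_n * 'I_d, exists l, forall k,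
      `|X k t ic.1 ic.2 - l| <= 2 * (B * expR (lam * t)) / 2 ^+ k.
    by move=> ic; apply: half_cauchy => k; exact: dX.
  by exists (\matrix_(i, c) g (i, c)) => _ i c k; rewrite mxE; exact: hg (i, c) k.
(* Uniform convergence on bounded times: the index k is chosen for the time |t| + 1 and therefore
   serves every s at distance less than 1 from t. *)
have cxi i c : continuous (fun t => frozen xi t i c).
  move=> t; apply/cvgrPdist_lt => e e0.
  have e4 : 0 < e / 4 by rewrite divr_gt0.
  have [k hk] := half_pow_lt (2 * (B * expR (lam * (`|t| + 1)))) e4.
  have /cvgrPdist_lt/(_ _ e4) := continuous_max0 (@cX k i c) (x := t) => n1.
  have ap s : s <= `|t| + 1 -> `|X k (Num.max s 0) i c - frozen xi s i c| <= e / 4.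
    move=> st; apply: le_trans (ltW hk).
    apply: le_trans (hxi _ _ i c k) _; first by rewrite le_max lexx orbT.
    rewrite ler_wpM2r ?invr_ge0 ?exprn_ge0// !ler_wpM2l// ler_expR ler_wpM2l ?(ltW lam0)//.
    by rewrite ge_max st addr_ge0.
  near=> s.
  have h1 : `|X k (Num.max t 0) i c - X k (Num.max s 0) i c| < e / 4 by near: s.
  have ts : `|t - s| < 1 by near: s; have := @nbhsx_ballx R R t 1 ltr01; apply: filterS => s; rewrite -ball_normE.
  have h2 : `|X k (Num.max t 0) i c - frozen xi t i c| <= e / 4.
    by apply: ap; rewrite (le_trans (ler_norm _))// lerDl.
  have h3 : `|X k (Num.max s 0) i c - frozen xi s i c| <= e / 4.
    apply: ap; have := ler_norm s; have := ler_distD t s 0; rewrite !subr0 [`|s - t|]distrC; lra.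
  move: h1 h2 h3; rewrite !ltr_norml !ler_norml; lra.
have cE i c : continuous (fun t => E t (frozen xi t) i c).
  exact: (field_along_continuous hE cxi).
have [y [v hy]] := trajectory_exists z cE.
exists y, v.
(* [y] is driven by the force along the limit [xi]; the equation follows once both are shown to be
   limits of the iterates. *)
suff yxi t : 0 <= t -> y t = xi t.
  rewrite /solves (_ : (fun t => E t (y _)) = fun t => E t (frozen xi t))//.
  by apply/funext => t; rewrite /frozen yxi// le_max lexx orbT.
move=> t0; apply/matrixP => i c; apply/eqP; rewrite -subr_eq0 -normr_le0.
apply/ler_addgt0Pl => e e0; rewrite addr0.
have e4 : 0 < e / 2 by rewrite divr_gt0.
have [k hk] := half_pow_lt (2 * (B * expR (lam * t))) e4.
have [w hw] := XS k.
have Bk : 0 <= L * (2 * B / 2 ^+ k) by rewrite mulr_ge0// divr_ge0 ?exprn_ge0// mulr_ge0.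
have h1 : `|X k.+1 t i c - y t i c| <= e / 2.
  apply: le_trans (trajectory_dist hw hy t0 lam0 Bk _ i c) _.
    move=> s j q /andP[s0 _]; rewrite -mulrA; apply: hL => p r.
    rewrite !fr// mulrAC -[2 * B * _]mulrA; apply: hxi; exact: ltW.
  apply: le_trans (ltW hk).
  have -> : L * (2 * B / 2 ^+ k) / lam ^+ 2 * expR (lam * t) = 2 * (B * expR (lam * t)) / 2 ^+ k * (L / lam ^+ 2).
    by field; rewrite expf_neq0//= lt0r_neq0.
  rewrite ler_piMr//; last by apply: le_trans lam2 _; lra.
  by rewrite divr_ge0 ?exprn_ge0// !mulr_ge0// expR_ge0.
have h2 : `|X k.+1 t i c - xi t i c| <= e / 2.
  apply: le_trans (hxi _ t0 i c k.+1) _; apply: le_trans (ltW hk).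
  rewrite ler_wpM2l ?mulr_ge0 ?expR_ge0// lef_pV2 ?posrE ?exprn_gt0//.
  by rewrite exprS ler_peMl ?exprn_ge0//; lra.
move: h1 h2; rewrite !ler_norml; lra.
Unshelve. all: by end_near. Qed.

(** Gronwall for the squared distance. The factor n d counts the entries, each entry of the force
    difference being at most L times the square root of [S]. Both uniqueness and continuity in the
    initial point follow. *)
Lemma solves_dist B L E z z' x v x' v' : 0 <= L -> regular_field B L E ->
  solves E z x v -> solves E z' x' v' ->
  forall T, 0 <= T ->
  \sum_i \sum_c ((x T i c - x' T i c) ^+ 2 + (v T i c - v' T i c) ^+ 2) <=
  (\sum_i \sum_c ((z.1 i c - z'.1 i c) ^+ 2 + (z.2 i c - z'.2 i c) ^+ 2)) *
  expR ((2 + (n * d)%:R * L ^+ 2) * T).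
Proof.
move=> L0 [_ hL _] [x0 v0 hx hv] [x'0 v'0 hx' hv'] T T0.
pose q (t : R) := \sum_i \sum_c ((x t i c - x' t i c) ^+ 2 + (v t i c - v' t i c) ^+ 2).
pose al (t : R) i c := E t (x (Num.max t 0)) i c - E t (x' (Num.max t 0)) i c.
pose dq (t : R) := \sum_i \sum_c (2 * ((x t i c - x' t i c) * (v t i c - v' t i c)) +
   2 * ((v t i c - v' t i c) * al t i c)).
have hq (t : R) : is_derive t 1 q (dq t).
  apply: dR_sum => i _; apply: dR_sum => c _; apply: dR_add.
    have h := dR_sub (hx t i c) (hx' t i c).
    by have := dR_mul h h => /is_derive_eq; apply; ring.
  have h := dR_sub (hv t i c) (hv' t i c).
  by have := dR_mul h h => /is_derive_eq; apply; rewrite /al; ring.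
have c0 : 0 < 2 + (n * d)%:R * L ^+ 2.
  by apply: ltr_pwDl => //; rewrite mulr_ge0// exprn_ge0.
have := @gronwall R q dq _ 0 T T0 c0 (lexx _) _ (fun t _ => hq t).
rewrite mul0r addr0 /q x0 v0 x'0 v'0; apply.
  by apply: is_derive_within => t _; exact: hq.
move=> t /andP[t0 _]; rewrite addr0 -/(q t).
pose S := \sum_i \sum_c (x t i c - x' t i c) ^+ 2.
have S0 : 0 <= S by apply: sumr_ge0 => i _; apply: sumr_ge0 => c _; exact: sqr_ge0.
have Sle i c : `|x t i c - x' t i c| <= Num.sqrt S.
  rewrite -sqrtr_sqr ler_sqrt// /S (bigD1 i)//= (bigD1 c)//= -addrA lerDl addr_ge0//.
    by apply: sumr_ge0 => ? _; exact: sqr_ge0.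
  by apply: sumr_ge0 => ? _; apply: sumr_ge0 => ? _; exact: sqr_ge0.
have alS i c : (al t i c) ^+ 2 <= L ^+ 2 * S.
  rewrite -[in leRHS](sqr_sqrtr S0) -exprMn -[leLHS]real_normK ?num_real//.
  rewrite lerXn2r ?nnegrE ?mulr_ge0 ?sqrtr_ge0// /al max_l ?(ltW t0)//.
  exact: hL.
have Sq : S <= q t.
  by apply: ler_sum => i _; apply: ler_sum => c _; rewrite lerDl sqr_ge0.
apply: (@le_trans _ _ (\sum_i \sum_c (2 * ((x t i c - x' t i c) ^+ 2 + (v t i c - v' t i c) ^+ 2) + L ^+ 2 * S))).
  apply: ler_sum => i _; apply: ler_sum => c _.
  have := alS i c.
  move: (al t i c) (x t i c - x' t i c) (v t i c - v' t i c) => a b e H.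
  have := sqr_ge0 (b - e); have := sqr_ge0 (e - a); nra.
under eq_bigr => i _ do rewrite big_split/= -mulr_sumr sumr_const card_ord.
rewrite big_split/= -mulr_sumr sumr_const card_ord -/(q t).
rewrite [leRHS]mulrDl lerD2l -mulrnA -[leLHS]mulr_natl mulnC -[leRHS]mulrA.
by rewrite ler_wpM2l// ler_wpM2l// exprn_ge0.
Qed.

End SecondOrderODE.

(** * Measure preserving maps *)

Section MeasurePreserving.
Local Open Scope ereal_scope.
Context d1 d2 (T1 : measurableType d1) (T2 : measurableType d2) (R : realType).

Definition measure_preserving (mu1 : set T1 -> \bar R) (mu2 : set T2 -> \bar R)
    (phi : T1 -> T2) : Prop :=
  measurable_fun setT phi /\ forall A, measurable A -> mu1 (phi @^-1` A) = mu2 A.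

Variables (mu1 : {measure set T1 -> \bar R}) (mu2 : {measure set T2 -> \bar R}).
Variable phi : T1 -> T2.
Hypothesis pphi : measure_preserving mu1 mu2 phi.

Lemma ge0_integral_preserving (f : T2 -> \bar R) :
  measurable_fun setT f -> (forall y, 0 <= f y) ->
  \int[mu1]_x f (phi x) = \int[mu2]_y f y.
Proof.
move=> mf f0; have [mphi h] := pphi.
pose phi' : {mfun T1 >-> T2} := HB.pack phi (isMeasurableFun.Build _ _ _ _ _ mphi).
transitivity (\int[pushforward mu1 phi]_y f y).
  by rewrite ge0_integral_pushforward// => y _; exact: f0.
by apply: (@eq_measure_integral _ _ _ _ mu2 (pushforward mu1 phi')) => A mA _; exact: h.
Qed.

Lemma integral_preserving (f : T2 -> \bar R) :
  measurable_fun setT f ->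
  \int[mu1]_x f (phi x) = \int[mu2]_y f y.
Proof.
move=> mf; rewrite [LHS]integralE [RHS]integralE.
congr (_ - _).
  rewrite -(@ge0_integral_preserving f^\+)//; last exact: measurable_funepos.
  by apply: eq_integral => x _; rewrite unlock.
rewrite -(@ge0_integral_preserving f^\-)//; last exact: measurable_funeneg.
by apply: eq_integral => x _; rewrite unlock.
Qed.

End MeasurePreserving.

Section PowerMeasure.
Local Open Scope ereal_scope.
Context d (T : measurableType d) (R : realType).
Variable mu : {sigma_finite_measure set T -> \bar R}.

Definition box n (A : 'I_n -> set T) : set (n.-tuple T) :=
  [set t | forall i, A i (tnth t i)].

Lemma measurable_box n (A : 'I_n -> set T) :
  (forall i, measurable (A i)) -> measurable (box A).
Proof.
move=> mA; rewrite (_ : box A = \bigcap_(i in [set: 'I_n]) ((@tnth n T ^~ i) @^-1` A i)).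
  apply: fin_bigcap_measurable => // i _.
  by rewrite -[X in measurable X]setTI; exact: measurable_tnth.
by apply/seteqP; split=> t h i; [move=> _|]; exact: h.
Qed.

Lemma power_measure_box n (A : 'I_n -> set T) : (forall i, measurable (A i)) ->
  power_measure mu n (box A) = \prod_(i < n) mu (A i).
Proof.
elim: n A => [|n ih] A mA.
  rewrite big_ord0 /= diracE mem_set//.
  by case.
rewrite /= /cons_measure /pushforward.
rewrite (_ : _ @^-1` _ = A ord0 `*` box (A \o lift ord0)); last first.
  apply/seteqP; split=> -[x t]/= h.
    by split=> [|i]; [exact: (h ord0)|have := h (lift ord0 i); rewrite tnthS].
  by move=> i; case: (unliftP ord0 i) => [j|] ->; [rewrite tnthS; exact: h.2|exact: h.1].
rewrite product_measure1E//; last by apply: measurable_box => i; exact: mA.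
by rewrite big_ord_recl; congr (_ * _); apply: ih => i; exact: mA.
Qed.

(** Boxes are stable under intersection and generate the tuple sigma-algebra, and boxes over an
    increasing exhaustion have finite measure. *)
Lemma power_measure_unique n (nu : {measure set (n.-tuple T) -> \bar R}) :
  (forall A : 'I_n -> set T, (forall i, measurable (A i)) ->
     nu (box A) = \prod_(i < n) mu (A i)) ->
  forall X, measurable X -> power_measure mu n X = nu X.
Proof.
move=> h; have /sigma_finiteP[F [TF ndF Foo]] := sigma_finiteT mu.
pose G : set (set (n.-tuple T)) :=
  [set X | exists A : 'I_n -> set T, (forall i, measurable (A i)) /\ X = box A].
apply: (measure_unique G (fun k => box (fun=> F k))).
- apply/seteqP; split.
    apply: smallest_sub; first exact: smallest_sigma_algebra.
    move=> X; rewrite -bigcup_seq => -[i _ [B mB <-]].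
    apply: sub_gen_smallest; exists (fun j => if j == i then B else setT); split.
      by move=> j; case: ifP.
    apply/seteqP; split=> t /=.
      by rewrite /box/= => -[_ Bt] j; case: eqP => // ->.
    by move=> /(_ i); rewrite eqxx.
  apply: smallest_sub; first exact: sigma_algebra_measurable.
  by move=> _ [A [mA ->]]; exact: measurable_box.
- move=> _ _ [A [mA ->]] [B [mB ->]]; exists (fun i => A i `&` B i); split.
    by move=> i; exact: measurableI.
  by apply/seteqP; split=> [t [ha hb] i|t hab]; [|split=> i; have [] := hab i].
- by move=> k; exists (fun=> F k); split=> // _; exact: (Foo k).1.
- apply/seteqP; split=> // t _.
  have /choice[k hk] : forall i, exists k, F k (tnth t i).
    by move=> i; have : setT (tnth t i) by []; rewrite TF => -[k _ ?]; exists k.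
  (* The exhaustion is increasing, so the largest of the n indices serves all coordinates. *)
  exists (\max_(i < n) k i)%N => // i.
  by move: (tnth t i) (hk i); apply/subsetPset/ndF; exact: leq_bigmax.
- by move=> _ [A [mA ->]]; rewrite h//; exact: power_measure_box.
- move=> k; rewrite /= power_measure_box; last by move=> _; exact: (Foo k).1.
  suff : 0 <= \prod_(i < n) mu (F k) /\ \prod_(i < n) mu (F k) < +oo by case.
  elim/big_ind : _ => [|x y [x0 xoo] [y0 yoo]|i _].
  + by split; [exact: lee01|exact: ltry].
  + by split; [exact: mule_ge0|rewrite lte_mul_pinfty// ge0_fin_numE].
  + by split; [exact: measure_ge0|exact: (Foo k).2].
Qed.

(** Translations, permutations and mergings of coordinates then only have to be checked on boxes. *)
Lemma preserving_power d1 (T1 : measurableType d1) (m1 : {measure set T1 -> \bar R})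
    n (phi : T1 -> n.-tuple T) :
  (forall i, measurable_fun setT (fun x => tnth (phi x) i)) ->
  (forall A : 'I_n -> set T, (forall i, measurable (A i)) ->
     m1 [set x | forall i, A i (tnth (phi x) i)] = \prod_(i < n) mu (A i)) ->
  measure_preserving m1 (power_measure mu n) phi.
Proof.
move=> mt h; have mphi : measurable_fun setT phi by apply/measurable_fun_tnthP => i; exact: mt.
split=> // A mA.
pose phi' : {mfun T1 >-> n.-tuple T} := HB.pack phi (isMeasurableFun.Build _ _ _ _ _ mphi).
by rewrite (@power_measure_unique n (pushforward m1 phi')).
Qed.

Lemma preserving_map n (psi : 'I_n -> T -> T) :
  (forall i, measure_preserving mu mu (psi i)) ->
  measure_preserving (power_measure mu n) (power_measure mu n)
    (fun t => [tuple psi i (tnth t i) | i < n]).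
Proof.
move=> h; apply: preserving_power => [i|A mA].
  under eq_fun do rewrite tnth_mktuple.
  by apply: (measurableT_comp (h i).1); exact: measurable_tnth.
rewrite (_ : [set _ | _] = box (fun i => psi i @^-1` A i)); last first.
  by apply/seteqP; split=> t H i; have := H i; rewrite tnth_mktuple.
transitivity (\prod_(i < n) mu (psi i @^-1` A i)).
  apply: power_measure_box => i.
  by rewrite -[X in measurable X]setTI; exact: (h i).1.
by apply: eq_bigr => i _; exact: (h i).2.
Qed.

Lemma preserving_perm n (s : 'I_n -> 'I_n) : bijective s ->
  measure_preserving (power_measure mu n) (power_measure mu n)
    (fun t => [tuple tnth t (s i) | i < n]).
Proof.
move=> [s' ss' s's]; apply: preserving_power => [i|A mA].
  by under eq_fun do rewrite tnth_mktuple; exact: measurable_tnth.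
rewrite (_ : [set _ | _] = box (A \o s')); last first.
  apply/seteqP; split=> t H i /=.
    by have := H (s' i); rewrite tnth_mktuple s's.
  by have := H (s i); rewrite /= tnth_mktuple ss'.
transitivity (\prod_(i < n) mu (A (s' i))); first by apply: power_measure_box => i; exact: mA.
by rewrite [RHS](reindex s')//; exists s => i _.
Qed.

(** [e] tells from which of the two tuples each coordinate is taken. *)
Lemma preserving_merge k m n (e : 'I_k -> 'I_m + 'I_n) : bijective e ->
  measure_preserving (power_measure mu m \x power_measure mu n) (power_measure mu k)
    (fun st => [tuple match e i with inl x => tnth st.1 x | inr y => tnth st.2 y end | i < k]).
Proof.
move=> [e' ee' e'e]; apply: preserving_power => [i|A mA].
  under eq_fun do rewrite tnth_mktuple.
  case: (e i) => j.
    by apply: (measurableT_comp (measurable_tnth j)); exact: measurable_fst.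
  by apply: (measurableT_comp (measurable_tnth j)); exact: measurable_snd.
rewrite (_ : [set _ | _] = box (fun x => A (e' (inl x))) `*` box (fun y => A (e' (inr y)))); last first.
  apply/seteqP; split=> -[u v] /= H.
    by split=> j; [have := H (e' (inl j))|have := H (e' (inr j))]; rewrite tnth_mktuple e'e.
  move=> i; rewrite tnth_mktuple; case: H => H1 H2; case E : (e i) => [j|j].
    by have := H1 j; rewrite -E ee'.
  by have := H2 j; rewrite -E ee'.
transitivity (power_measure mu m (box (fun x => A (e' (inl x)))) *
  power_measure mu n (box (fun y => A (e' (inr y))))).
  by apply: product_measure1E; apply: measurable_box => j; exact: mA.
rewrite !power_measure_box; [|by move=> j; exact: mA..].
rewrite [RHS](reindex e'); last by exists e => i _.
by rewrite big_sumType.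
Qed.

End PowerMeasure.

Section ProductSigmaFinite.
Local Open Scope ereal_scope.
Context d1 d2 (T1 : measurableType d1) (T2 : measurableType d2) (R : realType).
Variables (m1 : {sigma_finite_measure set T1 -> \bar R})
  (m2 : {sigma_finite_measure set T2 -> \bar R}).

Let prod_measure : {measure set (T1 * T2)%type -> \bar R} := m1 \x m2.

Lemma product_sigma_finite : sigma_finite setT prod_measure.
Proof.
have /sigma_finiteP[F [TF ndF Foo]] := sigma_finiteT m1.
have /sigma_finiteP[G [TG ndG Goo]] := sigma_finiteT m2.
exists (fun k => F k `*` G k).
  apply/seteqP; split=> // -[x y] _.
  have : setT x by []; have : setT y by []; rewrite TF TG => -[j _ Gy] [i _ Fx].
  exists (maxn i j) => //; split=> /=.
    by move: x Fx; exact/subsetPset/ndF/leq_maxl.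
  by move: y Gy; exact/subsetPset/ndG/leq_maxr.
move=> k; have [? ?] := Foo k; have [? ?] := Goo k.
split; first exact: measurableX.
by rewrite /prod_measure /= product_measure1E// lte_mul_pinfty// ge0_fin_numE.
Qed.

(** The product carries its sigma-finiteness so that Fubini applies again to products of
    products. *)
Definition product_sigma_measure : {sigma_finite_measure set (T1 * T2)%type -> \bar R} :=
  HB.pack (m1 \x m2) (Measure_isSigmaFinite.Build _ _ _ prod_measure product_sigma_finite).

End ProductSigmaFinite.

Section ProductPreserving.
Local Open Scope ereal_scope.
Context d1 d2 d3 d4 (T1 : measurableType d1) (T2 : measurableType d2)
  (T3 : measurableType d3) (T4 : measurableType d4) (R : realType).
Variables (m1 : {sigma_finite_measure set T1 -> \bar R})
  (m2 : {sigma_finite_measure set T2 -> \bar R})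
  (m3 : {sigma_finite_measure set T3 -> \bar R})
  (m4 : {sigma_finite_measure set T4 -> \bar R}).

Lemma preserving_prod (phi : T1 -> T3) (psi : T2 -> T4) :
  measure_preserving m1 m3 phi -> measure_preserving m2 m4 psi ->
  measure_preserving (m1 \x m2) (m3 \x m4) (fun xy => (phi xy.1, psi xy.2)).
Proof.
move=> [mphi hphi] [mpsi hpsi].
have mpp : measurable_fun setT (fun xy : T1 * T2 => (phi xy.1, psi xy.2)).
  apply: measurable_fun_pair => /=.
    by apply: (measurableT_comp mphi); exact: measurable_fst.
  by apply: (measurableT_comp mpsi); exact: measurable_snd.
split=> // X mX.
pose phi' : {mfun (T1 * T2)%type >-> (T3 * T4)%type} := HB.pack (fun xy : T1 * T2 => (phi xy.1, psi xy.2))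
  (isMeasurableFun.Build _ _ _ _ _ mpp).
rewrite (@product_measure_unique _ _ _ _ _ m3 m4 (pushforward (m1 \x m2) phi'))//.
move=> A B mA mB; rewrite /= /pushforward /=.
rewrite (_ : _ @^-1` _ = (phi @^-1` A) `*` (psi @^-1` B))//.
rewrite -(hphi _ mA) -(hpsi _ mB); apply: product_measure1E.
  by rewrite -[X in measurable X]setTI; exact: mphi.
by rewrite -[X in measurable X]setTI; exact: mpsi.
Qed.

(** Phase space lists all positions before all velocities, whereas splitting off a particle groups
    its position with its velocity. Tonelli reduces the regrouping to an exchange of the two middle
    variables. *)
Lemma ge0_integral_shuffle (f : (T1 * T2) * (T3 * T4) -> \bar R) :
  measurable_fun setT f -> (forall w, 0 <= f w) ->
  \int[(m1 \x m3) \x (m2 \x m4)]_w f ((w.1.1, w.2.1), (w.1.2, w.2.2)) =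
  \int[(m1 \x m2) \x (m3 \x m4)]_w f w.
Proof.
move=> mf f0.
pose g (w : (T1 * T3) * (T2 * T4)) := f ((w.1.1, w.2.1), (w.1.2, w.2.2)).
have mg : measurable_fun setT g.
  apply: (measurableT_comp mf); apply: measurable_fun_pair; apply: measurable_fun_pair.
  - exact: (measurableT_comp measurable_fst measurable_fst).
  - exact: (measurableT_comp measurable_fst measurable_snd).
  - exact: (measurableT_comp measurable_snd measurable_fst).
  - exact: (measurableT_comp measurable_snd measurable_snd).
have g0 w : 0 <= g w by exact: f0.
pose m34 := product_sigma_measure m3 m4.
pose m24 := product_sigma_measure m2 m4.
have mF1 := @measurable_fun_fubini_tonelli_F _ _ _ _ _ m34 f mf f0.
have mG1 := @measurable_fun_fubini_tonelli_F _ _ _ _ _ m24 g mg g0.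
transitivity (\int[m1 \x m3]_w fubini_F m24 g w).
  exact: (@fubini_tonelli1 _ _ _ _ _ (product_sigma_measure m1 m3) m24 g mg g0).
transitivity (\int[m1 \x m2]_w fubini_F m34 f w); last first.
  apply/esym; exact: (@fubini_tonelli1 _ _ _ _ _ (product_sigma_measure m1 m2) m34 f mf f0).
transitivity (\int[m1]_a \int[m3]_c fubini_F m24 g (a, c)).
  apply: (@fubini_tonelli1 _ _ _ _ _ m1 m3 (fubini_F m24 g) mG1) => w.
  by apply: integral_ge0 => y _; exact: g0.
transitivity (\int[m1]_a \int[m2]_b fubini_F m34 f (a, b)); last first.
  apply/esym; apply: (@fubini_tonelli1 _ _ _ _ _ m1 m2 (fubini_F m34 f) mF1) => w.
  by apply: integral_ge0 => y _; exact: f0.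
apply: eq_integral => a _; rewrite /fubini_F.
transitivity (\int[m3]_c \int[m2]_b \int[m4]_e f ((a, b), (c, e))).
  apply: eq_integral => c _.
  apply: (@fubini_tonelli1 _ _ _ _ _ m2 m4 (fun y => g (a, c, y))) => //.
  by apply: (measurableT_comp mg); exact: measurable_pair1.
transitivity (\int[m2]_b \int[m3]_c \int[m4]_e f ((a, b), (c, e))); last first.
  apply: eq_integral => b _.
  apply/esym/(@fubini_tonelli1 _ _ _ _ _ m3 m4 (fun y => f (a, b, y))) => //.
  by apply: (measurableT_comp mf); exact: measurable_pair1.
pose h (w : (T3 * T2) * T4) := f ((a, w.1.2), (w.1.1, w.2)).
have mh : measurable_fun setT h.
  apply: (measurableT_comp mf); apply: measurable_fun_pair; apply: measurable_fun_pair.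
  - exact: measurable_cst.
  - exact: (measurableT_comp measurable_snd measurable_fst).
  - exact: (measurableT_comp measurable_fst measurable_fst).
  - exact: measurable_snd.
have h0 w : 0 <= h w by exact: f0.
have mH := @measurable_fun_fubini_tonelli_F _ _ _ _ _ m4 h mh h0.
by apply: (@fubini_tonelli _ _ _ _ _ m3 m2 _ mH) => w; apply: integral_ge0.
Qed.

End ProductPreserving.

(** * Translations of the line and of the circle *)

Section Translations.
Local Open Scope ereal_scope.
Context {R : realType}.
Local Notation line := (measurableTypeR R).

Lemma measurable_shift (a : R) : measurable_fun [set: line] (fun y : line => (y + a)%R : line).
Proof.
have h : @measurable_fun _ _ (measurableTypeR R) (measurableTypeR R) setT ((@id R) \+ cst a)%R.
  by apply: measurable_funD.
exact: h.
Qed.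

Lemma line_shift_preserving (a : R) :
  measure_preserving (line_measure R) (line_measure R) (fun y => y + a)%R.
Proof.
have ms := measurable_shift a.
split=> // A mA.
pose phi : {mfun line >-> line} := HB.pack (fun y : line => (y + a)%R : line)
  (isMeasurableFun.Build _ _ _ _ _ ms).
apply/esym; apply: (@lebesgue_measure_unique R (pushforward lebesgue_measure phi)) => //.
move=> _ [[b c] _ <-]; rewrite /pushforward.
rewrite [X in _ = lebesgue_measure X](_ : _ = `](b - a)%R, (c - a)%R]%classic); last first.
  by apply/seteqP; split=> y; rewrite /= !in_itv/= ltrBlDr lerBrDr.
rewrite !lebesgue_measure_itv/= !lte_fin ltrD2r.
by congr (if _ then _ else _); rewrite -!EFinD; congr EFin; ring.
Qed.

(** Rotation of the circle read in the fundamental domain [0,1): [s] is the fractional part of a,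
    and 1 is subtracted when y + s leaves the domain. Points outside [0,1) are not charged by
    [circle_measure]. *)
Definition circle_shift (a y : R) : R :=
  let s := (a - (Num.floor a)%:~R)%R in
  if (y < 1 - s)%R then (y + s)%R else (y + (s - 1))%R.

Lemma circle_shift_int (a y : R) : exists k : int, circle_shift a y = (y + a + k%:~R)%R.
Proof.
rewrite /circle_shift; case: ifP => _.
  by exists (- Num.floor a)%R; rewrite rmorphN /= addrA.
by exists (- Num.floor a - 1)%R; rewrite rmorphB rmorphN /= !addrA.
Qed.

Lemma measurable_circle_shift (a : R) :
  measurable_fun [set: line] (circle_shift a : line -> line).
Proof.
pose s := (a - (Num.floor a)%:~R)%R.
have m1 : measurable_fun [set: line] (fun y : line => (y < 1 - s)%R).
  have h : @measurable_fun _ _ (measurableTypeR R) bool setT (fun x => (@id R x < cst (1 - s) x)%R).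
    by apply: measurable_fun_ltr.
  exact: h.
exact: (@measurable_fun_ifT _ _ line line (fun y => y + s)%R (fun y => y + (s - 1))%R
  (fun y => y < 1 - s)%R m1 (measurable_shift s) (measurable_shift (s - 1)%R)).
Qed.

(** The preimage of A in [0,1) is the disjoint union of a translate of A in [s,1) and a translate of
    A in [0,s). *)
Lemma circle_shift_preserving (a : R) :
  measure_preserving (circle_measure R) (circle_measure R) (circle_shift a).
Proof.
have ms := measurable_circle_shift a.
split=> // A mA.
have mpre : measurable (circle_shift a @^-1` A : set line) by rewrite -[X in measurable X]setTI; exact: ms.
rewrite /circle_measure /= /mfrestr /mrestr /=.
pose s := (a - (Num.floor a)%:~R)%R.
have /andP[s0 s1] : (0 <= s < 1)%R.
  by have := floor_itv a; rewrite /s intrD; lra.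
have mC : measurable (A `&` `[s, 1%R[ : set line) by apply: measurableI => //; exact: measurable_itv.
have mD : measurable (A `&` `[0%R, s[ : set line) by apply: measurableI => //; exact: measurable_itv.
have preE (b : R) (C : set line) : measurable C -> line_measure R ((fun y => y + b)%R @^-1` C) = line_measure R C.
  exact: (line_shift_preserving b).2.
rewrite [X in line_measure R X](_ : _ = ((fun y => y + s)%R @^-1` (A `&` `[s, 1%R[)) `|`
   ((fun y => y + (s - 1))%R @^-1` (A `&` `[0%R, s[))); last first.
  apply/seteqP; split=> y /=; rewrite /unit_interval /= /circle_shift -/s !in_itv /=.
    move=> [+ /andP[y0 y1]]; case: ifPn => [ys Ay|]; first by left; split => //; apply/andP; split; lra.
    by rewrite -leNgt => ys Ay; right; split => //; apply/andP; split; lra.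
  move=> [|] [Ay /andP[h1 h2]]; split; try (apply/andP; split; lra).
    by rewrite ifT//; lra.
  by rewrite ifF//; apply/negbTE; rewrite -leNgt; lra.
transitivity (line_measure R (A `&` `[s, 1%R[) + line_measure R (A `&` `[0%R, s[)).
  rewrite -(preE s _ mC) -(preE (s - 1)%R _ mD); apply: measureU.
  - by rewrite -[X in measurable X]setTI; exact: measurable_shift.
  - by rewrite -[X in measurable X]setTI; exact: measurable_shift.
  - by apply/seteqP; split=> y //= [[_ +] [_]]; rewrite !in_itv/=; lra.
rewrite -measureU//; last first.
  by apply/seteqP; split=> y //= [[_ +] [_]]; rewrite !in_itv/=; lra.
congr (line_measure R _); apply/seteqP; split=> y /=; rewrite /unit_interval /= !in_itv/=.
  by move=> [|] [Ay /andP[h1 h2]]; split=> //; lra.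
move=> [Ay /andP[h1 h2]]; have [ys|ys] := ltP y s; [right|left]; split=> //; lra.
Qed.

End Translations.

Section FiniteCoordinates.
Context {R : realType} dT (T : measurableType dT) (J : finType).
Variable c : J -> T -> R.
Hypothesis mc : forall j, measurable_fun setT (c j).

Let dyadic (k : nat) (y : R) : R := (Num.floor (2 ^+ k * y))%:~R / 2 ^+ k.

Let dyadic_cvg y : dyadic ^~ y @ \oo --> y.
Proof.
have h k : `|y - dyadic k y| <= 1 / 2 ^+ k.
  have p : (0 : R) < 2 ^+ k by rewrite exprn_gt0.
  have -> : y - dyadic k y = (2 ^+ k * y - (Num.floor (2 ^+ k * y))%:~R) / 2 ^+ k.
    by rewrite /dyadic; field; rewrite gt_eqF.
  have := floor_itv (2 ^+ k * y); rewrite intrD => /andP[h1 h2].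
  rewrite normrM normfV (gtr0_norm p) ler_wpM2r ?invr_ge0 ?(ltW p)//.
  by rewrite ger0_norm; lra.
apply/cvgrPdist_lt => e e0; have [K hK] := half_pow_lt 1 e0.
exists K => // k /= Kk; apply: le_lt_trans (h k) _; apply: le_lt_trans hK.
by rewrite ler_wpM2l// lef_pV2 ?posrE ?exprn_gt0// ler_weXn2l// ler1n.
Qed.

(** Links the topology of matrices to the product sigma-algebra of tuples. The function is the
    pointwise limit of its values at dyadic roundings of the coordinates; each rounding takes
    countably many values, coded by [pickle], on measurable sets. *)
Lemma measurable_of_coords (f : (J -> R) -> R) :
  (forall (u : nat -> J -> R) (v : J -> R), (forall j, u ^~ j @ \oo --> v j) ->
     f \o u @ \oo --> f v) ->
  measurable_fun setT (fun w => f (c ^~ w)).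
Proof.
move=> cf.
pose g k w := f (fun j => dyadic k (c j w)).
apply: (@measurable_fun_cvg _ _ _ setT g) => [k|w _]; last first.
  by apply: cf => j; exact: dyadic_cvg.
move=> _ Y mY; rewrite setTI.
pose fl w : {ffun J -> int} := [ffun j => Num.floor (2 ^+ k * c j w)].
pose H (p : {ffun J -> int}) := f (fun j => (p j)%:~R / 2 ^+ k).
have gE w : g k w = H (fl w).
  by congr f; apply/funext => j; rewrite ffunE.
rewrite (_ : _ @^-1` _ = \bigcup_(i in [set i | exists2 p, unpickle i = Some p & Y (H p)])
   [set w | unpickle i = Some (fl w)]); last first.
  apply/seteqP; split=> w /=.
    by rewrite gE => h; exists (pickle (fl w)) => /=; [exists (fl w) => //|]; rewrite pickleK.
  by move=> [i [p -> h] [E]]; rewrite gE -E.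
apply: bigcup_measurable => i _.
case E : (unpickle i : option {ffun J -> int}) => [p|]; last first.
  by rewrite (_ : [set _ | _] = set0)//; apply/seteqP; split.
rewrite (_ : [set _ | _] = \bigcap_(j in [set: J]) (c j @^-1` `[(p j)%:~R / 2 ^+ k, (p j + 1)%:~R / 2 ^+ k[)).
  apply: fin_bigcap_measurable => // j _; rewrite -[X in measurable X]setTI.
  by apply: mc => //; exact: measurable_itv.
have p2 : (0 : R) < 2 ^+ k by rewrite exprn_gt0.
apply/seteqP; split=> w /=.
  move=> [->] j _ /=; rewrite ffunE in_itv/= ler_pdivrMr// ltr_pdivlMr// ![c j w * _]mulrC.
  exact: floor_itv.
move=> h; congr Some; apply/ffunP => j; rewrite ffunE; apply/esym/eqP; rewrite floor_eq.
by have := h j I; rewrite /= in_itv/= ler_pdivrMr// ltr_pdivlMr// ![c j w * _]mulrC.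
Qed.

End FiniteCoordinates.

(** * Continuous functions and shears on phase space *)

Lemma cont_comp {T U V : topologicalType} (f : T -> U) (g : U -> V) :
  continuous f -> continuous g -> continuous (fun x => g (f x)).
Proof. by move=> cf cg x; apply: continuous_comp; [exact: cf|exact: cg]. Qed.

Section ContinuousReal.
Context {R : realType} {T : topologicalType}.
Implicit Types f g : T -> R.

Lemma cont_cst (a : R) : continuous (fun _ : T => a).
Proof. exact: cst_continuous. Qed.

Lemma cont_add f g : continuous f -> continuous g -> continuous (fun x => f x + g x).
Proof. by move=> cf cg x; apply: continuousD; [exact: cf|exact: cg]. Qed.

Lemma cont_sub f g : continuous f -> continuous g -> continuous (fun x => f x - g x).
Proof. by move=> cf cg x; apply: continuousB; [exact: cf|exact: cg]. Qed.

Lemma cont_mul f g : continuous f -> continuous g -> continuous (fun x => f x * g x).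
Proof. by move=> cf cg x; apply: continuousM; [exact: cf|exact: cg]. Qed.

Lemma cont_opp f : continuous f -> continuous (fun x => - f x).
Proof. by move=> cf x; apply: continuousN; exact: cf. Qed.

Lemma cont_min f g : continuous f -> continuous g -> continuous (fun x => Num.min (f x) (g x)).
Proof. by move=> cf cg x; exact: (continuous_min (cf x) (cg x)). Qed.

Lemma cont_max f g : continuous f -> continuous g -> continuous (fun x => Num.max (f x) (g x)).
Proof. by move=> cf cg x; exact: (continuous_max (cf x) (cg x)). Qed.

Lemma cont_norm f : continuous f -> continuous (fun x => `|f x|).
Proof. by move=> cf; exact: (cont_comp cf (@norm_continuous _ R)). Qed.

Lemma cont_sum (I : Type) (s : seq I) (P : pred I) (f : I -> T -> R) :
  (forall i, P i -> continuous (f i)) -> continuous (fun x => \sum_(i <- s | P i) f i x).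
Proof.
move=> h; elim: s => [|i s ih].
  by under eq_fun do rewrite big_nil; exact: cont_cst.
under eq_fun do rewrite big_cons.
have [Pi|_ //] := boolP (P i).
exact: cont_add (h _ Pi) ih.
Qed.

Lemma cont_prod (I : Type) (s : seq I) (P : pred I) (f : I -> T -> R) :
  (forall i, P i -> continuous (f i)) -> continuous (fun x => \prod_(i <- s | P i) f i x).
Proof.
move=> h; elim: s => [|i s ih].
  by under eq_fun do rewrite big_nil; exact: cont_cst.
under eq_fun do rewrite big_cons.
have [Pi|_ //] := boolP (P i).
exact: cont_mul (h _ Pi) ih.
Qed.

End ContinuousReal.

Section PhaseCoordinates.
Context {R : realType}.

Lemma mx_cvg {T : Type} (F : set_system T) {FF : Filter F} (n d : nat)
    (M : T -> 'M[R]_(n, d)) (l : 'M[R]_(n, d)) :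
  (forall i c, (fun s => M s i c) @ F --> l i c) -> M @ F --> l.
Proof.
move=> h; apply/cvgrPdist_lt => e e0.
have : \forall s \near F, forall ic : 'I_n * 'I_d, `|l ic.1 ic.2 - M s ic.1 ic.2| < e.
  apply: filter_forall => ic.
  by have /cvgrPdist_lt/(_ _ e0) := h ic.1 ic.2.
apply: filterS => s hs.
rewrite [X in X < _]/Num.Def.normr/= mx_normrE.
by apply/bigmax_ltP; split => // ic _; rewrite !mxE; exact: hs.
Qed.

Context {n d : nat}.
Local Notation coords := ((n * d).-tuple (measurableTypeR R)).
Local Notation Ph := (phase R n d).
Implicit Types (f g : Ph -> R).

Lemma phase_cvg {T : Type} (F : set_system T) {FF : Filter F} (X V : T -> 'M[R]_(n, d)) (z : Ph) :
  (forall i c, (fun s => X s i c) @ F --> z.1 i c) ->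
  (forall i c, (fun s => V s i c) @ F --> z.2 i c) ->
  (fun s => (X s, V s)) @ F --> z.
Proof.
move=> hx hv; case: z hx hv => x v /= hx hv.
exact: (@cvg_pair _ _ _ F (nbhs x) (nbhs v) _ _ _ X V (mx_cvg hx) (mx_cvg hv)).
Qed.

Lemma phase_continuous (T : topologicalType) (X V : T -> 'M[R]_(n, d)) :
  (forall i c, continuous (fun s => X s i c)) ->
  (forall i c, continuous (fun s => V s i c)) ->
  continuous (fun s => (X s, V s) : Ph).
Proof. by move=> hx hv t; apply: phase_cvg => i c; [exact: hx|exact: hv]. Qed.

Lemma continuous_phase1 : continuous (fun z : Ph => z.1).
Proof. by move=> [x v]; exact: cvg_fst. Qed.

Lemma continuous_phase2 : continuous (fun z : Ph => z.2).
Proof. by move=> [x v]; exact: cvg_snd. Qed.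

Lemma continuous_pos i c : continuous (fun z : Ph => z.1 i c).
Proof.
move=> z; apply: (@continuous_comp _ _ _ (fun z : Ph => z.1) (fun M : 'M[R]_(n, d) => M i c)).
  exact: continuous_phase1.
exact: coord_continuous.
Qed.

Lemma continuous_vel i c : continuous (fun z : Ph => z.2 i c).
Proof.
move=> z; apply: (@continuous_comp _ _ _ (fun z : Ph => z.2) (fun M : 'M[R]_(n, d) => M i c)).
  exact: continuous_phase2.
exact: coord_continuous.
Qed.

Lemma mx_of_coordsE (t : coords) i c : mx_of_coords t i c = tnth t (mxvec_index i c).
Proof. by rewrite !mxE. Qed.

Lemma measurable_phase_fun f : continuous f ->
  measurable_fun setT (f \o @phase_of_coords R n d).
Proof.
move=> cf.
pose J : finType := ('I_n * 'I_d + 'I_n * 'I_d)%type.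
pose c (j : J) (w : coords * coords) : R := match j with
  | inl ic => tnth w.1 (mxvec_index ic.1 ic.2)
  | inr ic => tnth w.2 (mxvec_index ic.1 ic.2) end.
pose M (u : J -> R) : Ph := (\matrix_(i, c) u (inl (i, c)), \matrix_(i, c) u (inr (i, c))).
pose F (u : J -> R) := f (M u).
have mc j : measurable_fun setT (c j).
  case: j => ic; apply: (measurableT_comp (measurable_tnth _)).
    exact: measurable_fst.
  exact: measurable_snd.
have := @measurable_of_coords R _ _ J c mc F.
rewrite (_ : (fun w => F (c^~ w)) = f \o @phase_of_coords R n d).
  apply=> u v uv; have Muv : M \o u @ \oo --> M v.
    by apply: phase_cvg => i e /=; rewrite mxE; under eq_fun do rewrite mxE; exact: uv.
  exact: (cvg_comp _ _ Muv (cf (M v))).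
apply/funext => w; congr f; congr pair; apply/matrixP => i e; by rewrite !mxE.
Qed.

Lemma measurable_phase_EFin f : continuous f ->
  measurable_fun setT (fun w => (f (phase_of_coords w))%:E : \bar R).
Proof. by move=> cf; apply/measurable_EFinP; exact: measurable_phase_fun. Qed.

Definition phase_eint f : \bar R := (\int[phase_measure R n d]_w (f (phase_of_coords w))%:E)%E.

Lemma continuous_shear_v (G : 'M[R]_(n, d) -> 'M[R]_(n, d)) : (forall i c, continuous (fun x => G x i c)) ->
  continuous (fun z : Ph => (z.1, z.2 + G z.1) : Ph).
Proof.
move=> cG; apply: phase_continuous => i c; first exact: continuous_pos.
under eq_fun do rewrite mxE.
apply: cont_add; first exact: continuous_vel.
exact: (cont_comp continuous_phase1 (cG i c)).
Qed.

Lemma continuous_shear_x (h : R) : continuous (fun z : Ph => (z.1 + h *: z.2, z.2) : Ph).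
Proof.
apply: phase_continuous => i c; last exact: continuous_vel.
under eq_fun do rewrite !mxE.
apply: cont_add; first exact: continuous_pos.
by apply: cont_mul; [exact: cont_cst|exact: continuous_vel].
Qed.

(** At fixed positions the shear translates each velocity coordinate by a constant, and Tonelli
    integrates the velocities first. *)
Lemma eint_shear_v f (G : 'M[R]_(n, d) -> 'M[R]_(n, d)) : continuous f ->
  (forall i c, continuous (fun x => G x i c)) -> (forall z, 0 <= f z) ->
  phase_eint (fun z => f (z.1, z.2 + G z.1)) = phase_eint f.
Proof.
move=> cf cG f0.
have cg : continuous (fun z : Ph => f (z.1, z.2 + G z.1)).
  exact: (cont_comp (continuous_shear_v cG) cf).
rewrite /phase_eint.
have ef w : (0 <= (f (phase_of_coords w))%:E)%E by rewrite lee_fin.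
have eg w : (0 <= (f ((phase_of_coords w).1, (phase_of_coords w).2 + G (phase_of_coords w).1))%:E)%E.
  by rewrite lee_fin.
have mf := measurable_phase_EFin cf.
have mg := measurable_phase_EFin cg.
etransitivity; first exact: (@fubini_tonelli1 _ _ _ _ _ (power_measure (circle_measure R) (n * d))
  (power_measure (line_measure R) (n * d)) _ mg eg).
etransitivity; last by apply/esym; exact: (@fubini_tonelli1 _ _ _ _ _ (power_measure (circle_measure R) (n * d))
  (power_measure (line_measure R) (n * d)) _ mf ef).
apply: eq_integral => s _; rewrite /fubini_F /=.
pose a i : R := mxvec (G (mx_of_coords s)) ord0 i.
have pm := preserving_map (fun i => line_shift_preserving (a i)).
rewrite -[RHS](ge0_integral_preserving pm); last 2 first.
- by apply: (measurableT_comp mf); exact: measurable_pair1.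
- by move=> t; exact: ef (s, t).
apply: eq_integral => t _; congr (f (_, _))%:E; apply/matrixP => i c.
by rewrite mxE !mx_of_coordsE tnth_mktuple /a mxvecE.
Qed.

(** At fixed velocities the shear is a translation of the torus. [circle_shift] brings the moved
    representative back to the unit cube, which changes it by integers that f does not see. *)
Lemma eint_shear_x f (h : R) : continuous f -> phase_periodic f ->
  (forall z, 0 <= f z) ->
  phase_eint (fun z => f (z.1 + h *: z.2, z.2)) = phase_eint f.
Proof.
move=> cf pf f0.
have cg : continuous (fun z : Ph => f (z.1 + h *: z.2, z.2)).
  exact: (cont_comp (@continuous_shear_x h) cf).
rewrite /phase_eint.
have ef w : (0 <= (f (phase_of_coords w))%:E)%E by rewrite lee_fin.
have eg w : (0 <= (f ((phase_of_coords w).1 + h *: (phase_of_coords w).2, (phase_of_coords w).2))%:E)%E.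
  by rewrite lee_fin.
have mf := measurable_phase_EFin cf.
have mg := measurable_phase_EFin cg.
etransitivity; first exact: (@fubini_tonelli2 _ _ _ _ _ (power_measure (circle_measure R) (n * d))
  (power_measure (line_measure R) (n * d)) _ mg eg).
etransitivity; last by apply/esym; exact: (@fubini_tonelli2 _ _ _ _ _ (power_measure (circle_measure R) (n * d))
  (power_measure (line_measure R) (n * d)) _ mf ef).
apply: eq_integral => t _; rewrite /fubini_G /=.
pose a i : R := mxvec (h *: mx_of_coords t) ord0 i.
have pm := preserving_map (fun i => circle_shift_preserving (a i)).
rewrite -[RHS](ge0_integral_preserving pm); last 2 first.
- by apply: (measurableT_comp mf); exact: measurable_pair2.
- by move=> s; exact: ef (s, t).
apply: eq_integral => s _ /=.
have /choice[k hk] : forall ic : 'I_n * 'I_d, exists k : int,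
    circle_shift (a (mxvec_index ic.1 ic.2)) (tnth s (mxvec_index ic.1 ic.2)) =
    tnth s (mxvec_index ic.1 ic.2) + a (mxvec_index ic.1 ic.2) + k%:~R.
  by move=> ic; exact: circle_shift_int.
rewrite -(pf _ (\matrix_(i, c) k (i, c))); congr (f (_, _))%:E; apply/matrixP => i c.
have /= hkic := hk (i, c).
by rewrite !mxE tnth_mktuple hkic /a mxvecE !mxE.
Qed.

End PhaseCoordinates.

(** * Symplectic Euler schemes *)

Section UniformContinuity.
Context {R : realType}.

Lemma segment_uniform_continuity (I : finType) (f : I -> R -> R) (T w : R) :
  (forall i, continuous (f i)) -> 0 < w ->
  exists2 eta : R, 0 < eta & forall i s s', 0 <= s <= T -> `|s - s'| < eta -> `|f i s - f i s'| <= w.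
Proof.
move=> cf w0.
have /compact_near_coveringP cT := @segment_compact R 0 T.
pose P (eta s : R) := forall i s', `|s - s'| < eta -> `|f i s - f i s'| <= w.
have : \forall eta \near (0:R)^'+, `[0, T]%classic `<=` P eta.
  apply: cT => x _.
  have w2 : 0 < w / 2 by rewrite divr_gt0.
  have : \forall s \near nbhs x, forall i, `|f i x - f i s| < w / 2.
    by apply: filter_forall => i; have /cvgrPdist_lt/(_ _ w2) := cf i x.
  move=> /nbhs_ballP[r /= r0 hr].
  have r2 : 0 < r / 2 by rewrite divr_gt0.
  exists (ball x (r / 2), [set eta | eta < r / 2]) => /=.
    by split; [exact: nbhsx_ballx|exact: nbhs_right_lt].
  move=> [s eta] /= [xs er] i s' ss'.
  have h1 : `|f i x - f i s| < w / 2.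
    by apply: hr; apply: le_ball xs; lra.
  have h2 : `|f i x - f i s'| < w / 2.
    apply: hr; move: xs; rewrite -ball_normE /= => xs.
    have := ler_distD s x s'; lra.
  have := ler_distD (f i x) (f i s) (f i s'); rewrite [`|f i s - f i x|]distrC; lra.
move=> [r /= r0 hr].
exists (r / 2); first by rewrite divr_gt0.
move=> i s s' sT ss'.
have r2 : 0 < r / 2 by rewrite divr_gt0.
have rr : ball_ Num.norm (0 : R) r (r / 2) by rewrite /ball_ /= sub0r normrN gtr0_norm//; lra.
have sI : `[0, T]%classic s by rewrite /= in_itv.
exact: (hr (r / 2) rr r2 s sI i s' ss').
Qed.

End UniformContinuity.

Section Euler.
Context {R : realType} {n d : nat}.
Local Notation mx := 'M[R]_(n, d).
Local Notation Ph := (phase R n d).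
Variables (E : R -> mx -> mx) (B L : R).
Hypothesis (B0 : 0 <= B) (L0 : 0 <= L) (hE : regular_field B L E).
Hypothesis perE : forall t (x : mx) (k : 'M[int]_(n, d)), E t (x + map_mx intr k) = E t x.

(** The position moves with the updated velocity, which makes the step a velocity shear followed by
    a position shear. *)
Definition euler_step (h : R) (k : nat) (z : Ph) : Ph :=
  let v := z.2 + h *: E (k%:R * h) z.1 in (z.1 + h *: v, v).

Fixpoint euler (h : R) (k : nat) (z : Ph) : Ph :=
  if k is k'.+1 then euler_step h k' (euler h k' z) else z.

Lemma field_continuous t i c : continuous (fun x : mx => E t x i c).
Proof.
have [_ hL _] := hE.
move=> x; have FF : Filter (nbhs (x : mx)) := nbhs_filter x.
apply/(@cvgrPdist_lt _ _ _ (nbhs (x : mx)) FF (fun x : mx => E t x i c)) => e e0.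
have a0 : 0 < L + 1 by rewrite ltr_wpDl.
apply/nbhs_ballP; exists (e / (L + 1)) => /=; first by rewrite divr_gt0.
move=> y xy; apply: (@le_lt_trans _ _ (L * (e / (L + 1)))).
  by apply: hL => j q; have := xy; move=> [_ /(_ j q)]; rewrite -ball_normE => /ltW.
rewrite mulrA ltr_pdivrMr// mulrC ltr_pM2l//; lra.
Qed.

Lemma continuous_euler_step h k : continuous (euler_step h k).
Proof.
have cG i c : continuous (fun x : mx => (h *: E (k%:R * h) x) i c).
  under eq_fun do rewrite mxE.
  by apply: cont_mul; [exact: cont_cst|exact: field_continuous].
exact: (cont_comp (continuous_shear_v cG) (@continuous_shear_x _ _ _ h)).
Qed.

Lemma continuous_euler h k : continuous (euler h k).
Proof.
elim: k => [|k ih]; first by move=> z; exact: cvg_id.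
exact: (cont_comp ih (@continuous_euler_step h k)).
Qed.

Lemma euler_step_per h k (g : Ph -> R) : phase_periodic g -> phase_periodic (g \o euler_step h k).
Proof.
move=> pg v j x /=; rewrite /euler_step /= perE.
by rewrite addrAC pg.
Qed.

Lemma eint_euler h k (g : Ph -> R) : continuous g -> phase_periodic g -> (forall z, 0 <= g z) ->
  phase_eint (fun z => g (euler h k z)) = phase_eint g.
Proof.
elim: k g => [//|k ih] g cg pg g0.
rewrite -[RHS](eint_shear_x h cg pg g0).
rewrite -[RHS](@eint_shear_v _ _ _ _ (fun x => h *: E (k%:R * h) x)) => [||i c|z]; last first.
- exact: g0.
- under eq_fun do rewrite mxE.
  by apply: cont_mul; [exact: cont_cst|exact: field_continuous].
- exact: (cont_comp (@continuous_shear_x _ _ _ h) cg).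
apply: (ih (g \o euler_step h k)) => [||z]; last exact: g0.
- exact: (cont_comp (@continuous_euler_step h k) cg).
- exact: euler_step_per.
Qed.

(** The bound depends on k and h only through k h, so it is uniform over the schemes that reach the
    same time; it confines the truncated integrands to a fixed set of velocities. *)
Lemma euler_vel h k (z : Ph) i c : 0 <= h -> `|(euler h k z).2 i c - z.2 i c| <= k%:R * (h * B).
Proof.
move=> h0; have [hB _ _] := hE.
elim: k => [|k ih]; first by rewrite subrr normr0 mul0r.
rewrite /= !mxE addrAC -natr1 mulrDl mul1r.
apply: le_trans (ler_normD _ _) _; rewrite lerD// normrM (ger0_norm h0).
by rewrite ler_wpM2l.
Qed.

(** One step multiplies the error by at most 1 + (1 + L)h and adds at most 2wh. The oscillation w
    within a step stands for a modulus of continuity, the field being merely continuous in time. *)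
Lemma euler_error h w m z (x v : R -> mx) : solves E z x v ->
  0 <= h <= 1 -> 0 <= w ->
  (forall k i c s s', (k < m)%N -> k%:R * h <= s <= k.+1%:R * h -> k%:R * h <= s' <= k.+1%:R * h ->
     `|E s (x s) i c - E s' (x s') i c| <= w /\ `|v s i c - v s' i c| <= w) ->
  forall k, (k <= m)%N -> forall i c,
   `|x (k%:R * h) i c - (euler h k z).1 i c| <= 2 * w * h * k%:R * (1 + (1 + L) * h) ^+ k /\
   `|v (k%:R * h) i c - (euler h k z).2 i c| <= 2 * w * h * k%:R * (1 + (1 + L) * h) ^+ k.
Proof.
move=> [x0 v0 hx hv] /andP[h0 h1] w0 hw; have [_ hL _] := hE.
elim=> [|k ih] km i c.
  by rewrite !mul0r mulr0 mul0r /= x0 v0 !subrr normr0.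
have {}ih := ih (ltnW km).
pose t := k%:R * h; pose t' := k.+1%:R * h.
have tt' : t' = t + h by rewrite /t' /t -natr1; ring.
have t0 : 0 <= t by rewrite /t mulr_ge0.
have let' : t <= t' by rewrite tt' lerDl.
pose r := 1 + (1 + L) * h.
have r1 : 1 <= r by rewrite /r lerDl mulr_ge0// addr_ge0.
pose e := 2 * w * h * k%:R * r ^+ k.
have e0 : 0 <= e by rewrite /e !mulr_ge0// exprn_ge0// (le_trans _ r1).
set y := euler h k z in ih *.
have inner s : t <= s <= t' -> k%:R * h <= s <= k.+1%:R * h by [].
have tin : k%:R * h <= t <= k.+1%:R * h by rewrite lexx -/t -/t' let'.
have t'in : k%:R * h <= t' <= k.+1%:R * h by rewrite lexx -/t -/t' let'.
(* mean value theorem on one step *)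
have [s1 s1t hs1] := @MVT_segment R (fun s => v s i c) (fun s => E (s) (x (Num.max s 0)) i c) t t' let'
  (fun s _ => hv s i c) (is_derive_within (fun s _ => hv s i c)).
have [s2 s2t hs2] := @MVT_segment R (fun s => x s i c) (fun s => v s i c) t t' let'
  (fun s _ => hx s i c) (is_derive_within (fun s _ => hx s i c)).
rewrite !in_itv/= in s1t s2t.
have s10 : Num.max s1 0 = s1 by apply: max_l; case/andP: s1t => /(le_trans t0).
rewrite s10 in hs1.
have th : t' - t = h by rewrite tt'; ring.
have [w1 _] := hw k i c s1 t km s1t tin.
have [_ w2] := hw k i c s2 t' km s2t t'in.
have lipE : `|E t (x t) i c - E t y.1 i c| <= L * e by apply: hL => p q; exact: (ih p q).1.
have [ex ev] := ih i c.
rewrite -/t -/e in ex ev.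
have velb : `|v t' i c - (euler h k.+1 z).2 i c| <= e + h * (w + L * e).
  rewrite /= mxE mxE -/y -/t.
  have -> : v t' i c - (y.2 i c + h * E t y.1 i c) = (v t i c - y.2 i c) +
     h * ((E s1 (x s1) i c - E t (x t) i c) + (E t (x t) i c - E t y.1 i c)).
    have : v t' i c = v t i c + E s1 (x s1) i c * h by rewrite -th -hs1; ring.
    by move=> ->; ring.
  apply: le_trans (ler_normD _ _) _; rewrite lerD// normrM (ger0_norm h0) ler_wpM2l//.
  by apply: le_trans (ler_normD _ _) _; rewrite lerD.
have posb : `|x t' i c - (euler h k.+1 z).1 i c| <= e + h * (w + (e + h * (w + L * e))).
  have -> : (euler h k.+1 z).1 i c = y.1 i c + h * (euler h k.+1 z).2 i c by rewrite /= !mxE.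
  have -> : x t' i c - (y.1 i c + h * (euler h k.+1 z).2 i c) = (x t i c - y.1 i c) +
     h * ((v s2 i c - v t' i c) + (v t' i c - (euler h k.+1 z).2 i c)).
    have : x t' i c = x t i c + v s2 i c * h by rewrite -th -hs2; ring.
    by move=> ->; ring.
  apply: le_trans (ler_normD _ _) _; rewrite lerD// normrM (ger0_norm h0) ler_wpM2l//.
  by apply: le_trans (ler_normD _ _) _; rewrite lerD.
have hLe : 0 <= h * (L * e) := mulr_ge0 h0 (mulr_ge0 L0 e0).
have he : 0 <= h * e := mulr_ge0 h0 e0.
have hw0 : 0 <= h * w := mulr_ge0 h0 w0.
have fin : r * e + 2 * w * h <= 2 * w * h * k.+1%:R * r ^+ k.+1.
  have rk : 1 <= r ^+ k.+1 by rewrite exprn_ege1.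
  have : 2 * w * h <= 2 * w * h * r ^+ k.+1 by rewrite ler_peMr// !mulr_ge0.
  by rewrite /e -natr1 exprS; lra.
split; last first.
  apply: le_trans velb _; apply: le_trans fin; rewrite /r; lra.
apply: le_trans posb _; apply: le_trans fin; rewrite /r.
have : h * (h * (L * e)) <= h * (L * e) by rewrite ler_piMl.
have : h * (h * w) <= h * w by rewrite ler_piMl.
lra.
Qed.

End Euler.

(** * Invariance of integrals under the flow *)

Section FlowPreserves.
Context {R : realType} {n d : nat}.
Local Notation mx := 'M[R]_(n, d).
Local Notation Ph := (phase R n d).
Variables (E : R -> mx -> mx) (B L : R).
Hypothesis (B0 : 0 <= B) (L0 : 0 <= L) (hE : regular_field B L E).
Hypothesis perE : forall t (x : mx) (k : 'M[int]_(n, d)), E t (x + map_mx intr k) = E t x.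
Variables (X V : Ph -> R -> mx).
Hypothesis hflow : forall z, solves E z (X z) (V z).

Lemma euler_cvg (T : R) (z : Ph) i c : 0 < T ->
  (fun m => (euler E (T / m.+1%:R) m.+1 z).1 i c) @ \oo --> X z T i c /\
  (fun m => (euler E (T / m.+1%:R) m.+1 z).2 i c) @ \oo --> V z T i c.
Proof.
move=> T0.
have Tm m : m.+1%:R * (T / m.+1%:R) = T by rewrite mulrC divfK// pnatr_eq0.
(* With h = T/(m + 1), the power (1 + (1 + L)h)^(m + 1) is at most e^((1 + L)T), so the error bound
   of [euler_error] is at most w K. *)
pose K := 2 * T * expR ((1 + L) * T).
have K0 : 0 <= K by rewrite !mulr_ge0 ?expR_ge0// ltW.
have [x0 v0 hx hv] := hflow z.
have [cX cV] : (forall i c, continuous (fun t => X z t i c)) /\ (forall i c, continuous (fun t => V z t i c)).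
  by split=> j q; have [] := trajectory_cont (hflow z) j q.
have cE := field_along_continuous hE cX.
pose f (j : 'I_n * 'I_d + 'I_n * 'I_d) s : R :=
  match j with inl ic => E s (X z s) ic.1 ic.2 | inr ic => V z s ic.1 ic.2 end.
have cf j : continuous (f j) by case: j => ic; [exact: cE|exact: cV].
suff main e : 0 < e -> \forall m \near \oo,
    `|X z T i c - (euler E (T / m.+1%:R) m.+1 z).1 i c| < e /\
    `|V z T i c - (euler E (T / m.+1%:R) m.+1 z).2 i c| < e.
  by split; apply/cvgrPdist_lt => e /main; apply: filterS => m [].
move=> e0.
pose w := e / (K + 1).
have w0 : 0 < w by rewrite divr_gt0// ltr_wpDl.
have [eta eta0 heta] := segment_uniform_continuity T cf w0.
have [M hM] : exists M : nat, forall m, (M <= m)%N -> T / m.+1%:R < Num.min eta 1.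
  have p0 : 0 < Num.min eta 1 by rewrite lt_min eta0 ltr01.
  exists (Num.truncn (T / Num.min eta 1)) => m Mm.
  rewrite ltr_pdivrMr ?ltr0n// mulrC -ltr_pdivrMr//.
  by apply: lt_le_trans (truncnS_gt _) _; rewrite ler_nat ltnS.
exists M => // m /= Mm.
have := hM m Mm; set h := T / m.+1%:R; rewrite lt_min => /andP[heta' h1].
have h0 : 0 <= h by rewrite divr_ge0// ltW.
have hh : 0 <= h <= 1 by rewrite h0 ltW.
have hw k j q s s' : (k < m.+1)%N -> k%:R * h <= s <= k.+1%:R * h -> k%:R * h <= s' <= k.+1%:R * h ->
     `|E s (X z s) j q - E s' (X z s') j q| <= w /\ `|V z s j q - V z s' j q| <= w.
  move=> km /andP[s1 s2] /andP[s'1 s'2].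
  have ss' : `|s - s'| < eta.
    apply: le_lt_trans heta'; rewrite ler_norml; move: s1 s2 s'1 s'2; rewrite -natr1 mulrDl mul1r; lra.
  have sT : 0 <= s <= T.
    apply/andP; split; first by apply: le_trans s1; rewrite mulr_ge0.
    by apply: le_trans s2 _; rewrite -[leRHS](Tm m) ler_wpM2r// ler_nat.
  by split; [exact: (heta (inl (j, q)) _ _ sT ss')|exact: (heta (inr (j, q)) _ _ sT ss')].
have := euler_error L0 hE (hflow z) hh (ltW w0) hw (leqnn _) i c.
rewrite {1 3}/h Tm => -[ex ev].
have bound : 2 * w * h * m.+1%:R * (1 + (1 + L) * h) ^+ m.+1 < e.
  apply: (@le_lt_trans _ _ (w * K)).
    have -> : 2 * w * h * m.+1%:R = 2 * w * T by rewrite -[T in RHS](Tm m) -/h; ring.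
    have -> : w * K = 2 * w * T * expR ((1 + L) * T) by rewrite /K; ring.
    apply: ler_wpM2l; first exact: (mulr_ge0 (mulr_ge0 (ler0n _ 2) (ltW w0)) (ltW T0)).
    have -> : (1 + L) * T = m.+1%:R * ((1 + L) * h) by rewrite -[T in LHS](Tm m) -/h; ring.
    have Lh : 0 <= (1 + L) * h := mulr_ge0 (addr_ge0 ler01 L0) h0.
    rewrite expRM_natl; apply: lerXn2r; rewrite ?nnegrE ?expR_ge0//; first exact: addr_ge0.
    exact: expR_ge1Dx.
  by rewrite /w mulrAC ltr_pdivrMr ?ltr_wpDl// ltr_pM2l// ltrDl.
by split; [apply: le_lt_trans ex _|apply: le_lt_trans ev _].
Qed.

Lemma flow_continuous (T : R) : 0 <= T -> continuous (fun z : Ph => (X z T, V z T) : Ph).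
Proof.
move=> T0.
pose C := expR ((2 + (n * d)%:R * L ^+ 2) * T).
pose Q (z z' : Ph) := (\sum_i \sum_c ((z.1 i c - z'.1 i c) ^+ 2 + (z.2 i c - z'.2 i c) ^+ 2)) * C.
have cQ z : continuous (Q z).
  apply: cont_mul; last exact: cont_cst.
  apply: cont_sum => i _; apply: cont_sum => c _; apply: cont_add.
    by apply: cont_mul; apply: cont_sub; [exact: cont_cst|exact: continuous_pos|exact: cont_cst|exact: continuous_pos].
  by apply: cont_mul; apply: cont_sub; [exact: cont_cst|exact: continuous_vel|exact: cont_cst|exact: continuous_vel].
have Q0 z : Q z z = 0.
  rewrite /Q big1 ?mul0r// => i _; rewrite big1// => c _.
  by rewrite !subrr expr0n addr0.
have bd z z' i c : (X z T i c - X z' T i c) ^+ 2 <= Q z z' /\ (V z T i c - V z' T i c) ^+ 2 <= Q z z'.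
  have := solves_dist L0 hE (hflow z) (hflow z') T0; rewrite -/C -/(Q z z') => H.
  have le1 : (X z T i c - X z' T i c) ^+ 2 + (V z T i c - V z' T i c) ^+ 2 <= Q z z'.
    apply: le_trans H.
    have nn j q : 0 <= (X z T j q - X z' T j q) ^+ 2 + (V z T j q - V z' T j q) ^+ 2.
      by rewrite addr_ge0// sqr_ge0.
    rewrite (bigD1 i)//= (bigD1 c)//= -addrA lerDl addr_ge0//.
      by apply: sumr_ge0 => q _; exact: nn.
    by apply: sumr_ge0 => j _; apply: sumr_ge0 => q _; exact: nn.
  by split; apply: le_trans le1; [rewrite lerDl sqr_ge0|rewrite lerDr sqr_ge0].
have key (f : Ph -> R) : (forall z z', (f z - f z') ^+ 2 <= Q z z') -> continuous f.
  move=> hf z; apply/cvgrPdist_lt => e e0.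
  have e20 : 0 < e ^+ 2 by rewrite exprn_gt0.
  have /cvgrPdist_lt/(_ _ e20) := cQ z z; apply: filterS => z'.
  rewrite Q0 sub0r normrN => /(le_lt_trans (ler_norm _)) h.
  rewrite -(@ltr_pXn2r _ 2)// ?nnegrE ?(ltW e0)//.
  by apply: le_lt_trans h; rewrite real_normK ?num_real.
by apply: phase_continuous => i c; apply: key => z z'; have [] := bd z z' i c.
Qed.

Definition vel_norm (z : Ph) : R := \sum_i \sum_c `|z.2 i c|.

(* Truncation in height and velocity makes the integrand bounded with finite-measure support,
   so that dominated convergence applies to the Euler schemes. *)
Definition cutoff (k : nat) (g : Ph -> R) (z : Ph) : R :=
  Num.min (g z) k%:R * Num.max 0 (Num.min 1 (k.+1%:R - vel_norm z)).

Lemma continuous_vel_norm : continuous vel_norm.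
Proof.
apply: cont_sum => i _; apply: cont_sum => c _.
exact: (cont_comp (@continuous_vel _ _ _ i c) (@norm_continuous _ R)).
Qed.

Lemma continuous_cutoff k g : continuous g -> continuous (cutoff k g).
Proof.
move=> cg; apply: cont_mul; first by apply: cont_min => //; exact: cont_cst.
apply: cont_max; first exact: cont_cst.
apply: cont_min; first exact: cont_cst.
by apply: cont_sub; [exact: cont_cst|exact: continuous_vel_norm].
Qed.

Lemma cutoff_ge0 k g z : 0 <= g z -> 0 <= cutoff k g z.
Proof. by move=> g0; rewrite /cutoff mulr_ge0 ?le_max ?lexx// le_min g0 ler0n. Qed.

Lemma cutoff_le k g z : 0 <= g z -> cutoff k g z <= k%:R.
Proof.
move=> g0; rewrite /cutoff -[leRHS]mulr1 ler_pM ?le_max ?lexx// ?le_min ?g0 ?ler0n//.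
  by rewrite ge_min lexx orbT.
by rewrite ge_max ler01 ge_min lexx.
Qed.

Lemma cutoff_eq0 k g z : k.+1%:R <= vel_norm z -> cutoff k g z = 0.
Proof.
move=> h; rewrite /cutoff [X in _ * X](_ : _ = 0) ?mulr0//.
by apply: max_l; rewrite ge_min subr_le0 h orbT.
Qed.

Lemma cutoff_per k g : phase_periodic g -> phase_periodic (cutoff k g).
Proof. by move=> pg v j x; rewrite /cutoff pg. Qed.

Lemma cutoff_mono (g : Ph -> R) z : 0 <= g z -> {homo (fun k => cutoff k g z) : j k / (j <= k)%N >-> j <= k}.
Proof.
move=> g0 j k jk; rewrite /cutoff.
have jkR : (j%:R : R) <= k%:R by rewrite ler_nat.
have jkS : (j.+1%:R : R) - vel_norm z <= k.+1%:R - vel_norm z by rewrite lerD2r ler_nat.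
apply: ler_pM.
- by rewrite le_min g0 ler0n.
- by rewrite le_max lexx.
- by rewrite le_min ge_min lexx/= ge_min jkR orbT.
- by rewrite ge_max le_max lexx/= le_max le_min !ge_min lexx jkS !orbT.
Qed.

Lemma cutoff_id g z : \forall k \near \oo, cutoff k g z = g z.
Proof.
exists (maxn (Num.truncn `|g z|).+1 (Num.truncn (vel_norm z)).+1) => // k /=; rewrite geq_max => /andP[k1 k2].
rewrite /cutoff min_l; last first.
  apply: le_trans (ler_norm _) _; apply: ltW; apply: lt_le_trans (truncnS_gt _) _.
  by rewrite ler_nat.
rewrite min_l ?max_r ?mulr1// lerBrDr -[k.+1%:R]natr1 addrC lerD2r.
by apply: ltW; apply: lt_le_trans (truncnS_gt _) _; rewrite ler_nat.
Qed.

Local Notation coords := ((n * d).-tuple (measurableTypeR R)).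

Definition vel_box (C : R) : set (coords * coords) :=
  [set w | forall i, `|tnth w.2 i : R| <= C].

Lemma vel_boxE C : vel_box C = box (fun=> setT) `*` box (fun=> `[- C, C]%classic).
Proof.
apply/seteqP; split=> -[s t] /=.
  by move=> h; split=> // i; rewrite /= in_itv/= -ler_norml; exact: h.
by move=> [_ h] i; have := h i; rewrite /= in_itv/= -ler_norml.
Qed.

Lemma measurable_vel_box C : measurable (vel_box C).
Proof.
rewrite vel_boxE; apply: measurableX; first exact: measurable_box.
by apply: measurable_box => i; exact: measurable_itv.
Qed.

Lemma vel_box_lty (C : R) : (phase_measure R n d (vel_box C) < +oo)%E.
Proof.
rewrite vel_boxE.
rewrite [X in (X < _)%E](_ : _ = (power_measure (circle_measure R) (n * d) (box (fun=> setT)) *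
  power_measure (line_measure R) (n * d) (box (fun=> `[(- C)%R, C]%classic)))%E); last first.
  apply: product_measure1E; first exact: measurable_box.
  by apply: measurable_box => i; exact: measurable_itv.
have fin (mu : {sigma_finite_measure set (measurableTypeR R) -> \bar R}) (A : set (measurableTypeR R)) :
    measurable A -> (mu A < +oo)%E -> (power_measure mu (n * d) (box (fun=> A)) < +oo)%E.
  move=> mA Aoo; rewrite power_measure_box//.
  suff : (0 <= \prod_(i < n * d) mu A)%E /\ (\prod_(i < n * d) mu A < +oo)%E by case.
  elim/big_ind : _ => [|x y [x0 xoo] [y0 yoo]|i _].
  + by split; [exact: lee01|exact: ltry].
  + by split; [exact: mule_ge0|rewrite lte_mul_pinfty// ge0_fin_numE].
  + by split; [exact: measure_ge0|].
rewrite lte_mul_pinfty//.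
- rewrite ge0_fin_numE//; apply: fin => //.
  rewrite /circle_measure /= /mfrestr /mrestr /= setTI; exact: unit_interval_lty.
- apply: fin; first exact: measurable_itv.
  by rewrite /line_measure /= lebesgue_measure_itv/=; case: ifP => // _; rewrite -EFinB ltry.
Qed.

Lemma eint_flow_cutoff (T : R) k (g : Ph -> R) : 0 < T -> continuous g -> phase_periodic g ->
  (forall z, 0 <= g z) ->
  phase_eint (fun z => cutoff k g (X z T, V z T)) = phase_eint (cutoff k g).
Proof.
move=> T0 cg pg g0.
have cc := @continuous_cutoff k _ cg.
pose h m := T / m.+1%:R.
have eul m : phase_eint (fun z => cutoff k g (euler E (h m) m.+1 z)) = phase_eint (cutoff k g).
  by apply: (eint_euler L0 hE perE (h m) m.+1 cc (@cutoff_per k g pg)) => z; exact: cutoff_ge0.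
(* Up to time T a velocity entry changes by at most T B. A point with a velocity entry above C is
   thus sent by every scheme to velocity norm above k + 1, where the cutoff vanishes; elsewhere the
   integrand is at most k. *)
pose C := k.+1%:R + T * B.
pose A := vel_box C.
have mA : measurable A := measurable_vel_box C.
pose G w : \bar R := (k%:R * \1_A w)%:E.
have iG : (phase_measure R n d).-integrable setT G.
  rewrite (_ : G = fun w => (k%:R%:E * (EFin \o \1_A) w)%E); last by apply/funext => w; rewrite /G EFinM.
  apply: integrableZl => //; apply/integrableP; split; first exact/measurable_EFinP.
  under eq_integral do rewrite /= ger0_norm//.
  by rewrite integral_indic// setIT; exact: vel_box_lty.
have bound m w : (`|(cutoff k g (euler E (h m) m.+1 (phase_of_coords w)))%:E| <= G w)%E.
  rewrite /G abse_EFin lee_fin ger0_norm; last exact: cutoff_ge0.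
  have [Aw|nAw] := pselect (A w).
    by rewrite indicE mem_set// mulr1; exact: cutoff_le.
  rewrite indicE memNset// mulr0 cutoff_eq0//.
  have [ic hic] : exists ic : 'I_n * 'I_d, C < `|(phase_of_coords w).2 ic.1 ic.2|.
    apply: contrapT => hn; apply: nAw => i.
    case: (mxvec_indexP i) => j c; rewrite leNgt; apply/negP => hC; apply: hn.
    by exists (j, c); rewrite /= mx_of_coordsE.
  have h0 : 0 <= h m by rewrite divr_ge0// ltW.
  have := euler_vel hE m.+1 (phase_of_coords w) ic.1 ic.2 h0.
  have -> : m.+1%:R * (h m * B) = T * B by rewrite mulrA [_ * h m]mulrC divfK// pnatr_eq0.
  move=> hv.
  have : `|(euler E (h m) m.+1 (phase_of_coords w)).2 ic.1 ic.2| <= vel_norm (euler E (h m) m.+1 (phase_of_coords w)).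
    rewrite /vel_norm (bigD1 ic.1)//= (bigD1 ic.2)//= -addrA lerDl addr_ge0//.
      by apply: sumr_ge0.
    by apply: sumr_ge0 => ? _; apply: sumr_ge0.
  apply: le_trans.
  have := ler_distD ((euler E (h m) m.+1 (phase_of_coords w)).2 ic.1 ic.2) ((phase_of_coords w).2 ic.1 ic.2) 0.
  rewrite !subr0 distrC /C in hic *; lra.
have cvgp w : (cutoff k g (euler E (h m) m.+1 (phase_of_coords w)))%:E @[m --> \oo] -->
    (cutoff k g (X (phase_of_coords w) T, V (phase_of_coords w) T))%:E.
  apply: cvg_EFin; first exact: nearW.
  pose e m := euler E (h m) m.+1 (phase_of_coords w).
  have ecvg : (fun m => ((e m).1, (e m).2)) @ \oo --> ((X (phase_of_coords w) T, V (phase_of_coords w) T) : Ph).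
    by apply: phase_cvg => i c; have [] := euler_cvg (phase_of_coords w) i c T0.
  have := cvg_comp _ _ ecvg (cc _).
  by rewrite (_ : _ \o _ = fun m => cutoff k g (e m))//; apply/funext => m /=; rewrite -surjective_pairing.
have eulE : (fun m => phase_eint (fun z => cutoff k g (euler E (h m) m.+1 z))) =
    fun=> phase_eint (cutoff k g) by apply/funext.
have hc : (fun m => phase_eint (fun z => cutoff k g (euler E (h m) m.+1 z))) @ \oo -->
    phase_eint (fun z => cutoff k g (X z T, V z T)).
  exact: (@dominated_cvg _ _ _ (phase_measure R n d) setT measurableT
    (fun m w => (cutoff k g (euler E (h m) m.+1 (phase_of_coords w)))%:E)
    (fun w => (cutoff k g (X (phase_of_coords w) T, V (phase_of_coords w) T))%:E) G
    (fun m => measurable_phase_EFin (cont_comp (@continuous_euler _ _ _ _ _ _ L0 hE (h m) m.+1) cc))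
    (fun w _ => cvgp w) (fun w _ => isT) iG (fun m w _ => bound m w)).
rewrite eulE in hc.
exact/esym/(cvg_unique _ (cvg_cst _) hc).
Qed.

Lemma eint_cutoff_cvg (g : Ph -> R) (phi : Ph -> Ph) : continuous g -> continuous phi -> (forall z, 0 <= g z) ->
  (fun k => phase_eint (fun z => cutoff k g (phi z))) @ \oo --> phase_eint (fun z => g (phi z)).
Proof.
move=> cg cphi g0.
have H := @cvg_monotone_convergence _ _ _ (phase_measure R n d) setT measurableT
  (fun k w => (cutoff k g (phi (phase_of_coords w)))%:E)
  (fun k => measurable_phase_EFin (cont_comp cphi (@continuous_cutoff k g cg))) _ _.
rewrite /phase_eint (_ : (\int[phase_measure R n d]_w _)%E =
  (\int[phase_measure R n d]_w limn ((fun k w => (cutoff k g (phi (phase_of_coords w)))%:E)^~ w))%E).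
  apply: H => [k w _|w _ j k jk]; first by rewrite lee_fin cutoff_ge0.
  by rewrite lee_fin; exact: cutoff_mono.
apply: eq_integral => w _; apply/esym/cvg_lim => //.
apply: cvg_near_cst.
by have := cutoff_id g (phi (phase_of_coords w)); apply: filterS => k ->.
Qed.

Lemma ge0_eint_flow (T : R) (g : Ph -> R) : 0 <= T -> continuous g -> phase_periodic g ->
  (forall z, 0 <= g z) ->
  phase_eint (fun z => g (X z T, V z T)) = phase_eint g.
Proof.
move=> T0 cg pg g0; have cphi := flow_continuous T0.
move: T0; rewrite le_eqVlt => /orP[/eqP <-|T0].
  congr phase_eint; apply/funext => z; have [-> -> _ _] := hflow z.
  by rewrite -surjective_pairing.
have h1 := eint_cutoff_cvg cg cphi g0.
have cid : continuous (@idfun Ph) by move=> z; exact: cvg_id.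
have h2 := eint_cutoff_cvg cg cid g0.
have e12 : (fun k => phase_eint (fun z => cutoff k g (X z T, V z T))) =
    (fun k => phase_eint (fun z => cutoff k g (idfun z))).
  by apply/funext => k; exact: eint_flow_cutoff.
rewrite e12 in h1.
exact: (cvg_unique _ h1 h2).
Qed.

Lemma eint_flow (T : R) (g : Ph -> R) : 0 <= T -> continuous g -> phase_periodic g ->
  phase_eint (fun z => g (X z T, V z T)) = phase_eint g.
Proof.
move=> T0 cg pg; rewrite /phase_eint integralE [RHS]integralE.
have cp : continuous (fun z => Num.max (g z) 0) by apply: cont_max => //; exact: cont_cst.
have cn : continuous (fun z => Num.max (- g z) 0).
  by apply: cont_max; [exact: cont_opp|exact: cont_cst].
have pp : phase_periodic (fun z => Num.max (g z) 0) by move=> v j x; rewrite pg.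
have pn : phase_periodic (fun z => Num.max (- g z) 0) by move=> v j x; rewrite pg.
have p0 z : 0 <= Num.max (g z) 0 by rewrite le_max lexx orbT.
have n0 z : 0 <= Num.max (- g z) 0 by rewrite le_max lexx orbT.
have := ge0_eint_flow T0 cp pp p0; have := ge0_eint_flow T0 cn pn n0.
rewrite /phase_eint => hn hp; congr (_ - _)%E.
  move: hp; congr (_ = _); apply: eq_integral => w _; by rewrite unlock /= EFin_max.
by move: hn; congr (_ = _); apply: eq_integral => w _; rewrite unlock /= EFin_max EFinN.
Qed.

End FlowPreserves.

(** * Transport along characteristics *)

Lemma within_comp {X Y Z : topologicalType} (A : set X) (S : set Y) (g : X -> Y) (F : Y -> Z) :
  continuous g -> (forall x, A x -> S (g x)) -> {within S, continuous F} ->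
  {within A, continuous (F \o g)}.
Proof.
move=> cg gS /subspace_continuousP cF; apply/subspace_continuousP => x Ax.
apply: (@cvg_comp _ _ _ g F _ (within S (nbhs (g x)))); last exact: (cF _ (gS _ Ax)).
move=> B; rewrite /within /= => hB.
have := cg x _ hB; rewrite /nbhs /=; apply: filterS => y hy Ay.
by apply: hy; exact: gS.
Qed.

Section AlongCurves.
Context {R : realType} {n d : nat}.
Local Notation mx := 'M[R]_(n, d).
Local Notation Ph := (phase R n d).

Lemma differentiable_curve (x : R -> mx) (dx : mx) (t : R) :
  (forall i c, is_derive t 1 (fun s => x s i c) (dx i c)) ->
  differentiable x t /\ 'd x t 1 = dx.
Proof.
move=> h; have dd : derivable x t 1 by apply/derivable_mxP => i c; case: (h i c).
have D : differentiable x t by apply/derivable1_diffP.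
split=> //; rewrite -deriveE// derive_mx//; apply/matrixP => i c; rewrite mxE.
by have := h i c => hh; rewrite derive_val.
Qed.

(** Chain rule, with the differential evaluated on coordinate directions because the equations are
    stated with directional derivatives. *)
Lemma is_derive_along (F : R * Ph -> R) (x v : R -> mx) (dx dv : mx) (t : R) :
  differentiable F (t, (x t, v t)) ->
  (forall i c, is_derive t 1 (fun s => x s i c) (dx i c)) ->
  (forall i c, is_derive t 1 (fun s => v s i c) (dv i c)) ->
  is_derive t 1 (fun s => F (s, (x s, v s)))
    ('D_1 (fun s => F (s, (x t, v t))) t +
     \sum_(j < n) \sum_(i < d) (dx j i * 'D_(x_dir R j i) (fun z => F (t, z)) (x t, v t) +
       dv j i * 'D_(v_dir R j i) (fun z => F (t, z)) (x t, v t))).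
Proof.
move=> dF hx hv.
have [Dx dxE] := differentiable_curve hx; have [Dv dvE] := differentiable_curve hv.
have Dxv : differentiable (fun s => (x s, v s) : Ph) t by exact: differentiable_pair.
pose g s : R * Ph := (s, (x s, v s)).
have Did : differentiable (id : R -> R) t by [].
have Dg : differentiable g t by exact: differentiable_pair.
have dgE : 'd g t 1 = (1, (dx, dv)).
  have h1 := congr1 (fun f : R -> R * Ph => f 1) (diff_pair Did Dxv).
  have h2 := congr1 (fun f : R -> Ph => f 1) (diff_pair Dx Dv).
  have h3 : 'd (id : R -> R) t 1 = 1 by rewrite diff_val.
  transitivity ('d (id : R -> R) t 1, 'd (fun s => (x s, v s) : Ph) t 1); first exact: h1.
  congr pair; first exact: h3.
  transitivity ('d x t 1, 'd v t 1); first exact: h2.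
  by congr pair.
have DFg : differentiable (F \o g) t by exact: differentiable_comp.
have DFgE : 'D_1 (F \o g) t = 'd F (g t) (1, (dx, dv)).
  by rewrite deriveE// diff_comp//= dgE.
have e0 (w : Ph) : 'd F (g t) (0, w) = 'D_w (fun z => F (t, z)) (x t, v t).
  transitivity ('D_((0, w) : R * Ph) F (g t)); first by apply/esym; exact: deriveE.
  apply: (congr1 (fun f : R -> R => lim (f @ 0^'))); apply/funext => h.
  by congr (h^-1 *: (F _ - _)); congr pair; rewrite /= scaler0 add0r.
have e1 : 'd F (g t) (1, 0) = 'D_1 (fun s => F (s, (x t, v t))) t.
  transitivity ('D_((1, 0) : R * Ph) F (g t)); first by apply/esym; exact: deriveE.
  apply: (congr1 (fun f : R -> R => lim (f @ 0^'))); apply/funext => h.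
  by congr (h^-1 *: (F _ - _)); congr pair; rewrite /= scaler0 add0r.
have dec : (1, (dx, dv)) = ((1, 0) : R * Ph) + \sum_(j < n) \sum_(i < d)
    (dx j i *: ((0, x_dir R j i) : R * Ph) + dv j i *: ((0, v_dir R j i) : R * Ph)).
  pose L (w : Ph) : R * Ph := (0, w).
  have addL (w w' : Ph) : L (w + w') = L w + L w' by rewrite /L; congr pair; rewrite addr0.
  have -> : \sum_(j < n) \sum_(i < d)
    (dx j i *: ((0, x_dir R j i) : R * Ph) + dv j i *: ((0, v_dir R j i) : R * Ph)) =
    L (\sum_(j < n) \sum_(i < d) (dx j i *: x_dir R j i + dv j i *: v_dir R j i)).
    rewrite (big_morph L addL (erefl _)); apply: eq_bigr => j _.
    rewrite (big_morph L addL (erefl _)); apply: eq_bigr => i _.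
    by rewrite addL; congr (_ + _); congr pair; rewrite /= scaler0.
  have -> : \sum_(j < n) \sum_(i < d) (dx j i *: x_dir R j i + dv j i *: v_dir R j i) = (dx, dv) :> Ph.
    pose A (w : mx) : Ph := (w, 0); pose C (w : mx) : Ph := (0, w).
    have addA (w w' : mx) : A (w + w') = A w + A w' by rewrite /A; congr pair; rewrite addr0.
    have addC (w w' : mx) : C (w + w') = C w + C w' by rewrite /C; congr pair; rewrite addr0.
    transitivity (A dx + C dv); last by congr pair; rewrite /= ?addr0 ?add0r.
    rewrite [in RHS](matrix_sum_delta dx) [in RHS](matrix_sum_delta dv).
    rewrite (big_morph A addA (erefl _)) (big_morph C addC (erefl _)) -big_split/=.
    apply: eq_bigr => j _; rewrite (big_morph A addA (erefl _)) (big_morph C addC (erefl _)) -big_split/=.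
    by apply: eq_bigr => i _; congr (_ + _); congr pair; rewrite /= scaler0.
  by congr pair; rewrite /= ?addr0 ?add0r.
split; first by apply/derivable1_diffP.
rewrite [LHS]DFgE dec linearD/= linear_sum e1; congr (_ + _); apply: eq_bigr => j _.
rewrite linear_sum; apply: eq_bigr => i _.
by rewrite linearD !linearZ !e0.
Qed.

Variables (E : R -> mx -> mx) (F : R -> Ph -> R).
Hypothesis Fcl : classical F.
Hypothesis Fpde : forall t z, 0 < t -> free_transport F t z =
  - \sum_(j < n) \sum_(i < d) E t z.1 j i * 'D_(v_dir R j i) (F t) z.

Lemma classical_continuous t : 0 <= t -> continuous (F t).
Proof.
move=> t0; have [_ cF _] := Fcl.
have cg : continuous (fun z : Ph => (t, z) : R * Ph).
  move=> z; exact: (@cvg_pair _ _ _ (nbhs z) (nbhs t) (nbhs z) _ _ _ (cst t) id (cvg_cst t) (@cvg_id _ _)).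
have := @within_comp _ _ _ setT _ _ _ cg (fun _ _ => t0) cF.
by move=> h; apply/continuous_subspace_setT; exact: h.
Qed.

(** The equation holds at positive times only; continuity up to time 0 lets the mean value theorem
    reach the initial datum. *)
Lemma constant_along z x v T : solves E z x v -> 0 <= T -> F T (x T, v T) = F 0 z.
Proof.
move=> hs T0; have [_ cF dF] := Fcl; have [x0 v0 hx hv] := hs.
pose g (s : R) : R * Ph := (s, (x s, v s)).
have cx i c := (trajectory_cont hs i c).1; have cv i c := (trajectory_cont hs i c).2.
have cg : continuous g.
  move=> s; exact: (@cvg_pair _ _ _ (nbhs s) (nbhs s) (nbhs (x s, v s)) _ _ _ id
    (fun s => (x s, v s)) (@cvg_id _ _) (phase_continuous cx cv (x:=s))).
have cG : {within `[0, T], continuous ((fun tz : R * Ph => F tz.1 tz.2) \o g)}.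
  by apply: within_comp cg _ cF => s /=; rewrite in_itv/= => /andP[].
have dG (s : R) : s \in `]0, T[%R -> is_derive s 1 ((fun tz : R * Ph => F tz.1 tz.2) \o g) ((fun=> 0) s).
  rewrite in_itv/= => /andP[s0 _].
  have h := is_derive_along (dF s (x s, v s) s0) (hx s) (hv s).
  apply: (is_derive_eq h) => /=.
  have := Fpde (x s, v s) s0; rewrite /free_transport /= => pde.
  rewrite max_l ?(ltW s0)//.
  under eq_bigr do rewrite big_split/=.
  by rewrite big_split/= addrA pde addNr.
have [c _] := MVT_segment T0 dG cG.
rewrite /= mul0r => /eqP; rewrite subr_eq0 => /eqP ->.
by rewrite x0 v0 -surjective_pairing.
Qed.

End AlongCurves.

Section Representation.
Context {R : realType} {n d : nat}.
Local Notation mx := 'M[R]_(n, d).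
Local Notation Ph := (phase R n d).
Variables (E : R -> mx -> mx) (B L : R).
Hypothesis (B0 : 0 <= B) (L0 : 0 <= L) (hE : regular_field B L E).
Hypothesis perE : forall t (x : mx) (k : 'M[int]_(n, d)), E t (x + map_mx intr k) = E t x.
Variables (X V : Ph -> R -> mx).
Hypothesis hflow : forall z, solves E z (X z) (V z).
Variables (F : R -> Ph -> R).
Hypothesis Fcl : classical F.
Hypothesis Fpde : forall t z, 0 < t -> free_transport F t z =
  - \sum_(j < n) \sum_(i < d) E t z.1 j i * 'D_(v_dir R j i) (F t) z.

(** [psi] is the identity when expectations are transported, and the absolute value in the proof
    that the Liouville solution is integrable. *)
Lemma eint_transport (psi : R -> R) (phi : Ph -> R) T : 0 <= T ->
  continuous psi -> continuous phi -> phase_periodic phi ->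
  phase_eint (fun z => phi z * psi (F T z)) = phase_eint (fun z => phi (X z T, V z T) * psi (F 0 z)).
Proof.
move=> T0 cpsi cphi pphi.
have [perF _ _] := Fcl.
have cF := classical_continuous Fcl T0.
have cg : continuous (fun z => phi z * psi (F T z)) by apply: cont_mul => //; exact: cont_comp.
have pg : phase_periodic (fun z => phi z * psi (F T z)).
  by move=> v k x; rewrite (pphi v k x) (perF T T0 v k x).
rewrite -(eint_flow L0 hE perE hflow T0 cg pg).
by congr phase_eint; apply/funext => z; rewrite (constant_along Fcl Fpde (hflow z) T0).
Qed.

End Representation.

(** * Independent particles *)

Section IndexPairs.
Context {m d : nat}.

Definition mxvec_inv (k : 'I_(m * d)) : 'I_m * 'I_d :=
  enum_val (cast_ord (esym (mxvec_cast m d)) k).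

Lemma mxvec_invK k : mxvec_index (mxvec_inv k).1 (mxvec_inv k).2 = k.
Proof. by rewrite /mxvec_index -surjective_pairing enum_valK cast_ordKV. Qed.

Lemma mxvec_indexK i c : mxvec_inv (mxvec_index i c) = (i, c).
Proof. by rewrite /mxvec_inv /mxvec_index cast_ordK enum_rankK. Qed.

End IndexPairs.

Definition phase_sigma (R : realType) (k d : nat) :=
  product_sigma_measure (power_measure (circle_measure R) (k * d)) (power_measure (line_measure R) (k * d)).

(** * Splitting off one particle *)

Section Insertion.
Context {R : realType} {n d : nat}.
Local Notation coords k := ((k * d).-tuple (measurableTypeR R)).
Variable l : 'I_n.+1.

Definition insert_mx (a : 'M[R]_(1, d)) (b : 'M[R]_(n, d)) : 'M[R]_(n.+1, d) :=
  \matrix_(i, c) if unlift l i is Some j then b j c else a ord0 c.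

Definition insert (y : phase R 1 d) (z : phase R n d) : phase R n.+1 d :=
  (insert_mx y.1 z.1, insert_mx y.2 z.2).

Let e (k : 'I_(n.+1 * d)) : 'I_(1 * d) + 'I_(n * d) :=
  if unlift l (mxvec_inv k).1 is Some j then inr (mxvec_index j (mxvec_inv k).2)
  else inl (mxvec_index ord0 (mxvec_inv k).2).

Let e' (u : 'I_(1 * d) + 'I_(n * d)) : 'I_(n.+1 * d) :=
  match u with inl a => mxvec_index l (mxvec_inv a).2
  | inr b => mxvec_index (lift l (mxvec_inv b).1) (mxvec_inv b).2 end.

Let e_bij : bijective e.
Proof.
exists e' => [k|[a|b]]; rewrite /e /e'.
- rewrite -[RHS]mxvec_invK; case: unliftP => [j|] ->; by rewrite !mxvec_indexK.
- by rewrite mxvec_indexK /= unlift_none -[in RHS](mxvec_invK a) (ord1 (mxvec_inv a).1).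
- by rewrite mxvec_indexK /= liftK mxvec_invK.
Qed.

Definition insert_coords (st : coords 1 * coords n) : coords n.+1 :=
  [tuple match e i with inl x => tnth st.1 x | inr y => tnth st.2 y end | i < n.+1 * d].

Definition insert_phase_coords (w : (coords 1 * coords 1) * (coords n * coords n)) :
  coords n.+1 * coords n.+1 :=
  (insert_coords (w.1.1, w.2.1), insert_coords (w.1.2, w.2.2)).

Lemma insert_coordsE s t : mx_of_coords (insert_coords (s, t)) = insert_mx (mx_of_coords s) (mx_of_coords t).
Proof.
apply/matrixP => i c; rewrite mx_of_coordsE tnth_mktuple [RHS]mxE /e mxvec_indexK /=.
by case: unliftP => [j|] _; rewrite mx_of_coordsE.
Qed.

Lemma insert_phase_coordsE w :
  phase_of_coords (insert_phase_coords w) = insert (phase_of_coords w.1) (phase_of_coords w.2).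
Proof. by rewrite /phase_of_coords /= !insert_coordsE. Qed.

(** Positions and velocities are merged separately by [preserving_merge]; [ge0_integral_shuffle],
    applied to an indicator function, reconciles the two groupings of the variables. *)
Lemma insert_preserving :
  measure_preserving (phase_sigma R 1 d \x phase_sigma R n d)%E
    (phase_measure R n.+1 d) insert_phase_coords.
Proof.
pose Pc k := power_measure (circle_measure R) (k * d).
pose Pl k := power_measure (line_measure R) (k * d).
have pc : measure_preserving (product_sigma_measure (Pc 1%N) (Pc n)) (Pc n.+1) insert_coords.
  exact: (preserving_merge (circle_measure R) e_bij).
have pl : measure_preserving (product_sigma_measure (Pl 1%N) (Pl n)) (Pl n.+1) insert_coords.
  exact: (preserving_merge (line_measure R) e_bij).
have [mpp hpp] := preserving_prod pc pl.
have mphi : measurable_fun setT insert_phase_coords.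
  apply: measurable_fun_pair; apply: (measurableT_comp pc.1); apply: measurable_fun_pair.
  - exact: (measurableT_comp measurable_fst measurable_fst).
  - exact: (measurableT_comp measurable_fst measurable_snd).
  - exact: (measurableT_comp measurable_snd measurable_fst).
  - exact: (measurableT_comp measurable_snd measurable_snd).
split=> // A mA.
rewrite -[RHS](hpp _ mA).
pose psi (xy : (coords 1 * coords n) * (coords 1 * coords n)) := (insert_coords xy.1, insert_coords xy.2).
have mpsi : measurable (psi @^-1` A) by rewrite -[X in measurable X]setTI; exact: mpp.
have mphiA : measurable (insert_phase_coords @^-1` A) by rewrite -[X in measurable X]setTI; exact: mphi.
pose f w : \bar R := (\1_(insert_phase_coords @^-1` A) w)%:E.
have mf : measurable_fun setT f by apply/measurable_EFinP.
have f0 w : (0 <= f w)%E by rewrite lee_fin.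
have := ge0_integral_shuffle (Pc 1%N) (Pl 1%N) (Pc n) (Pl n) mf f0.
move=> h.
have hB := @integral_indic _ _ R (phase_sigma R 1 d \x phase_sigma R n d)%E setT measurableT _ mphiA.
rewrite setIT in hB; apply: (etrans (esym hB)); apply: (etrans (esym h)).
have hC := @integral_indic _ _ R (product_sigma_measure (Pc 1%N) (Pc n) \x
  product_sigma_measure (Pl 1%N) (Pl n))%E setT measurableT _ mpsi.
by rewrite setIT in hC; apply: (etrans _ hC).
Qed.

End Insertion.

Section InsertionAlgebra.
Context {R : realType} {n d : nat}.
Variable l : 'I_n.+1.

Lemma particle_insert (y : phase R 1 d) (z : phase R n d) : particle (insert l y z) l = y.
Proof.
by case: y => a b; congr pair; apply/matrixP => i c; rewrite !mxE unlift_none [i]ord1.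
Qed.

Lemma particle_insert_lift (y : phase R 1 d) (z : phase R n d) j :
  particle (insert l y z) (lift l j) = particle z j.
Proof. by congr pair; apply/matrixP => i c; rewrite !mxE liftK. Qed.

Lemma continuous_insert1 (z : phase R n d) : continuous (fun y : phase R 1 d => insert l y z).
Proof.
apply: phase_continuous => i c; under eq_fun do rewrite mxE;
  case: (unlift l i) => [j|]; [exact: cont_cst|exact: continuous_pos|exact: cont_cst|exact: continuous_vel].
Qed.

End InsertionAlgebra.

Lemma continuous_particle {R : realType} {n d : nat} (j : 'I_n) : continuous (fun z : phase R n d => particle z j).
Proof.
by apply: phase_continuous => i c; under eq_fun do rewrite mxE; [exact: continuous_pos|exact: continuous_vel].
Qed.

Section BoundedContinuous.
Context {R : realType} {T : topologicalType}.
Implicit Types f g : T -> R.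

Definition bc f : Prop := continuous f /\ exists M, forall z, `|f z| <= M.

Lemma bc_cst (a : R) : bc (fun=> a).
Proof. by split; [exact: cont_cst|exists `|a|]. Qed.

Lemma bc_add f g : bc f -> bc g -> bc (fun z => f z + g z).
Proof.
move=> [cf [M hM]] [cg [K hK]]; split; first exact: cont_add.
by exists (M + K) => z; apply: le_trans (ler_normD _ _) _; exact: lerD.
Qed.

Lemma bc_opp f : bc f -> bc (fun z => - f z).
Proof. by move=> [cf [M hM]]; split; [exact: cont_opp|exists M => z; rewrite normrN]. Qed.

Lemma bc_sub f g : bc f -> bc g -> bc (fun z => f z - g z).
Proof. by move=> bf bg; exact: bc_add bf (bc_opp bg). Qed.

Lemma bc_mul f g : bc f -> bc g -> bc (fun z => f z * g z).
Proof.
move=> [cf [M hM]] [cg [K hK]]; split; first exact: cont_mul.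
by exists (M * K) => z; rewrite normrM ler_pM.
Qed.

Lemma bc_sum (I : Type) (s : seq I) (P : pred I) (f : I -> T -> R) :
  (forall i, P i -> bc (f i)) -> bc (fun x => \sum_(i <- s | P i) f i x).
Proof.
move=> h; elim: s => [|i s ih].
  by under eq_fun do rewrite big_nil; exact: bc_cst.
under eq_fun do rewrite big_cons.
have [Pi|_ //] := boolP (P i).
exact: bc_add (h _ Pi) ih.
Qed.

Lemma bc_norm f : bc f -> bc (fun z => `|f z|).
Proof. by move=> [cf [M hM]]; split; [exact: cont_norm|exists M => z; rewrite normr_id]. Qed.

End BoundedContinuous.

Lemma bc_comp {R : realType} {T U : topologicalType} (g : U -> T) (f : T -> R) : continuous g -> bc f -> bc (fun z => f (g z)).
Proof. by move=> cg [cf [M hM]]; split; [exact: cont_comp|exists M]. Qed.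

Lemma cont_particle {R : realType} {n d : nat} (j : 'I_n) (f : phase R 1 d -> R) :
  continuous f -> continuous (fun z : phase R n d => f (particle z j)).
Proof. by move=> cf; exact: (cont_comp (@continuous_particle _ _ _ j) cf). Qed.

Lemma bc_particle {R : realType} {n d : nat} (j : 'I_n) (f : phase R 1 d -> R) :
  bc f -> bc (fun z : phase R n d => f (particle z j)).
Proof. by move=> [cf [M hM]]; split; [exact: cont_particle|exists M]. Qed.

Section Expectation.
Context {R : realType} {d : nat}.
Variable F0 : phase R 1 d -> R.
Hypothesis (cF0 : continuous F0) (F00 : forall z, 0 <= F0 z) (F01 : phase_eint F0 = 1%E).

Definition weight n (z : phase R n d) : R := \prod_(j < n) F0 (particle z j).

Definition expect n (G : phase R n d -> R) : R := phase_integral (fun z => G z * weight z).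

Definition mean (g : phase R 1 d -> R) : R := phase_integral (fun y => g y * F0 y).

Lemma weight_ge0 n (z : phase R n d) : 0 <= weight z.
Proof. by apply: prodr_ge0. Qed.

Lemma weight_insert n (l : 'I_n.+1) y (z : phase R n d) : weight (insert l y z) = F0 y * weight z.
Proof.
rewrite /weight (bigD1_ord l)//= particle_insert; congr (_ * _).
by apply: eq_bigr => j _; rewrite particle_insert_lift.
Qed.

Lemma weight1 (y : phase R 1 d) : weight y = F0 y.
Proof.
rewrite /weight big_ord1; congr F0; case: y => a b; congr pair;
  by apply/matrixP => i c; rewrite mxE [i]ord1.
Qed.

Lemma expect1 (g : phase R 1 d -> R) : expect g = mean g.
Proof. by congr phase_integral; apply/funext => y; rewrite weight1. Qed.

Lemma continuous_weight n : continuous (@weight n).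
Proof. by apply: cont_prod => j _; exact: cont_particle. Qed.

Lemma eint_insert n (l : 'I_n.+1) (f : phase R n.+1 d -> R) : continuous f ->
  phase_eint f = (\int[phase_sigma R 1 d \x phase_sigma R n d]_w
    (f (insert l (phase_of_coords w.1) (phase_of_coords w.2)))%:E)%E.
Proof.
move=> cf; rewrite /phase_eint -(integral_preserving (insert_preserving l) (measurable_phase_EFin cf)).
by apply: eq_integral => w _; rewrite insert_phase_coordsE.
Qed.

Lemma eint_weight n : phase_eint (@weight n) = 1%E.
Proof.
elim: n => [|n ih].
  rewrite /phase_eint (_ : (fun w => _) = cst 1%E); last first.
    by apply/funext => w; rewrite /weight big_ord0.
  rewrite integral_cst// mul1e.
  have -> : [set: ((0 * d).-tuple (measurableTypeR R) * (0 * d).-tuple (measurableTypeR R))%type] =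
    box (fun=> setT) `*` box (fun=> setT) by apply/seteqP; split=> // -[s t] _.
  apply: (etrans (product_measure1E _ _ _ _)) => //; try by apply: measurable_box.
  have one (mu : {sigma_finite_measure set (measurableTypeR R) -> \bar R}) :
      power_measure mu (0 * d) (box (fun=> setT)) = 1%E.
    by rewrite power_measure_box// big_ord0.
  by transitivity (1 * 1 : \bar R)%E; [congr (_ * _)%E; exact: one|rewrite mul1e].
rewrite (eint_insert ord0 (@continuous_weight n.+1)).
under eq_integral do rewrite weight_insert EFinM.
rewrite (fubini_tonelli1 (m1 := phase_sigma R 1 d) (m2 := phase_sigma R n d)) /fubini_F /=; last 2 first.
- apply: emeasurable_funM.
    by apply: (measurableT_comp (measurable_phase_EFin cF0)); exact: measurable_fst.
  by apply: (measurableT_comp (measurable_phase_EFin (@continuous_weight n))); exact: measurable_snd.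
- by move=> w; rewrite mule_ge0// lee_fin// weight_ge0.
rewrite -[RHS]F01; apply: eq_integral => w _.
rewrite ge0_integralZl//.
- by rewrite [X in (_ * X)%E]ih mule1.
- exact: (measurable_phase_EFin (@continuous_weight n)).
- by move=> w' _; rewrite lee_fin weight_ge0.
- by rewrite lee_fin.
Qed.

Lemma integrable_weight n (G : phase R n d -> R) : bc G ->
  (phase_measure R n d).-integrable setT
    (fun w => (G (phase_of_coords w) * weight (phase_of_coords w))%:E).
Proof.
move=> [cG [M hM]].
apply: (@le_integrable _ _ _ _ _ _ _ (fun w => (M * weight (phase_of_coords w))%:E)) => //.
- by apply: (measurable_phase_EFin (f := fun z => G z * weight z)); apply: cont_mul => //; exact: continuous_weight.
- move=> w _; rewrite !abse_EFin lee_fin !normrM [`|weight _|]ger0_norm ?weight_ge0//.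
  by rewrite ler_wpM2r ?weight_ge0// (le_trans (hM _))// ler_norm.
- have h : (phase_measure R n d).-integrable setT (fun w => (weight (phase_of_coords w))%:E).
    apply/integrableP; split; first exact: (measurable_phase_EFin (@continuous_weight n)).
    under eq_integral do rewrite gee0_abs ?lee_fin ?weight_ge0//.
    by rewrite -/(phase_eint _) eint_weight ltry.
  under eq_fun do rewrite EFinM.
  exact: integrableZl.
Qed.

Lemma expect_cst n (a : R) : expect (fun _ : phase R n d => a) = a.
Proof.
rewrite /expect /phase_integral RintegralZl//.
  by rewrite /Rintegral -/(phase_eint _) eint_weight mulr1.
have := @integrable_weight n (fun=> 1) (bc_cst 1).
by under eq_fun do rewrite mul1r.
Qed.

Lemma expectD n (G H : phase R n d -> R) : bc G -> bc H ->
  expect (fun z => G z + H z) = expect G + expect H.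
Proof.
move=> bG bH; rewrite /expect /phase_integral -RintegralD//; try exact: integrable_weight.
by apply: eq_Rintegral => w _; rewrite mulrDl.
Qed.

Lemma expectZ n (a : R) (G : phase R n d -> R) : bc G ->
  expect (fun z => a * G z) = a * expect G.
Proof.
move=> bG; rewrite /expect /phase_integral -RintegralZl//; last exact: integrable_weight.
by apply: eq_Rintegral => w _; rewrite mulrA.
Qed.

Lemma expectB n (G H : phase R n d -> R) : bc G -> bc H ->
  expect (fun z => G z - H z) = expect G - expect H.
Proof.
move=> bG bH; rewrite /expect /phase_integral -RintegralB//; try exact: integrable_weight.
by apply: eq_Rintegral => w _; rewrite mulrBl.
Qed.

Lemma expect_sum n (I : Type) (s : seq I) (P : pred I) (G : I -> phase R n d -> R) :
  (forall i, bc (G i)) ->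
  expect (fun z => \sum_(i <- s | P i) G i z) = \sum_(i <- s | P i) expect (G i).
Proof.
move=> h; elim: s => [|i s ih].
  by under eq_fun do rewrite big_nil; rewrite big_nil expect_cst.
under eq_fun do rewrite big_cons; rewrite big_cons; case: ifPn => // Pi.
by rewrite expectD// ?ih//; apply: bc_sum.
Qed.

Lemma expect_le n (G H : phase R n d -> R) : bc G -> bc H -> (forall z, G z <= H z) ->
  expect G <= expect H.
Proof.
move=> bG bH h; rewrite /expect /phase_integral le_Rintegral//; try exact: integrable_weight.
by move=> w _; rewrite ler_wpM2r ?weight_ge0.
Qed.

Lemma expect_norm n (G : phase R n d -> R) : bc G -> `|expect G| <= expect (fun z => `|G z|).
Proof.
move=> bG; rewrite ler_norml -mulN1r -expectZ; last exact: bc_norm.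
apply/andP; split; apply: expect_le => //; try exact: bc_norm.
- by apply: bc_mul; [exact: bc_cst|exact: bc_norm].
- by move=> z; rewrite mulN1r lerNl -normrN ler_norm.
- by move=> z; exact: ler_norm.
Qed.

Lemma expect_bound n (G : phase R n d -> R) M : continuous G -> (forall z, `|G z| <= M) -> `|expect G| <= M.
Proof.
move=> cG h; have bG : bc G by split => //; exists M.
apply: le_trans (expect_norm bG) _; rewrite -[leRHS](expect_cst n M).
by apply: expect_le => //; [exact: bc_norm|exact: bc_cst].
Qed.

(** Conditioning on all particles but the l-th: when the conditional mean is a constant, it is the
    expectation. All cancellations between independent particles go through this lemma. *)
Lemma expect_insert n (l : 'I_n.+1) (G : phase R n.+1 d -> R) (a : R) : bc G ->
  (forall z, mean (fun y => G (insert l y z)) = a) -> expect G = a.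
Proof.
move=> bG h; have [cG _] := bG.
have cw : continuous (fun z => G z * weight z) by apply: cont_mul => //; exact: continuous_weight.
transitivity (fine (phase_eint (fun z => G z * weight z))); first by [].
rewrite (eint_insert l cw).
set f := (fun w => _).
have iG := integrable_weight bG.
have mf : measurable_fun setT f.
  have := measurableT_comp (measurable_phase_EFin cw) (insert_preserving l).1.
  by congr measurable_fun; apply/funext => w; rewrite /f /= insert_phase_coordsE.
have iF : (phase_sigma R 1 d \x phase_sigma R n d)%E.-integrable setT f.
  apply/integrableP; split=> //.
  have /integrableP[_] := iG.
  have mabs : measurable_fun setT (fun w => `|(G (phase_of_coords w) * weight (phase_of_coords w))%:E|%E).
    by apply: measurableT_comp => //; exact: (measurable_phase_EFin cw).
  rewrite -(integral_preserving (insert_preserving l) mabs).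
  by under eq_integral do rewrite insert_phase_coordsE.
have i1 z : (phase_measure R 1 d).-integrable setT
    (fun w => (G (insert l (phase_of_coords w) z) * F0 (phase_of_coords w))%:E).
  have := @integrable_weight 1 _ (bc_comp (@continuous_insert1 _ _ _ l z) bG).
  by under eq_fun do rewrite weight1.
rewrite -(integral21_prod_meas1 iF) /fubini_G.
rewrite [X in fine X](_ : _ = (\int[phase_sigma R n d]_w' (a * weight (phase_of_coords w'))%:E)%E); last first.
  apply: eq_integral => w' _; rewrite /f /=.
  under eq_integral do rewrite weight_insert mulrA EFinM.
  rewrite integralZr//.
  rewrite EFinM -(h (phase_of_coords w')); congr (_ * _)%E.
  apply/esym/fineK; exact: (integrable_fin_num measurableT (i1 (phase_of_coords w'))).
exact: expect_cst.
Qed.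

Lemma expect_particle n (l : 'I_n.+1) (g : phase R 1 d -> R) : bc g ->
  expect (fun z : phase R n.+1 d => g (particle z l)) = mean g.
Proof.
move=> bg; apply: (expect_insert (l := l)); first exact: bc_particle.
by move=> z; under eq_fun do rewrite particle_insert.
Qed.

End Expectation.

Section RowPermutation.
Context {R : realType} {n d : nat}.

Definition perm_rows (s : 'I_n -> 'I_n) (z : phase R n d) : phase R n d :=
  (\matrix_(i, c) z.1 (s i) c, \matrix_(i, c) z.2 (s i) c).

Lemma particle_perm_rows s z j : particle (perm_rows s z) j = particle z (s j).
Proof. by congr pair; apply/matrixP => i c; rewrite !mxE. Qed.

Lemma eint_perm_rows s (f : phase R n d -> R) : bijective s -> continuous f ->
  phase_eint (fun z => f (perm_rows s z)) = phase_eint f.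
Proof.
move=> [s' ss' s's] cf.
pose idx (k : 'I_(n * d)) := mxvec_index (s (mxvec_inv k).1) (mxvec_inv k).2.
have bidx : bijective idx.
  exists (fun k => mxvec_index (s' (mxvec_inv k).1) (mxvec_inv k).2) => k;
    by rewrite /idx mxvec_indexK /= ?ss' ?s's mxvec_invK.
have pp := preserving_prod (preserving_perm (circle_measure R) bidx) (preserving_perm (line_measure R) bidx).
rewrite /phase_eint -[RHS](integral_preserving pp (measurable_phase_EFin cf)).
apply: eq_integral => w _; congr (f _)%:E; congr pair; apply/matrixP => i c;
  by rewrite mxE !mx_of_coordsE tnth_mktuple /idx mxvec_indexK.
Qed.

End RowPermutation.

(** * Pair kernels and their fluctuations *)

Section Expectation2.
Context {R : realType} {d : nat}.
Variable F0 : phase R 1 d -> R.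
Hypothesis (cF0 : continuous F0) (F00 : forall z, 0 <= F0 z) (F01 : phase_eint F0 = 1%E).
Local Notation D := (phase R 1 d).
Local Notation mean := (mean F0).
Local Notation expect := (expect F0).

Lemma expect_perm n (s : 'I_n -> 'I_n) (G : phase R n d -> R) : bijective s -> bc G ->
  expect (fun z => G (perm_rows s z)) = expect G.
Proof.
move=> bs [cG _].
have cw : continuous (fun z => G z * weight F0 z) by apply: cont_mul => //; exact: (continuous_weight cF0).
transitivity (fine (phase_eint (fun z => G z * weight F0 z))); last by [].
rewrite -(eint_perm_rows bs cw).
transitivity (fine (phase_eint (fun z => G (perm_rows s z) * weight F0 z))); first by [].
suff wE z : weight F0 z = weight F0 (perm_rows s z) by under eq_fun do rewrite wE.
rewrite /weight (reindex s)/=; last by apply: onW_bij.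
by apply: eq_bigr => j _; rewrite particle_perm_rows.
Qed.

(** Phase space is not compact, so uniformity in the second argument is asked for explicitly; it
    passes under the integral and makes [mean (g y)] continuous in y. *)
Definition equicont (g : D -> D -> R) : Prop :=
  forall y e, 0 < e -> \forall y' \near y, forall z, `|g y z - g y' z| <= e.

Definition pair_kernel (M : R) (g : D -> D -> R) : Prop :=
  [/\ continuous (fun p : D * D => g p.1 p.2), forall y z, `|g y z| <= M & equicont g].

Lemma continuous_pair {T U V : topologicalType} (f : T -> U) (g : T -> V) :
  continuous f -> continuous g -> continuous (fun x => (f x, g x)).
Proof.
by move=> cf cg x; exact: (@cvg_pair _ _ _ (nbhs x) (nbhs (f x)) (nbhs (g x)) _ _ _ f g (cf x) (cg x)).
Qed.

Lemma kernel_bc1 M g y : pair_kernel M g -> bc (g y).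
Proof.
move=> [cg hM _]; split; last by exists M.
by apply: (cont_comp (f := fun z => (y, z)) _ cg); apply: continuous_pair; [exact: cst_continuous|move=> z; exact: cvg_id].
Qed.

Lemma kernel_bc M g n (j l : 'I_n) : pair_kernel M g ->
  bc (fun z : phase R n d => g (particle z j) (particle z l)).
Proof.
move=> [cg hM _]; split; last by exists M.
apply: (cont_comp (f := fun z : phase R n d => (particle z j, particle z l)) _ cg).
by apply: continuous_pair; exact: continuous_particle.
Qed.

Lemma mean_bound g M : continuous g -> (forall y, `|g y| <= M) -> `|mean g| <= M.
Proof. by move=> cg h; rewrite -expect1; exact: expect_bound. Qed.

Lemma meanB g h : bc g -> bc h -> mean (fun y => g y - h y) = mean g - mean h.
Proof. by move=> bg bh; rewrite -!expect1; exact: expectB. Qed.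

Lemma meanZ a g : bc g -> mean (fun y => a * g y) = a * mean g.
Proof. by move=> bg; rewrite -!expect1; exact: expectZ. Qed.

Lemma mean_cst a : mean (fun=> a) = a.
Proof. by rewrite -expect1; exact: expect_cst. Qed.

Lemma kernel_mean M g : pair_kernel M g -> continuous (fun y => mean (g y)) /\ forall y, `|mean (g y)| <= M.
Proof.
move=> kg; have [cg hM eg] := kg; split; last first.
  by move=> y; apply: mean_bound => //; exact: (kernel_bc1 y kg).1.
move=> y; have FF : Filter (nbhs (y : D)) := nbhs_filter y.
apply/(@cvgrPdist_le _ _ _ (nbhs (y : D)) FF (fun y => mean (g y))) => e e0.
apply: filterS (eg y e e0) => y' h.
rewrite -meanB; [|exact: kernel_bc1 kg..].
by apply: mean_bound => // z; apply: (bc_sub (kernel_bc1 y kg) (kernel_bc1 y' kg)).1.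
Qed.

Definition centered (g : D -> D -> R) (y z : D) : R := g y z - mean (g y).

Lemma kernel_centered M g : pair_kernel M g ->
  [/\ continuous (fun p : D * D => centered g p.1 p.2), forall y z, `|centered g y z| <= 2 * M &
   forall y, mean (centered g y) = 0].
Proof.
move=> kg; have [cm bm] := kernel_mean kg; have [cg hM _] := kg; split.
- apply: cont_sub => //; apply: (cont_comp (f := fst)) cm.
  by move=> [a b]; exact: cvg_fst.
- move=> y z; apply: le_trans (ler_normB _ _) _; rewrite mulrDl mul1r.
  by apply: lerD.
- move=> y; rewrite /centered meanB; [|exact: kernel_bc1 kg|exact: bc_cst].
  by rewrite mean_cst subrr.
Qed.

Section Fluctuations.
Variables (u : D -> D -> R) (M : R).
Hypothesis cu : continuous (fun p : D * D => u p.1 p.2).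
Hypothesis uM : forall y z, `|u y z| <= M.
Hypothesis u0 : forall y, mean (u y) = 0.
Variable n : nat.
Local Notation N := n.+1.

Let bcu (j l : 'I_N) : bc (fun z : phase R N d => u (particle z j) (particle z l)).
Proof.
split; last by exists M.
apply: (cont_comp (f := fun z : phase R N d => (particle z j, particle z l)) _ cu).
by apply: continuous_pair; exact: continuous_particle.
Qed.

(** Particle l is integrated out first: [W] ignores it, and as l differs from j the kernel is
    centered in this variable. *)
Lemma expect_centered0 (j l : 'I_N) (W : phase R N d -> R) : l != j -> bc W ->
  (forall y y' z, W (insert l y z) = W (insert l y' z)) ->
  expect (fun z => W z * u (particle z j) (particle z l)) = 0.
Proof.
move=> lj bW hW; apply: (expect_insert cF0 F00 F01 (l := l)); first exact: bc_mul.
move=> z; have [j' j'E] : exists j', j = lift l j'.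
  by case: (unliftP l j) lj => [j' ->|->]; [exists j'|rewrite eqxx].
have -> : (fun y => W (insert l y z) * u (particle (insert l y z) j) (particle (insert l y z) l)) =
    fun y => W (insert l 0 z) * u (particle z j') y.
  by apply/funext => y; rewrite j'E particle_insert particle_insert_lift (hW y 0).
rewrite meanZ ?u0 ?mulr0//.
split; last by exists M.
apply: (cont_comp (f := fun y => (particle z j', y)) _ cu); apply: continuous_pair.
  exact: cst_continuous.
by move=> y; exact: cvg_id.
Qed.

Let M0 : 0 <= M.
Proof. by apply: le_trans (uM 0 0). Qed.

(** In the expanded square, two different indices l and l' cannot both equal j, and the factor whose
    index is not j is centered given the other particles. Only the N diagonal terms out of N^2
    remain. *)
Lemma expect_fluct2 (j : 'I_N) :
  expect (fun z : phase R N d => (N%:R^-1 * \sum_(l < N) u (particle z j) (particle z l)) ^+ 2) <= M ^+ 2 / N%:R.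
Proof.
have -> : (fun z : phase R N d => (N%:R^-1 * \sum_(l < N) u (particle z j) (particle z l)) ^+ 2) =
  fun z => N%:R^-1 ^+ 2 * \sum_(l < N) \sum_(l' < N) u (particle z j) (particle z l') * u (particle z j) (particle z l).
  apply/funext => z; rewrite exprMn; congr (_ * _).
  rewrite expr2 mulr_sumr; apply: eq_bigr => l _; rewrite mulr_suml//.
have bb (l l' : 'I_N) : bc (fun z : phase R N d => u (particle z j) (particle z l') * u (particle z j) (particle z l)).
  exact: bc_mul.
rewrite expectZ//; last by apply: bc_sum => l _; apply: bc_sum.
rewrite expect_sum//; last by move=> l; apply: bc_sum.
have key (l : 'I_N) : expect (fun z : phase R N d => \sum_(l' < N) u (particle z j) (particle z l') * u (particle z j) (particle z l)) <= M ^+ 2.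
  rewrite expect_sum// (bigD1 l)//= big1 ?addr0.
    apply: le_trans (ler_norm _) _; apply: expect_bound => //; first exact: (bb l l).1.
    by move=> z; rewrite normrM expr2 ler_pM.
  move=> l' l'l.
  have [lj|lj] := eqVneq l j.
    under eq_fun do rewrite mulrC.
    apply: expect_centered0 => //; first by rewrite -lj.
    by move=> y y' z; case: (unliftP l' j) => [i ->|ji]; [case: (unliftP l' l) => [k ->|lk]|];
      rewrite ?particle_insert_lift//; [move: l'l; rewrite lk eqxx|move: l'l; rewrite lj ji eqxx].
  apply: expect_centered0 => //.
  move=> y y' z; case: (unliftP l j) => [i ->|ji]; last by move: lj; rewrite ji eqxx.
  case: (unliftP l l') => [k ->|lk]; last by move: l'l; rewrite lk eqxx.
  by rewrite !particle_insert_lift.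
apply: (@le_trans _ _ (N%:R^-1 ^+ 2 * \sum_(l < N) M ^+ 2)).
  by apply: ler_wpM2l; [rewrite exprn_ge0|apply: ler_sum].
rewrite sumr_const card_ord -[M ^+ 2 *+ _]mulr_natl.
by rewrite expr2 -mulrA mulKf ?pnatr_eq0// mulrC.
Qed.

(** Only the term l = j survives, which gives 1/N where the mean square alone would give the square
    root of 1/N. *)
Lemma expect_fluct1 (j : 'I_N) (h : D -> R) : bc h -> (forall y, `|h y| <= 1) ->
  `|expect (fun z : phase R N d => h (particle z j) * (N%:R^-1 * \sum_(l < N) u (particle z j) (particle z l)))|
  <= M / N%:R.
Proof.
move=> bh h1.
have bhj : bc (fun z : phase R N d => h (particle z j)) by exact: bc_particle.
have -> : (fun z : phase R N d => h (particle z j) * (N%:R^-1 * \sum_(l < N) u (particle z j) (particle z l))) =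
  fun z => N%:R^-1 * \sum_(l < N) h (particle z j) * u (particle z j) (particle z l).
  by apply/funext => z; rewrite mulrCA mulr_sumr.
rewrite expectZ//; last by apply: bc_sum => l _; exact: bc_mul.
rewrite expect_sum//; last by move=> l; exact: bc_mul.
rewrite (bigD1 j)//= big1 ?addr0.
  rewrite normrM ger0_norm ?invr_ge0// mulrC ler_wpM2r ?invr_ge0//.
  apply: expect_bound => //; first exact: (bc_mul bhj (bcu j j)).1.
  by move=> z; rewrite normrM -[M]mul1r ler_pM.
move=> l lj; apply: expect_centered0 => // y y' z.
case: (unliftP l j) => [i ->|jl]; last by move: lj; rewrite jl eqxx.
by rewrite !particle_insert_lift.
Qed.

End Fluctuations.

End Expectation2.

(** * Time derivatives of expectations *)

Section TimeDerivative.
Context {R : realType} {d : nat}.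
Variable F0 : phase R 1 d -> R.
Hypothesis (cF0 : continuous F0) (F00 : forall z, 0 <= F0 z) (F01 : phase_eint F0 = 1%E).
Local Notation expect := (expect F0).
Context {n : nat}.
Local Notation Ph := (phase R n d).
Implicit Types (G H dG dH : R -> Ph -> R) (t T : R).

(** The bound on [dG], uniform in z, yields the dominating function for differentiation under the
    expectation; the bound on [G] makes the notion stable under products. *)
Definition bounded_path T G dG : Prop :=
  [/\ forall t, 0 <= t <= T -> bc (G t) /\ bc (dG t),
      forall t z, is_derive t 1 (G ^~ z) (dG t z),
      exists M : R, forall t z, 0 <= t <= T -> `|G t z| <= M &
      exists M : R, forall t z, 0 <= t <= T -> `|dG t z| <= M].

Lemma bounded_path_mul T G dG H dH : bounded_path T G dG -> bounded_path T H dH ->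
  bounded_path T (fun t z => G t z * H t z) (fun t z => dG t z * H t z + G t z * dH t z).
Proof.
move=> [b1 d1 [M hM] [K hK]] [b2 d2 [M' hM'] [K' hK']]; split.
- move=> t tT; have [bG bdG] := b1 t tT; have [bH bdH] := b2 t tT.
  by split; [exact: bc_mul|apply: bc_add; exact: bc_mul].
- by move=> t z; exact: dR_mul.
- by exists (M * M') => t z tT; rewrite normrM ler_pM// ?hM ?hM'.
- exists (K * M' + M * K') => t z tT; apply: le_trans (ler_normD _ _) _.
  by rewrite !normrM lerD// ler_pM// ?hM ?hM' ?hK ?hK'.
Qed.

Lemma bounded_path_cst T (g : Ph -> R) : bc g -> bounded_path T (fun=> g) (fun _ _ => 0).
Proof.
move=> bg; have [cg [M hM]] := bg; split.
- by move=> t _; split => //; exact: bc_cst.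
- by move=> t z; exact: dR_cst.
- by exists M => t z _.
- by exists 0 => t z _; rewrite normr0.
Qed.

Lemma bounded_path_sum T (I : finType) (G dG : I -> R -> Ph -> R) :
  (forall i, bounded_path T (G i) (dG i)) ->
  bounded_path T (fun t z => \sum_i G i t z) (fun t z => \sum_i dG i t z).
Proof.
move=> h; split.
- by move=> t tT; split; apply: bc_sum => i _; have [b _ _ _] := h i; have [] := b t tT.
- by move=> t z; apply: dR_sum => i _; have [_ dd _ _] := h i; exact: dd.
- have /choice[M hM] : forall i, exists M : R, forall t z, 0 <= t <= T -> `|G i t z| <= M.
    by move=> i; have [] := h i.
  exists (\sum_i M i) => t z tT; apply: le_trans (ler_norm_sum _ _ _) _.
  by apply: ler_sum => i _; exact: hM.
- have /choice[M hM] : forall i, exists M : R, forall t z, 0 <= t <= T -> `|dG i t z| <= M.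
    by move=> i; have [] := h i.
  exists (\sum_i M i) => t z tT; apply: le_trans (ler_norm_sum _ _ _) _.
  by apply: ler_sum => i _; exact: hM.
Qed.

Lemma bounded_path_add T G dG H dH : bounded_path T G dG -> bounded_path T H dH ->
  bounded_path T (fun t z => G t z + H t z) (fun t z => dG t z + dH t z).
Proof.
move=> [b1 d1 [M1 h1] [M1' h1']] [b2 d2 [M2 h2] [M2' h2']]; split.
- by move=> t tT; have [? ?] := b1 t tT; have [? ?] := b2 t tT; split; exact: bc_add.
- by move=> t z; exact: (dR_add (d1 t z) (d2 t z)).
- exists (M1 + M2) => t z tT; apply: le_trans (ler_normD _ _) _.
  by apply: lerD; [exact: h1|exact: h2].
- exists (M1' + M2') => t z tT; apply: le_trans (ler_normD _ _) _.
  by apply: lerD; [exact: h1'|exact: h2'].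
Qed.

Lemma expect_is_derive T G dG : bounded_path T G dG ->
  forall t, 0 < t < T -> is_derive t 1 (fun s => expect (G s)) (expect (dG t)).
Proof.
move=> [bG dd _ [M hM]] t tT.
pose f (s : R) (w : (n * d).-tuple (measurableTypeR R) * (n * d).-tuple (measurableTypeR R)) := G s (phase_of_coords w) * weight F0 (phase_of_coords w).
have tI : `]0, T[%classic t by rewrite /= in_itv.
have sub (s : R) : `]0, T[%classic s -> 0 <= s <= T.
  by rewrite /= in_itv/= => /andP[s0 sT]; rewrite !ltW.
have if_ (s : R) : `]0, T[%classic s -> (phase_measure R n d).-integrable setT (EFin \o f s).
  by move=> /sub sT; have [b _] := bG s sT; exact: (integrable_weight cF0 F00 F01 b).
have hd (s : R) w : is_derive s 1 (f ^~ w) (dG s (phase_of_coords w) * weight F0 (phase_of_coords w)).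
  have := dR_mul (dd s (phase_of_coords w)) (dR_cst (weight F0 (phase_of_coords w)) s 1).
  by rewrite mulr0 addr0.
have d1 (s : R) w : `]0, T[%classic s -> setT w -> derivable (f ^~ w) s 1.
  by move=> _ _; case: (hd s w).
pose K (w : (n * d).-tuple (measurableTypeR R) * (n * d).-tuple (measurableTypeR R)) :=
  `|M| * weight F0 (@phase_of_coords R n d w).
have K0 w : 0 <= K w by rewrite mulr_ge0// weight_ge0.
have iK : (phase_measure R n d).-integrable setT (EFin \o K).
  exact: (integrable_weight cF0 F00 F01 (bc_cst `|M|)).
have pE (s : R) w : partial1of2 f s w = dG s (phase_of_coords w) * weight F0 (phase_of_coords w).
  by rewrite partial1of2E; have := hd s w => h; rewrite derive_val.
have Kub (s : R) w : `]0, T[%classic s -> setT w -> `|partial1of2 f s w| <= K w.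
  move=> /sub sT _; rewrite pE normrM [`|weight _ _|]ger0_norm ?weight_ge0//.
  by rewrite ler_wpM2r ?weight_ge0// (le_trans (hM _ _ sT))// ler_norm.
have D := derivable_under_integral measurableT tI if_ d1 K0 iK Kub.
have DE := differentiation_under_integral measurableT tI if_ d1 K0 iK Kub.
split; first exact: D.
rewrite -derive1E; apply: (etrans DE).
by apply: eq_Rintegral => w _; rewrite pE.
Qed.

Lemma lipschitz_within (f : R -> R) (M T : R) :
  (forall s t, 0 <= s <= T -> 0 <= t <= T -> `|f s - f t| <= M * `|s - t|) ->
  {within `[0, T], continuous f}.
Proof.
move=> h; apply/subspace_continuousP => t; rewrite /= in_itv/= => tT.
have FF := within_filter `[0, T]%classic (nbhs_filter t).
apply/cvgrPdist_le => e e0; rewrite /within /=.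
have M0 : 0 < `|M| + 1 by rewrite ltr_wpDl.
apply/nbhs_ballP; exists (e / (`|M| + 1)); first by rewrite /= divr_gt0.
move=> s; rewrite -ball_normE /= in_itv/= => ts sT.
apply: le_trans (h _ _ tT sT) _.
have le1 : M * `|t - s| <= (`|M| + 1) * `|t - s|.
  by rewrite ler_wpM2r// (le_trans (ler_norm _))// lerDl.
apply: (le_trans le1); rewrite -[leRHS](@divfK _ (`|M| + 1)) ?gt_eqF// mulrC.
by rewrite ler_wpM2r ?(ltW M0)// ltW.
Qed.

Lemma expect_within T G dG : bounded_path T G dG -> {within `[0, T], continuous (fun s => expect (G s))}.
Proof.
move=> [bG dd _ [M hM]]; apply: (@lipschitz_within _ M) => s t sT tT.
have main u v z : 0 <= u -> u <= v -> v <= T -> `|G v z - G u z| <= M * (v - u).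
  move=> u0 uv vT.
  have := @norm_derive_le _ (G ^~ z) (dG ^~ z) (fun r => M * r) (fun=> M) u v uv.
  rewrite -mulrBr; apply.
  - by apply: (is_derive_within (df := dG ^~ z)) => r _; exact: dd.
  - apply: (is_derive_within (df := fun=> M)) => r _.
    by have := dR_scale M (is_derive_id r (1:R)); rewrite mulr1.
  - by move=> r _; have := dR_scale M (is_derive_id r (1:R)); rewrite mulr1.
  - move=> r /andP[ur rv]; apply: hM; apply/andP; split; [exact: le_trans u0 (ltW ur)|exact: le_trans (ltW rv) vT].
have [bs _] := bG s sT; have [bt _] := bG t tT.
rewrite -expectB//; apply: expect_bound => //; first exact: (bc_sub bs bt).1.
move=> z; case/andP: sT => s0 sT; case/andP: tT => t0 tT.
have [st|ts] := leP s t.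
  by rewrite [leLHS]distrC [`|s - t|]distrC [`|t - s|]ger0_norm ?subr_ge0//; exact: main.
by rewrite [`|s - t|]ger0_norm ?subr_ge0 ?(ltW ts)//; apply: main => //; exact: ltW.
Qed.

End TimeDerivative.

(** * Coupling of the Newton and mean-field flows *)

Lemma sum_sq_le {R : realType} (I : finType) (u : I -> R) :
  (\sum_i u i) ^+ 2 <= #|I|%:R * \sum_i u i ^+ 2.
Proof.
have -> : (\sum_i u i) ^+ 2 = \sum_i \sum_j u i * u j.
  by rewrite expr2 mulr_suml; apply: eq_bigr => i _; rewrite mulr_sumr.
apply: (@le_trans _ _ (\sum_i \sum_j (u i ^+ 2 / 2 + u j ^+ 2 / 2))).
  apply: ler_sum => i _; apply: ler_sum => j _.
  have := sqr_ge0 (u i - u j); rewrite sqrrB; lra.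
under eq_bigr do rewrite big_split/= sumr_const -mulr_suml.
rewrite big_split/= sumr_const.
set q := \sum_i u i ^+ 2.
have -> : \sum_i (u i ^+ 2 / 2) *+ #|I| = (q / 2) *+ #|I| by rewrite /q mulr_suml -sumrMnl.
rewrite -mulrnDl -mulr_natl; lra.
Qed.

Lemma sqr_sub_le {R : realType} (a b : R) : (a - b) ^+ 2 <= 2 * (a ^+ 2 + b ^+ 2).
Proof. by have := sqr_ge0 (a + b); rewrite !expr2; nra. Qed.

Lemma bc_sqr {R : realType} {T : topologicalType} (f : T -> R) : bc f -> bc (fun z => f z ^+ 2).
Proof. by move=> bf; apply: (bc_mul bf bf). Qed.

Lemma mul2_le {R : realType} (a b : R) : a * b + b * a <= a ^+ 2 + b ^+ 2.
Proof. by have := sqr_ge0 (a - b); rewrite !expr2; nra. Qed.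

Lemma phase_diff_sum {R : realType} {d : nat} (w w' : phase R 1 d) :
  w = w' + \sum_a (match a with inl e => w.1 ord0 e - w'.1 ord0 e
                              | inr e => w.2 ord0 e - w'.2 ord0 e end) *: phase_dir R a.
Proof.
have sx (c : 'I_d -> R) : \sum_e c e *: x_dir R ord0 e = (\sum_e c e *: torus_dir R e, 0) :> phase R 1 d.
  apply: (big_ind2 (fun (p : phase R 1 d) q => p = (q, 0))) => //.
  - by move=> p1 q1 p2 q2 -> ->; congr pair; rewrite /= addr0.
  - by move=> e _; congr pair; rewrite /= scaler0.
have sv (c : 'I_d -> R) : \sum_e c e *: v_dir R ord0 e = (0, \sum_e c e *: torus_dir R e) :> phase R 1 d.
  apply: (big_ind2 (fun (p : phase R 1 d) q => p = (0, q))) => //.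
  - by move=> p1 q1 p2 q2 -> ->; congr pair; rewrite /= addr0.
  - by move=> e _; congr pair; rewrite /= scaler0.
rewrite big_sumType /= sx sv; case: w w' => [x v] [x' v'] /=.
by congr pair => /=; rewrite ?addr0 ?add0r; exact: row_diff_sum.
Qed.

Section Coupling.
Context {R : realType} {d n : nat}.
Local Notation N := n.+1.
Local Notation D := (phase R 1 d).
Local Notation Ph := (phase R N d).
Variable F0 : D -> R.
Hypothesis (cF0 : continuous F0) (F00 : forall z, 0 <= F0 z) (F01 : phase_eint F0 = 1%E).
Local Notation mean := (mean F0).
Local Notation expect := (expect F0).

Variables (K : 'I_d -> 'rV[R]_d -> R) (L : R).
Local Notation dir := (@torus_dir R d).
Hypothesis L1 : 1 <= L.
Hypothesis cK : forall c, continuous (K c).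
Hypothesis cDK : forall c e, continuous ('D_(dir e) (K c)).
Hypothesis dK : forall c x e, derivable (K c) x (dir e).
Hypothesis ddK : forall c x e f, derivable ('D_(dir e) (K c)) x (dir f).
Hypothesis bK : forall c x, `|K c x| <= L.
Hypothesis bDK : forall c x e, `|'D_(dir e) (K c) x| <= L.
Hypothesis bDDK : forall c x e f, `|'D_(dir f) ('D_(dir e) (K c)) x| <= L.

(** The sum includes l = j, so that all averages run over N particles; for an even potential the
    self-force is [K c 0] = 0. *)
Definition pair_force (x : 'M[R]_(N, d)) : 'M[R]_(N, d) :=
  \matrix_(j, c) (N%:R^-1 * \sum_(l < N) K c (row j x - row l x)).

Variables (X V : Ph -> R -> 'M[R]_(N, d)) (P Q : D -> R -> 'rV[R]_d) (Eb : R -> 'rV[R]_d -> 'rV[R]_d).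
Hypothesis hX : forall z, trajectory (fun t => pair_force (X z (Num.max t 0))) z (X z) (V z).
Hypothesis hP : forall y, trajectory (fun t => Eb t (P y (Num.max t 0))) y (P y) (Q y).
Hypothesis cX : forall t, 0 <= t -> continuous (fun z => (X z t, V z t) : Ph).
Hypothesis cP : forall t, 0 <= t -> continuous (fun y => (P y t, Q y t) : D).
Hypothesis hEb : forall t x c, 0 <= t -> Eb t x ord0 c = mean (fun y => K c (x - P y t)).

Implicit Types (j l : 'I_N) (c e : 'I_d) (t s T : R) (z : Ph).

Definition pdev j c t z : R := X z t j c - P (particle z j) t ord0 c.
Definition vdev j c t z : R := V z t j c - Q (particle z j) t ord0 c.
Definition fdev j c t z : R :=
  pair_force (X z (Num.max t 0)) j c - Eb t (P (particle z j) (Num.max t 0)) ord0 c.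

Lemma row_lipschitz (g : 'rV[R]_d -> R) : (forall x e, derivable g x (dir e)) ->
  (forall x e, `|'D_(dir e) g x| <= L) ->
  forall x x' : 'rV[R]_d, `|g x - g x'| <= L * \sum_(e < d) `|x ord0 e - x' ord0 e|.
Proof.
move=> dg bg x x'; rewrite [X in g X - _](row_diff_sum x x').
exact: (taylor1 dg bg).
Qed.

Let cPc t c : 0 <= t -> continuous (fun y => P y t ord0 c).
Proof. by move=> t0; exact: (cont_comp (cP t0) (@continuous_pos _ _ _ ord0 c)). Qed.

Let cQc t c : 0 <= t -> continuous (fun y => Q y t ord0 c).
Proof. by move=> t0; exact: (cont_comp (cP t0) (@continuous_vel _ _ _ ord0 c)). Qed.

(** Both argument orders are needed, the second one after the exchange of indices in
    [force_decomposition]. For equicontinuity the common argument cancels in the Lipschitz bound,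
    which leaves the continuity of the mean-field flow. *)
Lemma kernel_of_difference (g : 'rV[R]_d -> R) t : 0 <= t -> continuous g ->
  (forall x e, derivable g x (dir e)) -> (forall x e, `|'D_(dir e) g x| <= L) -> (forall x, `|g x| <= L) ->
  pair_kernel L (fun y y' => g (P y t - P y' t)) /\ pair_kernel L (fun y y' => g (P y' t - P y t)).
Proof.
move=> t0 cg dg bDg bg.
have cdiff (f1 f2 : D * D -> D) : continuous f1 -> continuous f2 ->
    continuous (fun p => g (P (f1 p) t - P (f2 p) t)).
  move=> c1 c2; apply: (cont_comp (f := fun p => P (f1 p) t - P (f2 p) t) _ cg).
  apply: mx_continuous => i c; rewrite [i]ord1.
  under eq_fun do rewrite !mxE.
  by apply: cont_sub; [exact: (cont_comp c1 (@cPc t c t0))|exact: (cont_comp c2 (@cPc t c t0))].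
have c1 : continuous (fst : D * D -> D) by move=> [a b]; exact: cvg_fst.
have c2 : continuous (snd : D * D -> D) by move=> [a b]; exact: cvg_snd.
have near_small (y : D) (e : R) : 0 < e -> \forall y' \near y, L * \sum_(i < d) `|P y t ord0 i - P y' t ord0 i| <= e.
  move=> e0; have cs : continuous (fun y' : D => L * \sum_(i < d) `|P y t ord0 i - P y' t ord0 i|).
    apply: cont_mul; first exact: cont_cst.
    by apply: cont_sum => i _; apply: cont_norm; apply: cont_sub; [exact: cont_cst|exact: cPc].
  have FF : Filter (nbhs (y : D)) := nbhs_filter y.
  have /(@cvgrPdist_le _ _ _ (nbhs (y : D)) FF)/(_ _ e0) := cs y.
  apply: filterS => y'; rewrite [X in `|L * X - _|]big1 ?mulr0; last by move=> i _; rewrite subrr normr0.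
  by rewrite sub0r normrN; apply: le_trans; exact: ler_norm.
split; split.
- exact: cdiff.
- by move=> y y'; exact: bg.
- move=> y e e0; apply: filterS (near_small y e e0) => y' h z.
  apply: le_trans h; apply: le_trans (row_lipschitz dg bDg _ _) _.
  rewrite ler_wpM2l ?(le_trans _ L1)//; apply: ler_sum => i _; rewrite !mxE.
  by have -> : P y t ord0 i - P z t ord0 i - (P y' t ord0 i - P z t ord0 i) = P y t ord0 i - P y' t ord0 i by ring.
- exact: cdiff.
- by move=> y y'; exact: bg.
- move=> y e e0; apply: filterS (near_small y e e0) => y' h z.
  apply: le_trans h; apply: le_trans (row_lipschitz dg bDg _ _) _.
  rewrite ler_wpM2l ?(le_trans _ L1)//; apply: ler_sum => i _; rewrite !mxE.
  have -> : P z t ord0 i - P y t ord0 i - (P z t ord0 i - P y' t ord0 i) = P y' t ord0 i - P y t ord0 i by ring.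
  by rewrite distrC.
Qed.

Definition force_kernel t c (y y' : D) : R := K c (P y t - P y' t).
Definition stress_kernel t c e (y y' : D) : R := 'D_(dir e) (K c) (P y t - P y' t).

Lemma kernel_force t c : 0 <= t -> pair_kernel L (force_kernel t c).
Proof. by move=> t0; have [] := kernel_of_difference t0 (@cK c) (@dK c) (@bDK c) (@bK c). Qed.

Lemma kernel_stress t c e : 0 <= t ->
  pair_kernel L (stress_kernel t c e) /\ pair_kernel L (fun y y' => stress_kernel t c e y' y).
Proof.
move=> t0; exact: (kernel_of_difference t0 (@cDK c e) (fun x f => @ddK c x e f) (fun x f => @bDDK c x e f)
  (fun x => @bDK c x e)).
Qed.

Lemma Eb_kernel t c y : 0 <= t -> Eb t (P y t) ord0 c = mean (force_kernel t c y).
Proof. exact: hEb. Qed.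

Lemma fdevE j c t z : 0 <= t ->
  fdev j c t z = N%:R^-1 * \sum_(l < N) K c (row j (X z t) - row l (X z t)) -
    mean (force_kernel t c (particle z j)).
Proof. by move=> t0; rewrite /fdev !max_l// mxE Eb_kernel. Qed.

Lemma pdev_derive j c t z : is_derive t 1 (pdev j c ^~ z) (vdev j c t z).
Proof.
have [_ _ h1 _] := hX z; have [_ _ h2 _] := hP (particle z j).
exact: (dR_sub (h1 t j c) (h2 t ord0 c)).
Qed.

Lemma vdev_derive j c t z : is_derive t 1 (vdev j c ^~ z) (fdev j c t z).
Proof.
have [_ _ _ h1] := hX z; have [_ _ _ h2] := hP (particle z j).
exact: (dR_sub (h1 t j c) (h2 t ord0 c)).
Qed.

Lemma dev0 j c z : pdev j c 0 z = 0 /\ vdev j c 0 z = 0.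
Proof.
have [x0 v0 _ _] := hX z; have [p0 q0 _ _] := hP (particle z j).
by rewrite /pdev /vdev x0 v0 p0 q0 /particle /= !mxE !subrr.
Qed.

Let L0 : 0 <= L. Proof. exact: le_trans L1. Qed.

Lemma average_bound (f : 'I_N -> R) (M : R) : (forall l, `|f l| <= M) -> `|N%:R^-1 * \sum_(l < N) f l| <= M.
Proof.
move=> h; rewrite normrM ger0_norm ?invr_ge0//.
rewrite mulrC ler_pdivrMr//; apply: le_trans (ler_norm_sum _ _ _) _.
apply: (@le_trans _ _ (\sum_(l < N) M)); first exact: ler_sum.
by rewrite sumr_const card_ord mulr_natr.
Qed.

Lemma fdev_bound j c t z : 0 <= t -> `|fdev j c t z| <= 2 * L.
Proof.
move=> t0; rewrite fdevE// mulrDl mul1r; apply: le_trans (ler_normB _ _) _; apply: lerD.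
  by apply: average_bound.
exact: (kernel_mean cF0 F00 F01 (kernel_force c t0)).2.
Qed.

(** A deterministic bound, of order one in N: it provides integrability and the starting point of
    the iteration of weak bounds. *)
Lemma dev_bound T j c t z : 0 <= t <= T ->
  `|vdev j c t z| <= 2 * L * T /\ `|pdev j c t z| <= 2 * L * T * T.
Proof.
move=> /andP[t0 tT].
have T0 : 0 <= T by apply: le_trans tT.
have lin (r s : R) : is_derive s 1 (fun u => r * u) r.
  by have := dR_scale r (is_derive_id s (1:R)); rewrite mulr1.
have vb s : 0 <= s <= T -> `|vdev j c s z| <= 2 * L * T.
  move=> /andP[s0 sT].
  have := @norm_derive_le _ (vdev j c ^~ z) (fdev j c ^~ z) (fun u => 2 * L * u) (fun=> 2 * L) 0 s s0.
  rewrite (dev0 j c z).2 subr0 mulr0 subr0 => h.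
  apply: le_trans (h _ _ _ _ _) _.
  - by apply: is_derive_within => r _; exact: vdev_derive.
  - by apply: is_derive_within => r _; exact: lin.
  - by move=> r _; exact: vdev_derive.
  - by move=> r /andP[r0 _]; apply: fdev_bound; exact: ltW.
  - by rewrite ler_wpM2l// mulr_ge0.
split; first by apply: vb; rewrite t0.
have := @norm_derive_le _ (pdev j c ^~ z) (vdev j c ^~ z) (fun u => 2 * L * T * u) (fun=> 2 * L * T) 0 t t0.
rewrite (dev0 j c z).1 subr0 mulr0 subr0 => h.
apply: le_trans (h _ _ _ _ _) _.
- by apply: is_derive_within => r _; exact: pdev_derive.
- by apply: is_derive_within => r _; exact: lin.
- by move=> r _; exact: pdev_derive.
- by move=> r /andP[r0 rt]; apply: vb; rewrite (ltW r0) (le_trans (ltW rt)).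
- by rewrite ler_wpM2l// !mulr_ge0.
Qed.

Lemma continuous_pdev j c t : 0 <= t -> continuous (pdev j c t).
Proof.
move=> t0; apply: cont_sub; first exact: (cont_comp (cX t0) (@continuous_pos _ _ _ j c)).
exact: (@cont_particle _ _ _ j _ (@cPc t c t0)).
Qed.

Lemma continuous_vdev j c t : 0 <= t -> continuous (vdev j c t).
Proof.
move=> t0; apply: cont_sub; first exact: (cont_comp (cX t0) (@continuous_vel _ _ _ j c)).
exact: (@cont_particle _ _ _ j _ (@cQc t c t0)).
Qed.

Lemma continuous_fdev j c t : 0 <= t -> continuous (fdev j c t).
Proof.
move=> t0; rewrite (_ : fdev j c t = fun z => N%:R^-1 * \sum_(l < N) K c (row j (X z t) - row l (X z t)) -
    mean (force_kernel t c (particle z j))); last by apply/funext => z; exact: fdevE.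
apply: cont_sub.
  apply: cont_mul; first exact: cont_cst.
  apply: cont_sum => l _; have cr : continuous (fun z => row j (X z t) - row l (X z t)); last exact: (cont_comp cr (@cK c)).
  apply: mx_continuous => i e; under eq_fun do rewrite !mxE.
  by apply: cont_sub; [exact: (cont_comp (cX t0) (@continuous_pos _ _ _ j e))
    |exact: (cont_comp (cX t0) (@continuous_pos _ _ _ l e))].
exact: (@cont_particle _ _ _ j _ (kernel_mean cF0 F00 F01 (kernel_force c t0)).1).
Qed.

Lemma path_pdev T j c : bounded_path T (pdev j c) (vdev j c).
Proof.
split.
- move=> t tT; have [vb pb] : (forall z, `|vdev j c t z| <= 2 * L * T) /\ (forall z, `|pdev j c t z| <= 2 * L * T * T).
    by split=> z; have [] := dev_bound j c z tT.
  case/andP: tT => t0 _.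
  split; split; [exact: continuous_pdev|by exists (2 * L * T * T)|exact: continuous_vdev|by exists (2 * L * T)].
- by move=> t z; exact: pdev_derive.
- by exists (2 * L * T * T) => t z tT; exact: (dev_bound j c z tT).2.
- by exists (2 * L * T) => t z tT; exact: (dev_bound j c z tT).1.
Qed.

Lemma path_vdev T j c : bounded_path T (vdev j c) (fdev j c).
Proof.
split.
- move=> t tT; have vb : forall z, `|vdev j c t z| <= 2 * L * T.
    by move=> z; have [] := dev_bound j c z tT.
  case/andP: tT => t0 _.
  split; split; [exact: continuous_vdev|by exists (2 * L * T)|exact: continuous_fdev|].
  by exists (2 * L) => z; exact: fdev_bound.
- by move=> t z; exact: vdev_derive.
- by exists (2 * L * T) => t z tT; exact: (dev_bound j c z tT).1.
- by exists (2 * L) => t z /andP[t0 _]; exact: fdev_bound.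
Qed.

Lemma bc_pdev j c t : 0 <= t -> bc (pdev j c t).
Proof.
by move=> t0; have [+ _ _ _] := path_pdev t j c; move=> /(_ t); rewrite t0 lexx => /(_ isT)[].
Qed.

Lemma bc_vdev j c t : 0 <= t -> bc (vdev j c t).
Proof.
by move=> t0; have [+ _ _ _] := path_vdev t j c; move=> /(_ t); rewrite t0 lexx => /(_ isT)[].
Qed.

Lemma bc_fdev j c t : 0 <= t -> bc (fdev j c t).
Proof.
by move=> t0; have [+ _ _ _] := path_vdev t j c; move=> /(_ t); rewrite t0 lexx => /(_ isT)[].
Qed.

(** The force error splits in two: [force_gap] compares N-particle averages at true and at
    mean-field positions and is controlled by the deviations, while [force_noise] is the sampling
    error of the mean force and involves independent particles only. *)
Definition force_gap j c t z : R :=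
  N%:R^-1 * \sum_(l < N) (K c (row j (X z t) - row l (X z t)) - force_kernel t c (particle z j) (particle z l)).

Definition force_noise j c t z : R :=
  N%:R^-1 * \sum_(l < N) centered F0 (force_kernel t c) (particle z j) (particle z l).

Lemma average_cst (a : R) : N%:R^-1 * \sum_(l < N) a = a.
Proof. by rewrite sumr_const card_ord -[X in _ * X]mulr_natl mulKf// pnatr_eq0. Qed.

Lemma averageD (f g : 'I_N -> R) :
  N%:R^-1 * \sum_(l < N) (f l + g l) = N%:R^-1 * (\sum_(l < N) f l) + N%:R^-1 * \sum_(l < N) g l.
Proof. by rewrite big_split mulrDr. Qed.

Lemma average_le (f g : 'I_N -> R) : (forall l, f l <= g l) ->
  N%:R^-1 * \sum_(l < N) f l <= N%:R^-1 * \sum_(l < N) g l.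
Proof. by move=> h; rewrite ler_wpM2l ?invr_ge0//; exact: ler_sum. Qed.

Lemma average_sqr (f : 'I_N -> R) : (N%:R^-1 * \sum_(l < N) f l) ^+ 2 <= N%:R^-1 * \sum_(l < N) f l ^+ 2.
Proof.
rewrite exprMn expr2 -mulrA ler_wpM2l ?invr_ge0//.
have := sum_sq_le f; rewrite card_ord => h.
apply: le_trans (ler_wpM2l _ h) _; first by rewrite invr_ge0.
by rewrite mulKf// pnatr_eq0.
Qed.

Lemma fdev_split j c t z : 0 <= t -> fdev j c t z = force_gap j c t z + force_noise j c t z.
Proof.
move=> t0; rewrite fdevE// -averageD.
rewrite -[X in _ - X]average_cst -mulrBr -sumrB; congr (_ * _); apply: eq_bigr => l _.
by rewrite /centered; ring.
Qed.

Lemma row_gap j l c t z :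
  (row j (X z t) - row l (X z t)) ord0 c - (P (particle z j) t - P (particle z l) t) ord0 c =
  pdev j c t z - pdev l c t z.
Proof. by rewrite /pdev !mxE; ring. Qed.

Lemma pdev_gap_sqr j l t z : (\sum_(e < d) `|pdev j e t z - pdev l e t z|) ^+ 2 <=
  d%:R * (2 * (\sum_e pdev j e t z ^+ 2 + \sum_e pdev l e t z ^+ 2)).
Proof.
apply: le_trans (sum_sq_le _) _; rewrite card_ord ler_wpM2l//.
rewrite -big_split mulr_sumr; apply: ler_sum => e _ /=.
rewrite real_normK ?num_real//; exact: sqr_sub_le.
Qed.

Lemma force_gap_le j c t z :
  force_gap j c t z ^+ 2 <=
  2 * L ^+ 2 * d%:R * ((\sum_e pdev j e t z ^+ 2) + N%:R^-1 * \sum_l \sum_e pdev l e t z ^+ 2).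
Proof.
apply: le_trans (average_sqr _) _.
rewrite -[X in _ * (X + _)]average_cst -averageD mulrCA [X in _ <= _ * X]mulr_sumr.
rewrite ler_wpM2l ?invr_ge0//; apply: ler_sum => l _.
apply: (@le_trans _ _ ((L * \sum_(e < d) `|pdev j e t z - pdev l e t z|) ^+ 2)).
  rewrite -real_normK ?num_real// ler_sqr ?nnegrE//.
    apply: le_trans (row_lipschitz (@dK c) (@bDK c) _ _) _.
    by under eq_bigr do rewrite row_gap.
  by apply: mulr_ge0 => //; apply: sumr_ge0 => e _; exact: normr_ge0.
rewrite exprMn; have := ler_wpM2l (sqr_ge0 L) (pdev_gap_sqr j l t z).
by set q := _ + \sum_e pdev l e t z ^+ 2; rewrite (_ : L ^+ 2 * (_ * (2 * q)) = 2 * L ^+ 2 * d%:R * q)//; ring.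
Qed.

(** Written with products instead of squares, which is the form that [bounded_path_mul]
    differentiates. *)
Definition energy t z : R :=
  N%:R^-1 * \sum_j \sum_c (pdev j c t z * pdev j c t z + vdev j c t z * vdev j c t z).

Definition energy_rate t z : R :=
  N%:R^-1 * \sum_j \sum_c ((vdev j c t z * pdev j c t z + pdev j c t z * vdev j c t z) +
    (fdev j c t z * vdev j c t z + vdev j c t z * fdev j c t z)).

Definition noise t z : R := N%:R^-1 * \sum_j \sum_c force_noise j c t z ^+ 2.

(** In the time derivative of the energy, 2ab + 2(gap + noise)b is at most a^2 + 3b^2 + gap^2 +
    noise^2, and the average of gap^2 is at most 4(dL)^2 times that of a^2; [rate] covers both
    coefficients. *)
Definition rate : R := 3 + 4 * (d%:R * L) ^+ 2.

Lemma path_energy T : exists G', bounded_path T energy G' /\ forall t z, G' t z = energy_rate t z.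
Proof.
eexists; split.
  apply: bounded_path_mul; first by apply: bounded_path_cst; exact: bc_cst.
  apply: bounded_path_sum => j; apply: bounded_path_sum => c; apply: bounded_path_add.
    exact: (bounded_path_mul (path_pdev T j c) (path_pdev T j c)).
  exact: (bounded_path_mul (path_vdev T j c) (path_vdev T j c)).
by move=> t z /=; rewrite mul0r add0r.
Qed.

Lemma energy_rate_le t z : 0 <= t -> energy_rate t z <= rate * energy t z + noise t z.
Proof.
move=> t0; rewrite /energy_rate /energy /noise.
set A := N%:R^-1 * \sum_l \sum_e pdev l e t z ^+ 2.
have gapsum : N%:R^-1 * \sum_j \sum_c force_gap j c t z ^+ 2 <= 4 * (d%:R * L) ^+ 2 * A.
  apply: (@le_trans _ _ (N%:R^-1 * \sum_(j < N) (d%:R * (2 * L ^+ 2 * d%:R * ((\sum_e pdev j e t z ^+ 2) + A))))).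
    apply: average_le => j.
    apply: (@le_trans _ _ (\sum_(c < d) (2 * L ^+ 2 * d%:R * ((\sum_e pdev j e t z ^+ 2) + A)))).
      by apply: ler_sum => c _; exact: force_gap_le.
    by rewrite sumr_const card_ord -[leLHS]mulr_natl.
  under eq_bigr do rewrite mulrA.
  rewrite le_eqVlt; apply/orP; left; apply/eqP.
  by rewrite -mulr_sumr [LHS]mulrCA averageD average_cst -/A; ring.
have rateE : rate * (N%:R^-1 * \sum_j \sum_c (pdev j c t z * pdev j c t z + vdev j c t z * vdev j c t z)) =
  4 * (d%:R * L) ^+ 2 * A + N%:R^-1 * \sum_j \sum_c (3 * pdev j c t z ^+ 2 + rate * vdev j c t z ^+ 2).
  rewrite /A mulrCA [X in _ = X + _]mulrCA -mulrDr; congr (_ * _).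
  rewrite !mulr_sumr -big_split; apply: eq_bigr => j _ /=.
  rewrite !mulr_sumr -big_split; apply: eq_bigr => c _ /=.
  by rewrite /rate; ring.
rewrite rateE.
apply: (@le_trans _ _ (N%:R^-1 * \sum_j \sum_c force_gap j c t z ^+ 2 +
  N%:R^-1 * \sum_j \sum_c (3 * pdev j c t z ^+ 2 + rate * vdev j c t z ^+ 2) +
  N%:R^-1 * \sum_j \sum_c force_noise j c t z ^+ 2)); last by rewrite !lerD2r.
rewrite -!averageD; apply: average_le => j; rewrite -!big_split; apply: ler_sum => c _ /=.
rewrite (fdev_split _ _ _ t0).
set a := pdev _ _ _ _; set b := vdev _ _ _ _; set u := force_gap _ _ _ _; set w := force_noise _ _ _ _.
have r3 : 3 * b ^+ 2 <= rate * b ^+ 2 by rewrite ler_wpM2r ?sqr_ge0// /rate lerDl mulr_ge0// sqr_ge0.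
have := sqr_ge0 a; move: r3 (mul2_le a b) (mul2_le u b) (mul2_le w b); set r := rate * _; lra.
Qed.

Lemma bc_centered M g j l : pair_kernel M g ->
  bc (fun z : Ph => centered F0 g (particle z j) (particle z l)).
Proof.
move=> kg; apply: bc_sub; first exact: kernel_bc kg.
have [cm bm] := kernel_mean cF0 F00 F01 kg.
have bm' : bc (fun y => mean (g y)) by split=> //; exists M.
exact: (bc_particle j bm').
Qed.

Lemma bc_average (f : 'I_N -> Ph -> R) : (forall l, bc (f l)) -> bc (fun z => N%:R^-1 * \sum_(l < N) f l z).
Proof. by move=> h; apply: bc_mul; [exact: bc_cst|exact: bc_sum]. Qed.

Lemma expect_average (f : 'I_N -> Ph -> R) : (forall l, bc (f l)) ->
  expect (fun z => N%:R^-1 * \sum_(l < N) f l z) = N%:R^-1 * \sum_(l < N) expect (f l).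
Proof.
move=> h; rewrite (expectZ cF0 F00 F01); last by exact: bc_sum.
by rewrite (expect_sum cF0 F00 F01).
Qed.

Lemma bc_force_noise j c t : 0 <= t -> bc (force_noise j c t).
Proof. by move=> t0; apply: bc_average => l; apply: bc_centered; exact: kernel_force. Qed.

Lemma bc_noise t : 0 <= t -> bc (noise t).
Proof.
move=> t0; apply: bc_average => j; apply: bc_sum => c _.
by apply: bc_sqr; exact: bc_force_noise.
Qed.

(** The d components contribute (2L)^2/N each, and d <= d^2. Stated with [rate] so that the quotient
    a/c of [gronwall] is exactly 1/N. *)
Lemma expect_noise t : 0 <= t -> expect (noise t) <= rate / N%:R.
Proof.
move=> t0.
have h j : bc (fun z => \sum_c force_noise j c t z ^+ 2).
  by apply: bc_sum => c _; apply: bc_sqr; exact: bc_force_noise.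
rewrite /noise (expect_average h).
apply: (@le_trans _ _ (N%:R^-1 * \sum_(j < N) (d%:R * ((2 * L) ^+ 2 / N%:R)))).
  apply: average_le => j; rewrite (expect_sum cF0 F00 F01); last first.
    by move=> c; apply: bc_sqr; exact: bc_force_noise.
  apply: (@le_trans _ _ (\sum_(c < d) ((2 * L) ^+ 2 / N%:R))); last first.
    by rewrite sumr_const card_ord -[leLHS]mulr_natl.
  apply: ler_sum => c _; have [cc bb mm] := kernel_centered cF0 F00 F01 (kernel_force c t0).
  exact: (expect_fluct2 cF0 F00 F01 cc bb mm j).
rewrite average_cst mulrA ler_wpM2r ?invr_ge0// /rate.
have : (d%:R : R) <= d%:R ^+ 2 by rewrite -natrX ler_nat; case: d => // m; rewrite expnS expn1 leq_pmulr.
move=> /(ler_wpM2r (sqr_ge0 (2 * L))); rewrite !exprMn; lra.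
Qed.

Lemma rate_gt0 : 0 < rate.
Proof. by rewrite /rate ltr_wpDr// mulr_ge0// sqr_ge0. Qed.

Lemma energy0 z : energy 0 z = 0.
Proof.
rewrite /energy big1 ?mulr0// => j _; rewrite big1// => c _.
by have [-> ->] := dev0 j c z; rewrite !mulr0 addr0.
Qed.

Lemma bc_energy t : 0 <= t -> bc (energy t).
Proof.
move=> t0; apply: bc_average => j; apply: bc_sum => c _.
by apply: bc_add; apply: bc_mul; (exact: bc_pdev || exact: bc_vdev).
Qed.

Lemma bc_energy_rate t : 0 <= t -> bc (energy_rate t).
Proof.
move=> t0; apply: bc_average => j; apply: bc_sum => c _.
by apply: bc_add; apply: bc_add; apply: bc_mul; (exact: bc_pdev || exact: bc_vdev || exact: bc_fdev).
Qed.

Lemma expect_energy T : 0 <= T -> expect (energy T) <= N%:R^-1 * expR (rate * T).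
Proof.
move=> T0; have [G' [hG G'E]] := path_energy T.
have := @gronwall _ (fun t => expect (energy t)) (fun t => expect (energy_rate t)) rate (rate / N%:R) T T0 rate_gt0.
have -> : expect (energy 0) = 0.
  by rewrite (_ : energy 0 = fun=> 0) ?(expect_cst cF0 F00 F01)//; apply/funext => z; exact: energy0.
have -> : 0 + rate / N%:R / rate = N%:R^-1.
  by rewrite add0r mulrAC divff ?mul1r// gt_eqF// rate_gt0.
apply.
- by rewrite divr_ge0// ltW// rate_gt0.
- exact: (expect_within cF0 F00 F01 hG).
- move=> t tT; have := expect_is_derive cF0 F00 F01 hG tT.
  by rewrite (_ : G' t = energy_rate t)//; apply/funext => z; exact: G'E.
- move=> t /andP[/ltW t0 _].
  rewrite -(expectZ cF0 F00 F01); last exact: bc_energy.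
  apply: le_trans (_ : _ <= expect (fun z => rate * energy t z + noise t z)) _.
    apply: (expect_le cF0 F00 F01); [exact: bc_energy_rate| |by move=> z; exact: energy_rate_le].
    by apply: bc_add; [apply: bc_mul; [exact: bc_cst|exact: bc_energy]|exact: bc_noise].
  rewrite (expectD cF0 F00 F01); [|by apply: bc_mul; [exact: bc_cst|exact: bc_energy]|exact: bc_noise].
  by rewrite lerD2l expect_noise.
Qed.

Definition admissible (h : D -> R) : Prop := bc h /\ forall y, `|h y| <= 1.

(** The weight depends on the initial datum of the particle only, hence is constant in time and
    commutes with time derivatives. *)
Definition weak_bound (f : 'I_N -> Ph -> R) (m : R) : Prop :=
  forall h, admissible h -> `|expect (fun z => N%:R^-1 * \sum_(j < N) (h (particle z j) * f j z))| <= m.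

Lemma bc_weighted (h : D -> R) j (f : Ph -> R) : admissible h -> bc f -> bc (fun z => h (particle z j) * f z).
Proof. by move=> [bh _] bf; apply: bc_mul => //; exact: (bc_particle j bh). Qed.

Lemma bc_kernel_average M g j : pair_kernel M g ->
  bc (fun z : Ph => N%:R^-1 * \sum_(l < N) g (particle z j) (particle z l)).
Proof. by move=> kg; apply: bc_average => l; exact: kernel_bc kg. Qed.

Lemma average_pdev_le t z e : N%:R^-1 * \sum_(j < N) pdev j e t z ^+ 2 <= energy t z.
Proof.
apply: average_le => j; rewrite (bigD1 e)//= -expr2 -addrA lerDl addr_ge0 ?sqr_ge0 -?expr2 ?sqr_ge0//.
by apply: sumr_ge0 => c _; rewrite addr_ge0 // -expr2 sqr_ge0.
Qed.

(** By |fg| <= (f^2 + g^2)/2; both mean squares will be of order 1/N. *)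
Lemma expect_weighted_product_le (h : D -> R) (f g : 'I_N -> Ph -> R) (a b : R) : admissible h ->
  (forall j, bc (f j)) -> (forall j, bc (g j)) ->
  expect (fun z => N%:R^-1 * \sum_(j < N) f j z ^+ 2) <= a ->
  (forall j, expect (fun z => g j z ^+ 2) <= b) ->
  `|expect (fun z => N%:R^-1 * \sum_(j < N) (h (particle z j) * (f j z * g j z)))| <= (a + b) / 2.
Proof.
move=> ah bf bg ha hb.
have bfg j : bc (fun z => f j z * g j z) by exact: bc_mul.
have b1 : bc (fun z => N%:R^-1 * \sum_(j < N) (h (particle z j) * (f j z * g j z))).
  by apply: bc_average => j; exact: bc_weighted.
have b2 j : bc (fun z => f j z ^+ 2) by exact: bc_sqr.
have b3 j : bc (fun z => g j z ^+ 2) by exact: bc_sqr.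
apply: le_trans (expect_norm cF0 F00 F01 b1) _.
apply: (@le_trans _ _ (expect (fun z => 2^-1 * (N%:R^-1 * \sum_(j < N) f j z ^+ 2 + N%:R^-1 * \sum_(j < N) g j z ^+ 2)))).
  apply: (expect_le cF0 F00 F01).
  - exact: bc_norm.
  - by apply: bc_mul; [exact: bc_cst|apply: bc_add; exact: bc_average].
  - move=> z; rewrite normrM ger0_norm ?invr_ge0// -averageD mulrCA ler_wpM2l ?invr_ge0//.
    apply: le_trans (ler_norm_sum _ _ _) _; rewrite mulr_sumr; apply: ler_sum => j _.
    rewrite normrM; apply: le_trans (ler_wpM2r (normr_ge0 _) (ah.2 _)) _; rewrite mul1r normrM.
    rewrite -(real_normK (num_real (f j z))) -(real_normK (num_real (g j z))).
    have := mul2_le `|f j z| `|g j z|.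
    lra.
rewrite (expectZ cF0 F00 F01); last by apply: bc_add; exact: bc_average.
rewrite (expectD cF0 F00 F01); [|exact: bc_average|exact: bc_average].
rewrite mulrC ler_wpM2r// lerD// expect_average//.
by apply: le_trans (average_le (g := fun=> b) _) _; [exact: hb|rewrite average_cst].
Qed.

Lemma centered_sq_le g j : pair_kernel L g ->
  expect (fun z : Ph => (N%:R^-1 * \sum_(l < N) centered F0 g (particle z j) (particle z l)) ^+ 2)
    <= 4 * L ^+ 2 / N%:R.
Proof.
move=> kg; have [cc bb mm] := kernel_centered cF0 F00 F01 kg.
have -> : 4 * L ^+ 2 = (2 * L) ^+ 2 by ring.
exact: (expect_fluct2 cF0 F00 F01 cc bb mm j).
Qed.

(* The mean of the kernel only changes the weight [h]; the centered part is small in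
   mean square. *)
Lemma kernel_weak_bound t e m g h : 0 <= t -> weak_bound (fun j => pdev j e t) m ->
  pair_kernel L g -> admissible h ->
  `|expect (fun z => N%:R^-1 * \sum_(j < N) (h (particle z j) *
      (pdev j e t z * (N%:R^-1 * \sum_(l < N) g (particle z j) (particle z l)))))| <=
  L * m + (expect (energy t) + 4 * L ^+ 2 / N%:R) / 2.
Proof.
move=> t0 wm kg ah.
have [cm bm] := kernel_mean cF0 F00 F01 kg.
(* Division by L keeps the new weight admissible; the factor L reappears in front of m. *)
pose h' y := h y * (L^-1 * mean (g y)).
have bmg : bc (fun y => mean (g y)) by split=> //; exists L.
have Lp : 0 < L by apply: lt_le_trans L1.
have ah' : admissible h'.
  split; first by apply: bc_mul; [exact: ah.1|apply: bc_mul => //; exact: bc_cst].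
  move=> y; rewrite normrM mulr_ile1// ?ah.2// normrM ger0_norm ?invr_ge0//.
  by rewrite mulrC ler_pdivrMr// mul1r.
pose cg j (z : Ph) := N%:R^-1 * \sum_(l < N) centered F0 g (particle z j) (particle z l).
have bcg j : bc (cg j) by apply: bc_average => l; apply: bc_centered kg.
have bp j : bc (pdev j e t) by exact: bc_pdev.
have E z : N%:R^-1 * \sum_(j < N) (h (particle z j) *
      (pdev j e t z * (N%:R^-1 * \sum_(l < N) g (particle z j) (particle z l)))) =
    L * (N%:R^-1 * \sum_(j < N) (h' (particle z j) * pdev j e t z)) +
    N%:R^-1 * \sum_(j < N) (h (particle z j) * (pdev j e t z * cg j z)).
  rewrite [X in _ = X + _]mulrCA [X in _ * X + _]mulr_sumr -averageD; congr (_ * _); apply: eq_bigr => j _.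
  rewrite /cg /centered.
  have -> : N%:R^-1 * \sum_(l < N) (g (particle z j) (particle z l) - mean (g (particle z j))) =
    N%:R^-1 * \sum_(l < N) g (particle z j) (particle z l) - mean (g (particle z j)).
    by rewrite sumrB mulrBr average_cst.
  rewrite /h'; set m0 := mean _; set p := pdev _ _ _ _; set hh := h _; set a := _^-1 * _.
  have -> : L * (hh * (L^-1 * m0) * p) = (L / L) * (hh * m0 * p) by ring.
  by rewrite divff ?gt_eqF//; ring.
have b1 : bc (fun z => N%:R^-1 * \sum_(j < N) (h' (particle z j) * pdev j e t z)).
  by apply: bc_average => j; exact: bc_weighted.
have b2 : bc (fun z => N%:R^-1 * \sum_(j < N) (h (particle z j) * (pdev j e t z * cg j z))).
  by apply: bc_average => j; apply: bc_weighted => //; exact: bc_mul.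
under eq_fun do rewrite E.
rewrite (expectD cF0 F00 F01)//; last by apply: bc_mul => //; exact: bc_cst.
rewrite (expectZ cF0 F00 F01)//; apply: le_trans (ler_normD _ _) _; apply: lerD.
  by rewrite normrM ger0_norm// ler_wpM2l//; exact: wm.
apply: expect_weighted_product_le => //; last by move=> j; exact: centered_sq_le.
apply: (expect_le cF0 F00 F01); [|exact: bc_energy|by move=> z; exact: average_pdev_le].
by apply: bc_average => j; exact: bc_sqr.
Qed.

Lemma row_taylor2 c (x x' : 'rV[R]_d) :
  `|K c x - K c x' - \sum_(e < d) (x ord0 e - x' ord0 e) * 'D_(dir e) (K c) x'| <=
  L * (\sum_(e < d) `|x ord0 e - x' ord0 e|) ^+ 2.
Proof.
rewrite [X in K c X - _](row_diff_sum x x').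
have h := taylor2 (@dK c) (@ddK c) (fun x e f => @bDDK c x e f) (index_enum 'I_d) (fun e => x ord0 e - x' ord0 e) x'.
exact: h.
Qed.

(** Second order Taylor remainder of the interaction around the mean-field positions. *)
Definition force_rest j c t z : R :=
  N%:R^-1 * \sum_(l < N) (K c (row j (X z t) - row l (X z t)) - force_kernel t c (particle z j) (particle z l) -
    \sum_(e < d) (pdev j e t z - pdev l e t z) * stress_kernel t c e (particle z j) (particle z l)).

Lemma force_rest_le h c t z : admissible h ->
  `|N%:R^-1 * \sum_(j < N) (h (particle z j) * force_rest j c t z)| <= 4 * d%:R * L * energy t z.
Proof.
move=> ah.
set A := N%:R^-1 * \sum_l \sum_e pdev l e t z ^+ 2.
have Ale : A <= energy t z.
  apply: average_le => j; apply: ler_sum => c' _.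
  by rewrite -!expr2 lerDl sqr_ge0.
apply: (@le_trans _ _ (4 * d%:R * L * A)); last by rewrite ler_wpM2l// !mulr_ge0.
rewrite normrM ger0_norm ?invr_ge0//.
apply: (@le_trans _ _ (N%:R^-1 * \sum_(j < N) (2 * d%:R * L * ((\sum_e pdev j e t z ^+ 2) + A)))).
  rewrite ler_wpM2l ?invr_ge0//; apply: le_trans (ler_norm_sum _ _ _) _; apply: ler_sum => j _.
  rewrite normrM; apply: le_trans (ler_wpM2r (normr_ge0 _) (ah.2 _)) _; rewrite mul1r.
  rewrite normrM ger0_norm ?invr_ge0//.
  rewrite -[X in _ * (X + _)]average_cst -averageD mulrCA [X in _ <= _ * X]mulr_sumr.
  rewrite ler_wpM2l ?invr_ge0//; apply: le_trans (ler_norm_sum _ _ _) _; apply: ler_sum => l _.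
  have := row_taylor2 c (row j (X z t) - row l (X z t)) (P (particle z j) t - P (particle z l) t).
  under eq_bigr do rewrite row_gap; under [X in _ <= _ * X ^+ 2]eq_bigr do rewrite row_gap.
  move=> h1; apply: le_trans h1 _.
  apply: le_trans (ler_wpM2l L0 (pdev_gap_sqr j l t z)) _.
  set q := _ + \sum_e pdev l e t z ^+ 2; rewrite (_ : L * (_ * (2 * q)) = 2 * d%:R * L * q)//; ring.
rewrite -mulr_sumr mulrCA averageD -/A average_cst.
rewrite (_ : 2 * d%:R * L * (A + A) = 4 * d%:R * L * A)//; ring.
Qed.

(** The linear Taylor term contains the difference of the deviations of j and l. In the part with l
    the two summation indices are exchanged: the deviation then carries the weight 1, written
    explicitly to match [kernel_weak_bound], and [h] becomes part of the kernel. *)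
Lemma force_decomposition h c t z : 0 <= t ->
  N%:R^-1 * \sum_(j < N) (h (particle z j) * fdev j c t z) =
  N%:R^-1 * \sum_(j < N) (h (particle z j) * force_noise j c t z) +
  \sum_(e < d) (N%:R^-1 * (\sum_(j < N) (h (particle z j) *
      (pdev j e t z * (N%:R^-1 * \sum_(l < N) stress_kernel t c e (particle z j) (particle z l))))) -
    N%:R^-1 * (\sum_(j < N) (1 * (pdev j e t z * (N%:R^-1 * \sum_(l < N)
      (h (particle z l) * stress_kernel t c e (particle z l) (particle z j))))))) +
  N%:R^-1 * \sum_(j < N) (h (particle z j) * force_rest j c t z).
Proof.
move=> t0.
have swap e : N%:R^-1 * (\sum_(j < N) (1 * (pdev j e t z * (N%:R^-1 * \sum_(l < N)
      (h (particle z l) * stress_kernel t c e (particle z l) (particle z j)))))) =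
    N%:R^-1 * \sum_(j < N) (h (particle z j) * (N%:R^-1 * \sum_(l < N)
      (pdev l e t z * stress_kernel t c e (particle z j) (particle z l)))).
  congr (_ * _).
  under eq_bigr do rewrite mul1r mulrCA mulr_sumr mulr_sumr.
  under [RHS]eq_bigr do rewrite mulrCA mulr_sumr mulr_sumr.
  rewrite exchange_big; apply: eq_bigr => j _; apply: eq_bigr => l _; ring.
under [X in _ + X + _]eq_bigr do rewrite swap -mulrBr -sumrB.
rewrite -mulr_sumr -!mulrDr; congr (_ * _).
rewrite exchange_big -!big_split; apply: eq_bigr => j _ /=.
under [X in _ + X + _]eq_bigr do rewrite -mulrBr.
rewrite -mulr_sumr -!mulrDr; congr (_ * _).
rewrite (fdev_split _ _ _ t0) [LHS]addrC -[RHS]addrA; congr (_ + _).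
rewrite /force_gap /force_rest.
have -> : \sum_(e < d) (pdev j e t z * (N%:R^-1 * \sum_(l < N) stress_kernel t c e (particle z j) (particle z l)) -
     N%:R^-1 * \sum_(l < N) (pdev l e t z * stress_kernel t c e (particle z j) (particle z l))) =
  N%:R^-1 * \sum_(l < N) \sum_(e < d) (pdev j e t z - pdev l e t z) * stress_kernel t c e (particle z j) (particle z l).
  rewrite exchange_big mulr_sumr; apply: eq_bigr => e _.
  rewrite mulrCA -mulrBr mulr_sumr -sumrB; congr (_ * _); apply: eq_bigr => l _; ring.
by rewrite -averageD; congr (_ * _); apply: eq_bigr => l _; ring.
Qed.

(** The weight sits in the second argument, where a pair kernel only has to be continuous and
    bounded, so any admissible [h] may enter. *)
Lemma kernel_swap_weighted h t c e : 0 <= t -> admissible h ->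
  pair_kernel L (fun y y' => h y' * stress_kernel t c e y' y).
Proof.
move=> t0 [[ch _] bh]; have [_ [cs bs es]] := kernel_stress c e t0.
split.
- apply: cont_mul => //; have c2 : continuous (snd : D * D -> D) by move=> [a b]; exact: cvg_snd.
  exact: (cont_comp c2 ch).
- move=> y z; rewrite normrM; apply: le_trans (ler_wpM2r (normr_ge0 _) (bh _)) _.
  by rewrite mul1r; exact: bs.
- move=> y a a0; apply: filterS (es y a a0) => y' hy z.
  rewrite -mulrBr normrM; apply: le_trans (ler_wpM2r (normr_ge0 _) (bh _)) _.
  by rewrite mul1r; exact: hy.
Qed.

Lemma admissible1 : admissible (fun=> 1).
Proof. by split; [exact: bc_cst|move=> y; rewrite normr1]. Qed.

Lemma weak_bound_noise c t : 0 <= t -> weak_bound (fun j => force_noise j c t) (2 * L / N%:R).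
Proof.
move=> t0 h ah; have [cc bb mm] := kernel_centered cF0 F00 F01 (kernel_force c t0).
have b1 j : bc (fun z => h (particle z j) * force_noise j c t z).
  by apply: bc_weighted => //; exact: bc_force_noise.
rewrite expect_average//; apply: average_bound => j.
exact: (expect_fluct1 cF0 F00 F01 cc bb mm j ah.1 ah.2).
Qed.

Lemma bc_stress j l t c e : 0 <= t ->
  bc (fun z : Ph => stress_kernel t c e (particle z j) (particle z l)).
Proof. by move=> t0; exact: kernel_bc (kernel_stress c e t0).1. Qed.

Lemma bc_force_rest j c t : 0 <= t -> bc (force_rest j c t).
Proof.
move=> t0; apply: bc_average => l; apply: bc_sub; last first.
  apply: bc_sum => e _; apply: bc_mul; last exact: bc_stress.
  by apply: bc_sub; exact: bc_pdev.
apply: bc_sub; last exact: kernel_bc (kernel_force c t0).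
split; last by exists L => z; exact: bK.
have cr : continuous (fun z => row j (X z t) - row l (X z t)); last exact: (cont_comp cr (@cK c)).
apply: mx_continuous => i e; under eq_fun do rewrite !mxE.
by apply: cont_sub; [exact: (cont_comp (cX t0) (@continuous_pos _ _ _ j e))
  |exact: (cont_comp (cX t0) (@continuous_pos _ _ _ l e))].
Qed.

Lemma force_weak_bound t m c : 0 <= t -> (forall e, weak_bound (fun j => pdev j e t) m) ->
  weak_bound (fun j => fdev j c t) (2 * L / N%:R +
    d%:R * (2 * (L * m + (expect (energy t) + 4 * L ^+ 2 / N%:R) / 2)) +
    4 * d%:R * L * expect (energy t)).
Proof.
move=> t0 hm h ah.
under eq_fun do rewrite (force_decomposition _ _ _ t0).
set B := L * m + _.
pose G1 e (z : Ph) := N%:R^-1 * (\sum_(j < N) (h (particle z j) *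
      (pdev j e t z * (N%:R^-1 * \sum_(l < N) stress_kernel t c e (particle z j) (particle z l))))).
pose G2 e (z : Ph) := N%:R^-1 * (\sum_(j < N) (1 * (pdev j e t z * (N%:R^-1 * \sum_(l < N)
      (h (particle z l) * stress_kernel t c e (particle z l) (particle z j)))))).
have k1 e := (kernel_stress c e t0).1.
have k2 e := kernel_swap_weighted c e t0 ah.
have b1 e : bc (G1 e).
  apply: bc_average => j; apply: bc_weighted => //; apply: bc_mul; first exact: bc_pdev.
  exact: bc_kernel_average (k1 e).
have b2 e : bc (G2 e).
  apply: bc_average => j; apply: bc_mul; first exact: bc_cst.
  by apply: bc_mul; [exact: bc_pdev|exact: bc_kernel_average (k2 e)].
have B1 e : `|expect (G1 e)| <= B by exact: kernel_weak_bound (hm e) (k1 e) ah.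
have B2 e : `|expect (G2 e)| <= B by exact: kernel_weak_bound (hm e) (k2 e) admissible1.
have bn : bc (fun z => N%:R^-1 * \sum_(j < N) (h (particle z j) * force_noise j c t z)).
  by apply: bc_average => j; apply: bc_weighted => //; exact: bc_force_noise.
have br : bc (fun z => N%:R^-1 * \sum_(j < N) (h (particle z j) * force_rest j c t z)).
  by apply: bc_average => j; apply: bc_weighted => //; exact: bc_force_rest.
have bs : bc (fun z => \sum_(e < d) (G1 e z - G2 e z)).
  by apply: bc_sum => e _; exact: bc_sub.
rewrite (expectD cF0 F00 F01)//; last exact: bc_add.
apply: le_trans (ler_normD _ _) _; apply: lerD; last first.
  apply: le_trans (expect_norm cF0 F00 F01 br) _.
  rewrite -(expectZ cF0 F00 F01); last exact: bc_energy.
  apply: (expect_le cF0 F00 F01); [exact: bc_norm| |by move=> z; exact: force_rest_le].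
  by apply: bc_mul; [exact: bc_cst|exact: bc_energy].
rewrite (expectD cF0 F00 F01)//; apply: le_trans (ler_normD _ _) _; apply: lerD.
  exact: weak_bound_noise.
rewrite (expect_sum cF0 F00 F01); last by move=> e; exact: (bc_sub (b1 e) (b2 e)).
apply: le_trans (ler_norm_sum _ _ _) _.
apply: (@le_trans _ _ (\sum_(e < d) (2 * B))); last by rewrite sumr_const card_ord -[leLHS]mulr_natl.
apply: ler_sum => e _; rewrite (expectB cF0 F00 F01 (b1 e) (b2 e)).
apply: le_trans (ler_normB _ _) _; rewrite mulrDl mul1r; exact: lerD.
Qed.

(** Coefficient of e^(rate t)/N in [force_weak_bound] once the energy is bounded by e^(rate t)/N: 2L
    from the noise, d + 4dL^2 from the products with centered kernels, 4dL from the Taylor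
    remainder. *)
Definition weak_const : R := 2 * L + d%:R + 4 * d%:R * L ^+ 2 + 4 * d%:R * L.

Lemma weak_const_ge0 : 0 <= weak_const.
Proof. by rewrite /weak_const !addr_ge0// !mulr_ge0// sqr_ge0. Qed.

Lemma force_weak_bound_exp t k c : 0 <= t ->
  (forall e, weak_bound (fun j => pdev j e t) (k * expR (rate * t))) ->
  weak_bound (fun j => fdev j c t) ((2 * d%:R * L * k + weak_const / N%:R) * expR (rate * t)).
Proof.
move=> t0 hk h ah; apply: le_trans (force_weak_bound c t0 hk ah) _.
have := expect_energy t0; set q := expect _; set E := expR _ => hq.
have E1 : 1 <= E by rewrite /E -expR0 ler_expR mulr_ge0// ltW// rate_gt0.
have h1 : (2 * L + 4 * d%:R * L ^+ 2) * N%:R^-1 * 1 <= (2 * L + 4 * d%:R * L ^+ 2) * N%:R^-1 * E.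
  apply: ler_wpM2l => //; apply: mulr_ge0; last by rewrite invr_ge0.
  by apply: addr_ge0; apply: mulr_ge0 => //; (exact: sqr_ge0 || exact: mulr_ge0).
have h2 : (d%:R + 4 * d%:R * L) * q <= (d%:R + 4 * d%:R * L) * (N%:R^-1 * E).
  by apply: ler_wpM2l => //; apply: addr_ge0 => //; apply: mulr_ge0 => //; exact: mulr_ge0.
rewrite /weak_const; move: h1 h2; set M := N%:R^-1; nra.
Qed.

Lemma path_weighted T h (f df : 'I_N -> R -> Ph -> R) : admissible h ->
  (forall j, bounded_path T (f j) (df j)) ->
  bounded_path T (fun t z => N%:R^-1 * \sum_(j < N) (h (particle z j) * f j t z))
    (fun t z => N%:R^-1 * \sum_(j < N) (h (particle z j) * df j t z)).
Proof.
move=> ah hf.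
have bN : bounded_path T (fun _ _ => N%:R^-1) (fun _ (_ : Ph) => 0) by apply: bounded_path_cst; exact: bc_cst.
have bh j : bounded_path T (fun _ z => h (particle z j)) (fun _ (_ : Ph) => 0).
  by apply: bounded_path_cst; exact: (bc_particle j ah.1).
have := bounded_path_mul bN (bounded_path_sum (fun j => bounded_path_mul (bh j) (hf j))).
congr bounded_path; apply/funext => t; apply/funext => z.
by rewrite mul0r add0r; congr (_ * _); apply: eq_bigr => j _; rewrite mul0r add0r.
Qed.

Lemma weak_bound_le f m m' : m <= m' -> weak_bound f m -> weak_bound f m'.
Proof. by move=> mm h g ag; apply: le_trans mm; exact: h. Qed.

(** The weighted expectations vanish initially with their first derivative, and
    [force_weak_bound_exp] bounds the second one. On positions this is an affine map of k with slope
    2dL/rate^2. *)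
Lemma weak_bound_step T k : 0 <= T -> 0 <= k ->
  (forall t e, 0 <= t <= T -> weak_bound (fun j => pdev j e t) (k * expR (rate * t))) ->
  forall t c, 0 <= t <= T ->
  weak_bound (fun j => vdev j c t) ((2 * d%:R * L * k + weak_const / N%:R) / rate * expR (rate * t)) /\
  weak_bound (fun j => pdev j c t) ((2 * d%:R * L * k + weak_const / N%:R) / rate ^+ 2 * expR (rate * t)).
Proof.
move=> T0 k0 hk t c /andP[t0 tT].
set rho := 2 * d%:R * L * k + _.
have rho0 : 0 <= rho.
  by apply: addr_ge0; [exact: mulr_ge0 (mulr_ge0 _ _) _|exact: mulr_ge0 weak_const_ge0 _].
suff main h : admissible h ->
  `|expect (fun z => N%:R^-1 * \sum_(j < N) (h (particle z j) * vdev j c t z))| <= rho / rate * expR (rate * t) /\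
  `|expect (fun z => N%:R^-1 * \sum_(j < N) (h (particle z j) * pdev j c t z))| <= rho / rate ^+ 2 * expR (rate * t).
  by split=> h ah; have [] := main h ah.
move=> ah.
have p1 := path_weighted ah (fun j => path_pdev t j c).
have p2 := path_weighted ah (fun j => path_vdev t j c).
apply: (@second_derive_le _
  (fun s => expect (fun z => N%:R^-1 * \sum_(j < N) (h (particle z j) * pdev j c s z)))
  (fun s => expect (fun z => N%:R^-1 * \sum_(j < N) (h (particle z j) * vdev j c s z)))
  (fun s => expect (fun z => N%:R^-1 * \sum_(j < N) (h (particle z j) * fdev j c s z)))
  rho rate t t0 rate_gt0 rho0).
- exact: (expect_within cF0 F00 F01 p1).
- exact: (expect_within cF0 F00 F01 p2).
- by move=> s st; exact: (expect_is_derive cF0 F00 F01 p1 st).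
- by move=> s st; exact: (expect_is_derive cF0 F00 F01 p2 st).
- rewrite [X in expect X](_ : _ = fun=> 0) ?(expect_cst cF0 F00 F01)//; apply/funext => z.
  by rewrite big1 ?mulr0// => j _; rewrite (dev0 j c z).1 mulr0.
- rewrite [X in expect X](_ : _ = fun=> 0) ?(expect_cst cF0 F00 F01)//; apply/funext => z.
  by rewrite big1 ?mulr0// => j _; rewrite (dev0 j c z).2 mulr0.
- move=> s /andP[s0 st]; apply: force_weak_bound_exp => //; first exact: ltW.
  by move=> e; apply: hk; rewrite (ltW s0) (le_trans (ltW st)).
Qed.

(** With a = dL this follows from (2a - 1)^2 >= 0. It makes the slope in [weak_bound_step] at most
    1/2 and closes the velocity bound in [weak_bound_limit]. *)
Lemma rate_ge : 4 * d%:R * L + 1 <= rate.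
Proof.
rewrite /rate -mulrA; set a := d%:R * L; have := sqr_ge0 (2 * a - 1); rewrite expr2; nra.
Qed.

(* [weak_bound_step] maps a bound [k] to a bound at most [k / 2 + weak_const / N]; its
   iterates converge to [2 * weak_const / N] from the crude initial bound. *)
Lemma weak_bound_iter T : 0 <= T -> forall k t e, 0 <= t <= T ->
  weak_bound (fun j => pdev j e t) ((2 * L * T * T / 2 ^+ k + 2 * weak_const / N%:R) * expR (rate * t)).
Proof.
move=> T0.
have W0 : 0 <= weak_const / N%:R by exact: mulr_ge0 weak_const_ge0 _.
have E1 t : 0 <= t -> 1 <= expR (rate * t).
  by move=> t0; rewrite -expR0 ler_expR mulr_ge0// ltW// rate_gt0.
have LT0 : 0 <= 2 * L * T * T by exact: mulr_ge0 (mulr_ge0 (mulr_ge0 _ _) _) _.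
elim=> [|k IH] t e tT; have t0 : 0 <= t by case/andP: tT.
  have bd : weak_bound (fun j => pdev j e t) (2 * L * T * T).
    move=> h ah; apply: (expect_bound cF0 F00 F01).
      by have [] := bc_average (fun j => bc_weighted j ah (bc_pdev j e t0)).
    move=> z; apply: average_bound => j; rewrite normrM.
    apply: le_trans (ler_wpM2r (normr_ge0 _) (ah.2 _)) _; rewrite mul1r.
    exact: (dev_bound j e z tT).2.
  apply: weak_bound_le bd; rewrite expr0 divr1.
  apply: le_trans (ler_wpM2l _ (E1 t t0)); last by rewrite addr_ge0// -mulrA mulr_ge0.
  by rewrite mulr1 lerDl -mulrA mulr_ge0.
set kap := _ + 2 * weak_const / N%:R in IH.
have kap0 : 0 <= kap.
  by apply: addr_ge0; [exact: divr_ge0|rewrite -mulrA mulr_ge0].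
have [_] := weak_bound_step T0 kap0 IH e tT.
apply: weak_bound_le; rewrite ler_wpM2r ?expR_ge0// ler_pdivrMr ?exprn_gt0 ?rate_gt0//.
have -> : 2 * L * T * T / 2 ^+ k.+1 + 2 * weak_const / N%:R = kap / 2 + weak_const / N%:R.
  by rewrite /kap exprS invfM; set a := 2 * L * T * T; set b := 2 ^- k; field.
have r1 := rate_ge.
have dL : 0 <= d%:R * L by exact: mulr_ge0.
have r2 : rate <= rate ^+ 2 by rewrite expr2 ler_peMr// ?(ltW rate_gt0)// (le_trans _ r1)// lerDr -mulrA mulr_ge0.
move: r1 r2 W0 kap0 dL; set W := weak_const / N%:R; set r := rate ^+ 2; rewrite -!mulrA; set a := d%:R * L.
move=> r1 r2 W0 kap0 a0.
have h1 : kap * (4 * a) <= kap * r by apply: ler_wpM2l => //; apply: le_trans r2; apply: le_trans r1; rewrite lerDl.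
have h2 : W * 1 <= W * r by apply: ler_wpM2l => //; apply: le_trans r2; apply: le_trans r1; rewrite lerDr mulr_ge0.
have -> : 2 * (d%:R * (L * kap)) = kap * (4 * a) / 2 by rewrite /a; field.
by lra.
Qed.

(** The crude term tends to 0 along the iteration. One further step gives the velocities: (2dL * 2W
    + W)/rate = W(4dL + 1)/rate <= W, where W = [weak_const]/N. *)
Lemma weak_bound_limit T e : 0 <= T ->
  weak_bound (fun j => pdev j e T) (2 * weak_const / N%:R * expR (rate * T)) /\
  weak_bound (fun j => vdev j e T) (weak_const / N%:R * expR (rate * T)).
Proof.
move=> T0.
have W0 : 0 <= weak_const / N%:R by exact: mulr_ge0 weak_const_ge0 _.
have main t e' : 0 <= t <= T -> weak_bound (fun j => pdev j e' t) (2 * weak_const / N%:R * expR (rate * t)).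
  move=> tT h ah; apply/ler_addgt0Pr => eps eps0.
  have [k hk] := half_pow_lt (2 * L * T * T * expR (rate * t)) eps0.
  apply: le_trans (weak_bound_iter T0 k e' tT ah) _.
  rewrite mulrDl addrC lerD2l; apply: ltW; apply: le_lt_trans hk; rewrite mulrAC//.
split; first by apply: main; rewrite T0 lexx.
have k0 : 0 <= 2 * weak_const / N%:R by rewrite -mulrA mulr_ge0.
have TT : 0 <= T <= T by rewrite T0 lexx.
have [+ _] := weak_bound_step T0 k0 main e TT.
apply: weak_bound_le; rewrite ler_wpM2r ?expR_ge0// ler_pdivrMr ?rate_gt0//.
have -> : 2 * d%:R * L * (2 * weak_const / N%:R) + weak_const / N%:R = weak_const / N%:R * (4 * d%:R * L + 1) by ring.
by rewrite ler_wpM2l// rate_ge.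
Qed.

(** The d position directions count 2 [weak_const] each and the d velocity directions [weak_const]
    each; 2d comes from the second order remainder of the test function. *)
Definition coupling_const : R := 3 * d%:R * weak_const + 2 * d%:R.

Lemma coupling_const_ge0 : 0 <= coupling_const.
Proof. by apply: addr_ge0; [exact: mulr_ge0 (mulr_ge0 _ _) weak_const_ge0|exact: mulr_ge0]. Qed.

Lemma coupling_bound (phi : D -> R) T : 0 <= T -> bc phi ->
  (forall a, continuous ('D_(phase_dir R a) phi)) ->
  (forall y a, derivable phi y (phase_dir R a)) ->
  (forall y a b, derivable ('D_(phase_dir R a) phi) y (phase_dir R b)) ->
  (forall y a, `|'D_(phase_dir R a) phi y| <= 1) ->
  (forall y a b, `|'D_(phase_dir R b) ('D_(phase_dir R a) phi) y| <= 1) ->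
  `|expect (fun z => N%:R^-1 * \sum_(j < N) (phi (particle (X z T, V z T) j) -
      phi (P (particle z j) T, Q (particle z j) T)))| <=
  coupling_const / N%:R * expR (rate * T).
Proof.
move=> T0 bphi cDphi dphi ddphi b1 b2.
pose flow1 (y : D) : D := (P y T, Q y T).
have cflow1 : continuous flow1 by exact: cP.
pose dev (a : 'I_d + 'I_d) j z := match a with inl e => pdev j e T z | inr e => vdev j e T z end.
have bdev a j : bc (dev a j) by case: a => e; [exact: bc_pdev|exact: bc_vdev].
have split_sum (f : 'I_d + 'I_d -> R) : \sum_a f a = \sum_e f (inl e) + \sum_e f (inr e).
  exact: big_sumType.
pose rest j z := phi (particle (X z T, V z T) j) - phi (flow1 (particle z j)) -
  \sum_a dev a j z * 'D_(phase_dir R a) phi (flow1 (particle z j)).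
(* The factor 2d is the number of phase directions, through Cauchy-Schwarz. *)
have rest_le j z : `|rest j z| <= 2 * d%:R * (\sum_c (pdev j c T z * pdev j c T z + vdev j c T z * vdev j c T z)).
  rewrite /rest (_ : particle (X z T, V z T) j = flow1 (particle z j) + \sum_a dev a j z *: phase_dir R a).
    apply: le_trans (taylor2 dphi ddphi b2 _ _ _) _; rewrite mul1r.
    apply: le_trans (sum_sq_le _) _; rewrite card_sum card_ord addnn -muln2 natrM [_ * 2]mulrC.
    rewrite ler_wpM2l ?mulr_ge0// split_sum -big_split; apply: ler_sum => c _ /=.
    by rewrite !real_normK ?num_real// !expr2.
  rewrite [LHS](phase_diff_sum _ (flow1 (particle z j))); congr (_ + _).
  by apply: eq_bigr => -[] e _; rewrite /dev /pdev /vdev /= !mxE.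
have bD a : admissible (fun y => 'D_(phase_dir R a) phi (flow1 y)).
  split; last by move=> y; exact: b1.
  by split; [exact: (cont_comp cflow1 (cDphi a))|exists 1 => y; exact: b1].
have brest j : bc (rest j).
  apply: bc_sub; last by apply: bc_sum => a _; apply: bc_mul => //; apply: (bc_particle j (bD a).1).
  apply: bc_sub; last by apply: (bc_particle j (bc_comp cflow1 bphi)).
  exact: (bc_comp (cX T0) (bc_particle j bphi)).
have E z : N%:R^-1 * \sum_(j < N) (phi (particle (X z T, V z T) j) - phi (P (particle z j) T, Q (particle z j) T)) =
  \sum_a N%:R^-1 * (\sum_(j < N) 'D_(phase_dir R a) phi (flow1 (particle z j)) * dev a j z) + N%:R^-1 * \sum_j rest j z.
  rewrite -mulr_sumr -mulrDr; congr (_ * _); rewrite exchange_big -big_split; apply: eq_bigr => j _ /=.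
  rewrite /rest addrC; under [X in _ = _ + X]eq_bigr do rewrite mulrC.
  by rewrite subrK.
under eq_fun do rewrite E.
have bsum a : bc (fun z => N%:R^-1 * (\sum_(j < N) 'D_(phase_dir R a) phi (flow1 (particle z j)) * dev a j z)).
  by apply: bc_average => j; exact: (bc_weighted j (bD a) (bdev a j)).
have bs : bc (fun z => \sum_a N%:R^-1 * (\sum_(j < N) 'D_(phase_dir R a) phi (flow1 (particle z j)) * dev a j z)).
  by apply: bc_sum.
have br : bc (fun z => N%:R^-1 * \sum_j rest j z) by exact: bc_average.
rewrite (expectD cF0 F00 F01 bs br) (expect_sum cF0 F00 F01)//.
apply: le_trans (ler_normD _ _) _.
set q := N%:R^-1 * expR (rate * T).
have -> : coupling_const / N%:R * expR (rate * T) =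
  (d%:R * (2 * weak_const * q) + d%:R * (weak_const * q)) + 2 * d%:R * q.
  by rewrite /coupling_const /q; ring.
apply: lerD.
  apply: le_trans (ler_norm_sum _ _ _) _; rewrite split_sum.
  have cst (x : R) : d%:R * x = \sum_(e < d) x by rewrite sumr_const card_ord -[RHS]mulr_natl.
  rewrite !cst; apply: lerD; apply: ler_sum => e _.
    by have := (weak_bound_limit e T0).1 _ (bD (inl e)); rewrite /q mulrA.
  by have := (weak_bound_limit e T0).2 _ (bD (inr e)); rewrite /q mulrA.
apply: le_trans (expect_norm cF0 F00 F01 br) _.
apply: (@le_trans _ _ (expect (fun z => 2 * d%:R * energy T z))).
  apply: (expect_le cF0 F00 F01); [exact: bc_norm|by apply: bc_mul; [exact: bc_cst|exact: bc_energy]|].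
  move=> z; rewrite normrM ger0_norm ?invr_ge0// /energy mulrCA ler_wpM2l ?invr_ge0//.
  by apply: le_trans (ler_norm_sum _ _ _) _; rewrite mulr_sumr; apply: ler_sum => j _; exact: rest_le.
rewrite (expectZ cF0 F00 F01); last exact: bc_energy.
by rewrite ler_wpM2l ?mulr_ge0// expect_energy.
Qed.

End Coupling.

(** * Force fields *)

Section OppositeSmooth.
Context {R : realType} {E : normedModType R} {I : Type}.
Variable e : I -> E.

Lemma partials_opp (f : E -> R) : smooth e f -> forall s,
  partials e s (fun x => - f x) = (fun x => - partials e s f x).
Proof.
move=> sf; elim=> [//|i s IH]; rewrite /partials /= -/(partials e s) -/(partials e s).
apply/funext => x; rewrite -/(partials e s (fun x => - f x)) IH.
exact: (deriveN ((sf s).2 x i)).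
Qed.

Lemma smooth_opp (f : E -> R) : smooth e f -> smooth e (fun x => - f x).
Proof.
move=> sf s; rewrite partials_opp//; split.
  by apply: cont_opp; exact: (sf s).1.
by move=> x i; apply: derivableN; exact: (sf s).2.
Qed.

End OppositeSmooth.

Lemma even_derive0 {R : realType} {E : normedModType R} (f : E -> R) (v : E) :
  (forall x, f (- x) = f x) -> derivable f 0 v -> 'D_v f 0 = 0.
Proof.
move=> ef df.
have h : is_derive (0 : R) 1 (fun r : R => f (0 + r *: v)) ('D_v f 0).
  by have := @is_derive_line R E f 0 v 0; rewrite scale0r addr0 => /(_ df).
have h' : is_derive (0 : R) 1 (fun r : R => f (0 + (- r) *: v)) (- 'D_v f 0).
  have hN : is_derive (0 : R) 1 (fun r : R => - r) (-1).
    have := dR_scale (-1) (is_derive_id (0 : R) (1 : R)); rewrite mulr1.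
    by rewrite (_ : (fun y : R => -1 * id y) = -%R)//; apply/funext => y; rewrite mulN1r.
  have h1 : is_derive (- 0 : R) 1 (fun r : R => f (0 + r *: v)) ('D_v f 0) by rewrite oppr0.
  have := is_derive1_comp h1 hN; rewrite mulrN1.
  exact.
have : (fun r : R => f (0 + (- r) *: v)) = (fun r : R => f (0 + r *: v)).
  by apply/funext => r; rewrite !add0r scaleNr ef.
move=> heq; rewrite heq in h'.
have e1 := @derive_val _ _ _ _ _ _ _ h; have e2 := @derive_val _ _ _ _ _ _ _ h'.
by move: e2; rewrite e1 => /eqP; rewrite -subr_eq0 opprK -mulr2n mulrn_eq0 => /eqP.
Qed.

Section PotentialForce.
Context {R : realType} {d : nat}.
Variable V : 'rV[R]_d -> R.
Hypothesis (Vper : torus_periodic V) (Vsm : smooth (@torus_dir R d) V) (Vev : forall x, V (- x) = V x).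
Local Notation dir := (@torus_dir R d).

(** Minus the gradient of V, as a one-letter [partials]: its further derivatives are again iterated
    partials of -V, to which smoothness applies directly. *)
Definition potential_force (c : 'I_d) (x : 'rV[R]_d) : R := partials dir [:: c] (fun y => - V y) x.
Local Notation K := potential_force.

Lemma potential_forceE c x : K c x = - potential_gradient V x ord0 c.
Proof. by rewrite /potential_force partials_opp// /potential_gradient mxE. Qed.

Lemma potential_force_smooth c s : continuous (partials dir s (K c)) /\
  forall x e, derivable (partials dir s (K c)) x (dir e).
Proof. by have /(_ s) := @smooth_derive _ _ _ c (smooth_opp Vsm). Qed.

Lemma potential_force_per c : torus_periodic (K c).
Proof. by apply: derive_periodic => k x /=; rewrite Vper. Qed.

Lemma potential_force0 c : K c 0 = 0.
Proof.
apply: even_derive0; first by move=> x; rewrite Vev.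
exact: (smooth_opp Vsm [::]).2.
Qed.

(** The summand 1 makes the bound at least 1, so that it can be divided by. *)
Definition force_const (r : R) : R := 1 + fine (gradient_sobolev_norm r V).

Lemma gradient_sobolev_lty r : 0 <= r -> (gradient_sobolev_norm r V < +oo)%E.
Proof.
move=> r0; rewrite /gradient_sobolev_norm.
apply: (big_ind (fun u : \bar R => (u < +oo)%E)) => //.
  by move=> x y hx hy; rewrite gt_max hx hy.
move=> i _; apply: (sobolev_norm_lty r0).
  rewrite (_ : (fun x => _) = 'D_(dir i) V); first exact: derive_periodic.
  by apply/funext => x; rewrite /potential_gradient mxE.
rewrite (_ : (fun x => _) = 'D_(dir i) V); first exact: smooth_derive.
by apply/funext => x; rewrite /potential_gradient mxE.
Qed.

Lemma potential_force_bound (r : R) c s x : 2 <= r -> (size s <= 2)%N ->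
  `|partials dir s (K c) x| <= force_const r.
Proof.
move=> r2 s2.
have r0 : 0 <= r by apply: le_trans r2.
set f := fun x => potential_gradient V x ord0 c.
have h1 : (sobolev_norm dir r f <= gradient_sobolev_norm r V)%E.
  exact: (le_bigmax_cond _ (fun i => sobolev_norm dir r (fun x => potential_gradient V x ord0 i)) (isT : xpredT c)).
have fin := gradient_sobolev_lty r0.
have h0 : (0 <= gradient_sobolev_norm r V)%E.
  by rewrite /gradient_sobolev_norm; exact: bigmax_ge_id.
have h2 : (sup_norm_upto dir (Num.truncn r) f <= (fine (gradient_sobolev_norm r V))%:E)%E.
  rewrite fineK ?ge0_fin_numE//; apply: le_trans h1.
  apply: (@sup_norm_le_sobolev _ _ _ _ _ _ c (dir c)).
  by apply/eqP => /matrixP/(_ ord0 c); rewrite !mxE !eqxx => /eqP; rewrite oner_eq0.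
have fE : f = 'D_(dir c) V by apply/funext => y; rewrite /f /potential_gradient mxE.
have -> : partials dir s (K c) x = - partials dir s f x.
  by rewrite fE -!partials_rcons partials_opp.
rewrite normrN; apply: (@le_trans _ _ (fine (gradient_sobolev_norm r V))); last by rewrite lerDr.
by apply: (sup_norm_uptoP h2); apply: leq_trans s2 _; rewrite truncn_ge_nat.
Qed.

Lemma force_const_ge1 r : 0 <= r -> 1 <= force_const r.
Proof.
move=> r0; rewrite lerDl fine_ge0// /gradient_sobolev_norm; exact: bigmax_ge_id.
Qed.

End PotentialForce.

Section DensityPath.
Context {R : realType} {d : nat}.
Local Notation D := (phase R 1 d).
Variable G : R -> D -> R.
Hypothesis (cG : forall t, continuous (G t)) (G0 : forall t z, 0 <= G t z) (G1 : forall t, phase_eint (G t) = 1%E).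
Hypothesis cGt : forall z, continuous (fun t => G t z).
Local Notation mu := (phase_measure R 1 d).

Let int_density (g : D -> R) t : bc g -> mu.-integrable setT (fun w => (g (phase_of_coords w) * G t (phase_of_coords w))%:E).
Proof.
move=> bg; have := integrable_weight (@cG t) (@G0 t) (@G1 t) bg.
by under eq_fun do rewrite weight1.
Qed.

Let int_G t : mu.-integrable setT (EFin \o (fun w => G t (phase_of_coords w))).
Proof.
have := int_density t (bc_cst 1); under eq_fun do rewrite mul1r; exact.
Qed.

(* Scheffe's lemma: the positive part of [G t0 - G t] is dominated by [G t0], and the two
   parts of the difference have equal integrals. *)
Lemma continuous_mean_path (g : D -> R) : bc g -> continuous (fun t => mean (G t) g).
Proof.
move=> bg t0; have [cg [M hM]] := bg.
have M0 : 0 <= M by apply: le_trans (hM (0, 0)); exact: normr_ge0.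
pose p t w := Num.max (G t0 (phase_of_coords w) - G t (phase_of_coords w)) 0.
have p0 t w : 0 <= p t w by rewrite /p le_max lexx orbT.
have ple t w : p t w <= G t0 (phase_of_coords w).
  by rewrite /p ge_max G0 andbT gerBl G0.
have mp t : measurable_fun setT (fun w => (p t w)%:E).
  apply: (measurable_phase_EFin (f := fun z => Num.max (G t0 z - G t z) 0)).
  by apply: cont_max; [apply: cont_sub; exact: cG|exact: cont_cst].
have ip t : mu.-integrable setT (EFin \o p t).
  apply: le_integrable (int_G t0) => //; first exact: mp.
  by move=> w _ /=; rewrite !ger0_norm// lee_fin.
have cp : {in `]t0 - 1, t0 + 1[%classic, continuous (fun t => \int[mu]_w p t w)}.
  apply: (@continuity_under_integral _ _ _ mu p setT measurableT _ _ _ _ (fun w => G t0 (phase_of_coords w))).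
  - by move=> t _; exact: ip.
  - apply: aeW => w _ t _; apply: cont_max; last exact: cont_cst.
    by apply: cont_sub; [exact: cont_cst|exact: cGt].
  - exact: int_G.
  - by move=> t _; apply: aeW => w _; rewrite ger0_norm.
have {}cp : (fun t => \int[mu]_w p t w) @ t0 --> (0 : R).
  have := cp t0; rewrite inE /= in_itv /= ltrBlDr ltrDl ltr01 /= => /(_ isT).
  rewrite /continuous_at [X in _ --> X](_ : _ = 0)//.
  rewrite (_ : p t0 = fun=> 0) ?Rintegral_cst ?mul0r//; apply/funext => w.
  by rewrite /p subrr maxxx.
(* The function |a - b| equals 2 max(a - b, 0) - (a - b), and a - b has integral 0 for two
   probability densities. *)
have key t : `|mean (G t0) g - mean (G t) g| <= 2 * M * \int[mu]_w p t w.
  rewrite /mean /phase_integral -RintegralB//; [|exact: (int_density t0 bg)|exact: (int_density t bg)].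
  have ig : mu.-integrable setT (EFin \o (fun w => g (phase_of_coords w) * G t0 (phase_of_coords w) - g (phase_of_coords w) * G t (phase_of_coords w))).
    exact: (integrableB measurableT (int_density t0 bg) (int_density t bg)).
  apply: le_trans (le_normr_Rintegral measurableT ig) _.
  have z0 : \int[mu]_w (G t0 (phase_of_coords w) - G t (phase_of_coords w)) = 0.
    rewrite RintegralB//.
    by rewrite /Rintegral -!/(phase_eint _) !G1 subrr.
  have i1 : mu.-integrable setT (EFin \o (fun w => 2 * M * p t w)).
    by have := integrableZl measurableT (2 * M) (ip t).
  have i2 : mu.-integrable setT (EFin \o (fun w => G t0 (phase_of_coords w) - G t (phase_of_coords w))).
    exact: (integrableB measurableT (int_G t0) (int_G t)).
  have i3 : mu.-integrable setT (EFin \o (fun w => M * (G t0 (phase_of_coords w) - G t (phase_of_coords w)))).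
    by have := integrableZl measurableT M i2.
  have -> : 2 * M * \int[mu]_w p t w =
      \int[mu]_w (2 * M * p t w - M * (G t0 (phase_of_coords w) - G t (phase_of_coords w))).
    by rewrite RintegralB// RintegralZl// RintegralZl// z0 mulr0 subr0.
  apply: le_Rintegral => //.
  - exact: (integrable_norm ig).
  - exact: (integrableB measurableT i1 i3).
  - move=> w _; rewrite -mulrBr normrM /p.
    set a := G t0 _; set b := G t _; have := hM (phase_of_coords w).
    case: (leP (a - b) 0) => ab h.
      by rewrite [`|a - b|]ler0_norm// mulr0 sub0r -mulrN ler_wpM2r// oppr_ge0.
    have -> : 2 * M * (a - b) - M * (a - b) = M * (a - b) by ring.
    by rewrite [`|a - b|]gtr0_norm// ler_wpM2r// ltW.
apply/cvgrPdist_le => /= e e0.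
have c2 : (fun t => 2 * M * \int[mu]_w p t w) @ t0 --> (0 : R).
  by rewrite -[X in _ --> X](mulr0 (2 * M)); apply: cvgMr.
have /cvgrPdist_le/(_ e e0) := c2.
by apply: filterS => t; rewrite sub0r normrN => h; apply: le_trans (key t) (le_trans (ler_norm _) h).
Qed.

End DensityPath.

Section ForceFields.
Context {R : realType} {d : nat}.
Local Notation dir := (@torus_dir R d).
Local Notation D := (phase R 1 d).
Variables (K : 'I_d -> 'rV[R]_d -> R) (L : R).
Hypothesis L0 : 0 <= L.
Hypothesis cK : forall c, continuous (K c).
Hypothesis dK : forall c x e, derivable (K c) x (dir e).
Hypothesis bK : forall c x, `|K c x| <= L.
Hypothesis bDK : forall c x e, `|'D_(dir e) (K c) x| <= L.
Hypothesis perK : forall c, torus_periodic (K c).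

Lemma pair_force_regular n : regular_field L (2 * d%:R * L) (fun _ : R => @pair_force R d n K).
Proof.
split.
- by move=> _ x j c; rewrite mxE; exact: average_bound.
- move=> _ x y a hxy j c; rewrite !mxE -mulrBr -sumrB; apply: average_bound => l.
  apply: le_trans (row_lipschitz (@dK c) (@bDK c) _ _) _.
  apply: (@le_trans _ _ (L * \sum_(e < d) (2 * a))).
    apply: ler_wpM2l => //; apply: ler_sum => e _; rewrite !mxE.
    have -> : x j e - x l e - (y j e - y l e) = (x j e - y j e) - (x l e - y l e) by ring.
    apply: le_trans (ler_normB _ _) _; rewrite mulrDl mul1r; exact: lerD.
  rewrite sumr_const card_ord -[X in L * X]mulr_natl.
  by have -> : L * (d%:R * (2 * a)) = 2 * d%:R * L * a by ring.
- by move=> x j c; exact: cont_cst.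
Qed.

Lemma pair_force_per n (x : 'M[R]_(n.+1, d)) (k : 'M[int]_(n.+1, d)) :
  pair_force K (x + map_mx intr k) = pair_force K x.
Proof.
apply/matrixP => j c; rewrite !mxE; congr (_ * _); apply: eq_bigr => l _.
have -> : row j (x + map_mx intr k) - row l (x + map_mx intr k) =
    (row j x - row l x) + map_mx intr (row j k - row l k).
  by apply/matrixP => i e; rewrite !mxE intrB; ring.
exact: perK.
Qed.

Lemma pair_force_perm n (s : 'I_n.+1 -> 'I_n.+1) (x : 'M[R]_(n.+1, d)) : bijective s ->
  pair_force K (\matrix_(i, c) x (s i) c) = \matrix_(i, c) pair_force K x (s i) c.
Proof.
move=> bs; apply/matrixP => j c; rewrite !mxE; congr (_ * _).
rewrite [RHS](reindex s) /=; last by exact: onW_bij.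
apply: eq_bigr => l _; congr (K c _).
by apply/matrixP => i e; rewrite !mxE.
Qed.

Variable G : R -> D -> R.
Hypothesis (cG : forall t, continuous (G t)) (G0 : forall t z, 0 <= G t z) (G1 : forall t, phase_eint (G t) = 1%E).
Hypothesis cGt : forall z, continuous (fun t => G t z).

Definition mean_force (t : R) (x : 'M[R]_(1, d)) : 'M[R]_(1, d) :=
  \row_c mean (G t) (fun y => K c (x - y.1)).

Lemma continuous_force_at c (x : 'rV[R]_d) : continuous (fun y : D => K c (x - y.1)).
Proof.
have cr : continuous (fun y : D => x - y.1); last exact: (cont_comp cr (@cK c)).
apply: mx_continuous => i e; under eq_fun do rewrite !mxE.
by apply: cont_sub; [exact: cont_cst|exact: continuous_pos].
Qed.

Lemma bc_force_at c (x : 'rV[R]_d) : bc (fun y : D => K c (x - y.1)).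
Proof. by split; [exact: continuous_force_at|exists L => y; exact: bK]. Qed.

Lemma mean_force_regular : regular_field L (2 * d%:R * L) mean_force.
Proof.
split.
- move=> t x j c; rewrite mxE; apply: (mean_bound (@cG t) (@G0 t) (@G1 t)) => [|y]; first exact: continuous_force_at.
  exact: bK.
- move=> t x y a hxy j c; rewrite !mxE.
  rewrite -(meanB (@cG t) (@G0 t) (@G1 t)); [|exact: bc_force_at|exact: bc_force_at].
  apply: (mean_bound (@cG t) (@G0 t) (@G1 t)) => [|z].
    by apply: cont_sub; exact: continuous_force_at.
  apply: le_trans (row_lipschitz (@dK c) (@bDK c) _ _) _.
  have a0 : 0 <= a by apply: le_trans (hxy ord0 c); exact: normr_ge0.
  apply: (@le_trans _ _ (L * \sum_(e < d) (2 * a))).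
    apply: ler_wpM2l => //; apply: ler_sum => e _; rewrite !mxE.
    have -> : x ord0 e - z.1 ord0 e - (y ord0 e - z.1 ord0 e) = x ord0 e - y ord0 e by ring.
    by apply: le_trans (hxy _ _) _; rewrite ler_peMl// ler1n.
  rewrite sumr_const card_ord -[X in L * X]mulr_natl.
  by have -> : L * (d%:R * (2 * a)) = 2 * d%:R * L * a by ring.
- move=> x i c; under eq_fun do rewrite mxE.
  exact: (continuous_mean_path cG G0 G1 cGt (bc_force_at c x)).
Qed.

Lemma mean_force_per t (x : 'M[R]_(1, d)) (k : 'M[int]_(1, d)) :
  mean_force t (x + map_mx intr k) = mean_force t x.
Proof.
apply/matrixP => j c; rewrite !mxE; congr mean; apply/funext => y.
by rewrite addrAC perK.
Qed.

End ForceFields.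

(** * Conclusion *)

Lemma insert_ord0 {R : realType} {n d : nat} (y : phase R 1 d) (z : phase R n d) :
  (col_mx y.1 z.1 : 'M[R]_(1 + n, d), col_mx y.2 z.2 : 'M[R]_(1 + n, d)) = insert ord0 y z.
Proof.
have h (a : 'M[R]_(1, d)) (b : 'M[R]_(n, d)) : col_mx a b = insert_mx ord0 a b.
  apply/matrixP => i c; rewrite mxE [RHS]mxE.
  case: splitP => k ik; case: unliftP => [j|] ji.
  - by move: ik; rewrite ji /= /bump leq0n [k]ord1.
  - by rewrite [k]ord1.
  - by congr (b _ c); apply: val_inj; move: ik; rewrite ji /= /bump leq0n => -[].
  - by move: ik; rewrite ji.
by rewrite /insert !h.
Qed.

Section MarginalIntegral.
Context {R : realType} {n d : nat}.
Local Notation D := (phase R 1 d).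
Local Notation m1 := (phase_sigma R 1 d).
Local Notation m2 := (phase_sigma R n d).

Lemma integrable_insert (l : 'I_n.+1) (f : phase R n.+1 d -> R) : continuous f ->
  (phase_eint (fun z => `|f z|%R) < +oo)%E ->
  (m1 \x m2)%E.-integrable setT (fun w => (f (insert l (phase_of_coords w.1) (phase_of_coords w.2)))%:E).
Proof.
move=> cf fin; apply/integrableP; split.
  have := measurableT_comp (measurable_phase_EFin cf) (insert_preserving l).1.
  by congr measurable_fun; apply/funext => w /=; rewrite insert_phase_coordsE.
by move: fin; rewrite (eint_insert l (cont_norm cf)).
Qed.

Lemma integrable_phase (f : phase R n d -> R) : continuous f ->
  (phase_eint (fun z => `|f z|%R) < +oo)%E ->
  (phase_measure R n d).-integrable setT (fun w => (f (phase_of_coords w))%:E).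
Proof. by move=> cf fin; apply/integrableP; split=> //; exact: measurable_phase_EFin. Qed.

End MarginalIntegral.

Lemma eint_bounded_lty {R : realType} {n d : nat} (phi f : phase R n d -> R) : bc phi -> continuous f ->
  (phase_eint (fun z => `|f z|%R) < +oo)%E -> (phase_eint (fun z => `|phi z * f z|%R) < +oo)%E.
Proof.
move=> [cphi [M hM]] cf fin.
have M0 : 0 <= M by apply: le_trans (hM (0, 0)); exact: normr_ge0.
apply: (@le_lt_trans _ _ (M%:E * phase_eint (fun z => `|f z|%R))%E); last by rewrite lte_mul_pinfty.
rewrite /phase_eint -ge0_integralZl//; last first.
- exact: (measurable_phase_EFin (cont_norm cf)).
apply: ge0_le_integral => //.
- exact: (measurable_phase_EFin (cont_norm (cont_mul cphi cf))).
- by apply: measurable_funeM; exact: (measurable_phase_EFin (cont_norm cf)).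
- by move=> w _; rewrite -EFinM lee_fin normrM ler_wpM2r.
Qed.

(** The marginal is a real-valued integral, meaningful only where the section is integrable. By
    Fubini this is almost every point, and there [phi] may be moved under the inner integral. *)
Lemma marginal_integral {R : realType} {n d : nat} (f : phase R n.+1 d -> R) (g phi : phase R 1 d -> R) :
  continuous f -> (phase_eint (fun z => `|f z|%R) < +oo)%E ->
  continuous g -> (phase_eint (fun z => `|g z|%R) < +oo)%E -> bc phi ->
  (\int[phase_measure R 1 d]_w (phi (phase_of_coords w) *
     (first_marginal f (phase_of_coords w) - g (phase_of_coords w)))%:E)%E =
  (phase_integral (fun z => phi (particle z ord0) * f z) - phase_integral (fun y => phi y * g y))%:E.
Proof.
move=> cf ff cg fg bphi; have [cphi _] := bphi.
pose m1 := phase_sigma R 1 d; pose m2 := phase_sigma R n d.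
have bpp : bc (fun z : phase R n.+1 d => phi (particle z ord0)).
  exact: (bc_particle ord0 bphi).
have cpf : continuous (fun z : phase R n.+1 d => phi (particle z ord0) * f z).
  by apply: cont_mul => //; exact: bpp.1.
have iH := integrable_insert ord0 cf ff.
have iP := integrable_insert ord0 cpf (eint_bounded_lty bpp cf ff).
set H := (fun w => _) in iH; set P := (fun w => _) in iP.
have margE w : first_marginal f (phase_of_coords w) = fine (fubini_F m2 H w).
  rewrite /first_marginal /phase_integral /Rintegral /fubini_F /H; congr fine.
  by apply: eq_integral => w' _; rewrite insert_ord0.
have mmarg : measurable_fun setT (fun w => first_marginal f (phase_of_coords w)).
  under eq_fun do rewrite margE.
  by apply: measurableT_comp => //; exact: (measurable_fubini_F iH).
have mphi : measurable_fun setT (fun w => phi (phase_of_coords w : phase R 1 d)) by exact: (measurable_phase_fun cphi).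
have mg : measurable_fun setT (fun w => g (phase_of_coords w : phase R 1 d)) by exact: (measurable_phase_fun cg).
have ig : m1.-integrable setT (fun w => (phi (phase_of_coords w) * g (phase_of_coords w))%:E).
  exact: (integrable_phase (cont_mul cphi cg) (eint_bounded_lty bphi cg fg)).
have iF := integrable_fubini_F iP.
transitivity (\int[m1]_w (fubini_F m2 P w - (phi (phase_of_coords w) * g (phase_of_coords w))%:E))%E.
  apply: ae_eq_integral => //.
  - by apply/measurable_EFinP; apply: measurable_funM => //; exact: measurable_funB.
  - apply: emeasurable_funB; first exact: (measurable_fubini_F iP).
    exact: (measurable_phase_EFin (cont_mul cphi cg)).
  - have : {ae m1, forall x, m2.-integrable setT (fun y => H (x, y))} by exact: (ae_integrable1 iH).
    apply: filterS => w iw _; rewrite margE mulrBr EFinB; congr (_ - _)%E.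
    rewrite EFinM fineK; last exact: (integrable_fin_num measurableT iw).
    rewrite /fubini_F -integralZl//; apply: eq_integral => w' _.
    by rewrite /H /P /= particle_insert EFinM.
rewrite integralB// (integral12_prod_meas1 iP).
rewrite EFinB; congr (_ - _)%E.
  rewrite /phase_integral /Rintegral fineK.
    by apply/esym; exact: (eint_insert ord0 cpf).
  apply: (integrable_fin_num measurableT).
  exact: (integrable_phase cpf (eint_bounded_lty bpp cf ff)).
by rewrite /phase_integral /Rintegral fineK//; exact: (integrable_fin_num measurableT ig).
Qed.

Lemma solves_unique {R : realType} {n d : nat} (E : R -> 'M[R]_(n, d) -> 'M[R]_(n, d)) (B L : R) z x v x' v' :
  0 <= L -> regular_field B L E -> solves E z x v -> solves E z x' v' ->
  forall T, 0 <= T -> (x T, v T) = (x' T, v' T).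
Proof.
move=> L0 hE h h' T T0; have := solves_dist L0 hE h h' T0.
rewrite [X in _ <= X * _]big1; last first.
  by move=> i _; rewrite big1// => c _; rewrite !subrr !expr0n addr0.
rewrite mul0r => hle.
have t0 i c : 0 <= (x T i c - x' T i c) ^+ 2 + (v T i c - v' T i c) ^+ 2 by rewrite addr_ge0// sqr_ge0.
have s0 i : 0 <= \sum_c ((x T i c - x' T i c) ^+ 2 + (v T i c - v' T i c) ^+ 2) by exact: sumr_ge0.
have e0 i c : (x T i c - x' T i c) ^+ 2 + (v T i c - v' T i c) ^+ 2 = 0.
  apply/eqP; rewrite eq_le t0 andbT; apply: le_trans hle.
  rewrite (bigD1 i)//= (bigD1 c)//= -addrA lerDl addr_ge0 ?sumr_ge0//.
have ec i c : x T i c = x' T i c /\ v T i c = v' T i c.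
  have /eqP := e0 i c; rewrite paddr_eq0 ?sqr_ge0// !sqrf_eq0 !subr_eq0.
  by move=> /andP[/eqP -> /eqP ->].
by congr pair; apply/matrixP => i c; have [] := ec i c.
Qed.

(** The permuted trajectory solves the same equations, so uniqueness applies. Together with
    [expect_perm] this makes the particles exchangeable. *)
Lemma flow_perm {R : realType} {n d : nat} (K : 'I_d -> 'rV[R]_d -> R) (B L : R)
    (X V : phase R n.+1 d -> R -> 'M[R]_(n.+1, d)) (s : 'I_n.+1 -> 'I_n.+1) : 0 <= L ->
  regular_field B L (fun _ : R => @pair_force R d n K) -> (forall z, solves (fun=> pair_force K) z (X z) (V z)) ->
  bijective s -> forall T z, 0 <= T ->
  (X (perm_rows s z) T, V (perm_rows s z) T) = perm_rows s (X z T, V z T).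
Proof.
move=> L0 hE hflow bs T z T0; rewrite /perm_rows /=.
apply: (solves_unique L0 hE (hflow _) _ T0
  (x' := fun t => \matrix_(i, c) X z t (s i) c) (v' := fun t => \matrix_(i, c) V z t (s i) c)).
have [x0 v0 hx hv] := hflow z; split.
- by rewrite x0.
- by rewrite v0.
- by move=> t i c; under eq_fun do rewrite mxE; rewrite mxE; exact: hx.
- move=> t i c; under eq_fun do rewrite mxE; rewrite pair_force_perm// mxE; exact: hv.
Qed.

Lemma classical_time {R : realType} {n d : nat} (F : R -> phase R n d -> R) z :
  classical F -> continuous (fun t : R => F (Num.max t 0) z).
Proof.
move=> [_ cF _].
have cm : continuous (fun t : R => Num.max t 0) by apply: cont_max; [move=> x; exact: cvg_id|exact: cont_cst].
have cg : continuous (fun t : R => (Num.max t 0, z) : R * phase R n d).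
  move=> t; exact: (@cvg_pair _ _ _ (nbhs t) (nbhs (Num.max t 0)) (nbhs z) _ _ _ (fun t => Num.max t 0) (cst z) (cm t) (cvg_cst z)).
have h0 t : setT t -> (0 : R) <= Num.max t 0 by rewrite le_max lexx orbT.
have := @within_comp _ _ _ setT _ _ _ cg h0 cF.
by move=> h; apply/continuous_subspace_setT; exact: h.
Qed.

(** From t <= 1 + t^(1 + delta), e^(rt) is at most e^r e^(r t^(1 + delta)); the constant a e^r + r
    dominates both the prefactor and the exponent. *)
Lemma exp_rate_le {R : realType} (a r t delta : R) : 0 <= a -> 0 <= r -> 0 <= t -> 0 < delta ->
  a * expR (r * t) <= (a * expR r + r) * expR ((a * expR r + r) * t `^ (1 + delta)).
Proof.
move=> a0 r0 t0 d0; set u := t `^ (1 + delta).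
have u0 : 0 <= u by exact: powR_ge0.
have tu : t <= 1 + u.
  have [t1|t1] := leP t 1; first by rewrite (le_trans t1)// lerDl.
  rewrite (@le_trans _ _ u)// ?lerDr// /u -[leLHS]powRr1//.
  by apply: ler_powR; [exact: ltW|rewrite lerDl ltW].
have ae0 : 0 <= a * expR r by rewrite mulr_ge0// expR_ge0.
apply: (@le_trans _ _ (a * expR r * expR (r * u))).
  rewrite -mulrA -expRD ler_wpM2l// ler_expR -[X in X + _]mulr1 -mulrDr.
  exact: ler_wpM2l.
apply: ler_pM => //; [by rewrite lerDl|].
by rewrite ler_expR ler_wpM2r// lerDr.
Qed.

Lemma flows_exist {R : realType} {n d : nat} (E : R -> 'M[R]_(n, d) -> 'M[R]_(n, d)) (B L : R) :
  0 <= B -> 0 <= L -> regular_field B L E ->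
  exists X V : phase R n d -> R -> 'M[R]_(n, d), forall z, solves E z (X z) (V z).
Proof.
move=> B0 L0 hE.
have h z : exists xv : (R -> 'M[R]_(n, d)) * (R -> 'M[R]_(n, d)), solves E z xv.1 xv.2.
  by have [x [v hs]] := solves_exists B0 L0 hE z; exists (x, v).
have [xv hxv] := choice h.
by exists (fun z => (xv z).1), (fun z => (xv z).2).
Qed.

Section MeanField.
Context {R : realType} {d n : nat}.
Local Notation N := n.+1.
Local Notation D := (phase R 1 d).
Variables (V : 'rV[R]_d -> R) (F0 : D -> R).
Hypothesis (Vper : torus_periodic V) (Vsm : smooth (@torus_dir R d) V) (Vev : forall x, V (- x) = V x).
Hypothesis pF0 : probability_density F0.
Hypothesis cF0 : continuous F0.
Variable r : R.
Hypothesis r2 : 2 <= r.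
Variables (FN : R -> phase R N d -> R) (F : R -> D -> R).
Hypothesis hFN : Liouville_solution V F0 FN.
Hypothesis hF : Vlasov_solution V F0 F.

Local Notation K := (potential_force V).
Local Notation L := (force_const V r).
Local Notation lip := (2 * d%:R * L).
(** Extension of the Vlasov solution by its initial datum at negative times, which makes the mean
    force continuous on the whole line. *)
Local Notation G := (fun t : R => F (Num.max t 0)).

Let L1 : 1 <= L. Proof. by apply: force_const_ge1; exact: le_trans r2. Qed.
Let L0 : 0 <= L. Proof. exact: le_trans L1. Qed.
Let lip0 : 0 <= lip. Proof. by apply: mulr_ge0 L0; exact: mulr_ge0. Qed.
Let cK c : continuous (K c). Proof. exact: (potential_force_smooth Vsm c [::]).1. Qed.
Let dK c x e : derivable (K c) x (torus_dir R e). Proof. exact: (potential_force_smooth Vsm c [::]).2. Qed.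
Let bK c x : `|K c x| <= L.
Proof. exact: (potential_force_bound (s := [::]) Vper Vsm c x r2). Qed.
Let bDK c x e : `|'D_(torus_dir R e) (K c) x| <= L.
Proof. exact: (potential_force_bound (s := [:: e]) Vper Vsm c x r2). Qed.
Let perK c : torus_periodic (K c). Proof. exact: potential_force_per. Qed.

Let F00 z : 0 <= F0 z. Proof. by case: pF0. Qed.
Let F01 : phase_eint F0 = 1%E. Proof. by case: pF0. Qed.

Let pos0 (t : R) : 0 <= Num.max t 0. Proof. by rewrite le_max lexx orbT. Qed.
Let cG t : continuous (G t). Proof. by case: hF => cF _ _ _; exact: classical_continuous. Qed.
Let G0 t z : 0 <= G t z. Proof. by case: hF => _ + _ _; move=> /(_ _ (pos0 t))[]. Qed.
Let G1 t : phase_eint (G t) = 1%E. Proof. by case: hF => _ + _ _; move=> /(_ _ (pos0 t))[]. Qed.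
Let cGt z : continuous (fun t => G t z). Proof. by case: hF => cF _ _ _; exact: classical_time. Qed.

Local Notation EN := (fun _ : R => @pair_force R d n K).
Local Notation E1 := (mean_force K G).

Let hEN : regular_field L lip EN. Proof. exact: pair_force_regular. Qed.
Let hE1 : regular_field L lip E1. Proof. exact: mean_force_regular. Qed.

Lemma liouville_transport t (z : phase R N d) : 0 < t -> free_transport FN t z =
  - \sum_(j < N) \sum_(i < d) EN t z.1 j i * 'D_(v_dir R j i) (FN t) z.
Proof.
move=> t0; have [_ pde _] := hFN; rewrite pde// mulr_sumr -sumrN; apply: eq_bigr => j _.
rewrite exchange_big mulr_sumr -sumrN; apply: eq_bigr => i _ /=.
rewrite mxE -mulr_suml mulrA -mulNr; congr (_ * _); rewrite -mulrN; congr (_ * _).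
(* The equation omits the self-interaction l = j, while [pair_force] includes it; the two agree
   because the force of an even potential vanishes at 0. *)
rewrite [in RHS](bigD1 j)//= subrr potential_force0// add0r -sumrN; apply: eq_bigr => l _.
by rewrite potential_forceE// opprK.
Qed.

Lemma mean_forceE t x c : 0 <= t -> E1 t x ord0 c = - gradient_convolution V (F t) x ord0 c.
Proof.
move=> t0; rewrite !mxE -/(mean (F t) _) -mulN1r.
have -> : F t = G t by rewrite max_l.
have bc1 : bc (fun y : D => potential_gradient V (x - y.1) ord0 c).
  have := bc_opp (bc_force_at cK bK c x).
  by congr bc; apply/funext => y; rewrite potential_forceE// opprK.
rewrite -(meanZ (@cG t) (@G0 t) (@G1 t) _ bc1); congr mean; apply/funext => y.
by rewrite potential_forceE// mulN1r.
Qed.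

Lemma vlasov_transport t (z : D) : 0 < t -> free_transport F t z =
  - \sum_(j < 1) \sum_(i < d) E1 t z.1 j i * 'D_(v_dir R j i) (F t) z.
Proof.
move=> t0; have [_ _ pde _] := hF; rewrite pde// big_ord1 -sumrN; apply: eq_bigr => i _.
by rewrite mean_forceE ?ltW// mulNr opprK.
Qed.

Let continuous_id : continuous (fun x : R => x). Proof. by move=> x; exact: cvg_id. Qed.

Let periodic_shift c (x : 'rV[R]_d) : phase_periodic (fun y : D => K c (x - y.1)).
Proof.
move=> v k y /=; have -> : x - (y + map_mx intr k) = (x - y) + map_mx intr (- k).
  by apply/matrixP => i j; rewrite !mxE intrN; ring.
exact: perK.
Qed.

(** Integrability at later times comes from transporting |FN| back to the initial product
    density. *)
Lemma eint_liouville t : 0 <= t -> phase_eint (fun z => `|FN t z|) = 1%E.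
Proof.
move=> t0; have [X [W hX]] := flows_exist L0 lip0 hEN; have [cl _ init] := hFN.
have := eint_transport lip0 hEN (fun _ => @pair_force_per _ _ _ perK n) hX cl liouville_transport t0
  (@norm_continuous _ _) (@cont_cst _ _ 1) (fun _ _ _ => erefl).
under eq_fun do rewrite mul1r; move=> ->.
under eq_fun do rewrite mul1r init ger0_norm ?(weight_ge0 F00)//.
exact: (eint_weight cF0 F00 F01).
Qed.

Lemma first_marginal_bound (phi : D -> R) t : 0 <= t -> phase_periodic phi ->
  smooth_bounded (@phase_dir R d) phi -> (forall s x, (size s <= 2)%N -> `|partials (@phase_dir R d) s phi x| <= 1) ->
  (\int[phase_measure R 1 d]_w
     (phi (phase_of_coords w) * (first_marginal (FN t) (phase_of_coords w) - F t (phase_of_coords w)))%:E <=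
   (N%:R^-1 * (@coupling_const R d L * expR (@rate R d L * t)))%:E)%E.
Proof.
move=> t0 pphi [sphi _] bphi.
have cphi : continuous phi by exact: (sphi [::]).1.
have bcphi : bc phi by split=> //; exists 1 => x; exact: (bphi [::]).
have [X [W hX]] := flows_exist L0 lip0 hEN.
have [P [Q hP]] := flows_exist L0 lip0 hE1.
have cX s : 0 <= s -> continuous (fun z => (X z s, W z s) : phase R N d).
  by move=> s0; exact: (flow_continuous lip0 hEN hX s0).
have cP s : 0 <= s -> continuous (fun y => (P y s, Q y s) : D).
  by move=> s0; exact: (flow_continuous lip0 hE1 hP s0).
have [clN _ initN] := hFN; have [cl dens _ init] := hF.
have initE : F 0 = F0 by apply/funext => y; exact: init.
have initNE : FN 0 = @weight _ _ F0 N by apply/funext => z; exact: initN.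
(* Transporting the Vlasov density back to time 0 turns the mean force into an expectation over
   initial data, comparable with the empirical average. *)
have hE s x c : 0 <= s -> E1 s x ord0 c = mean F0 (fun y => K c (x - P y s)).
  move=> s0; rewrite mxE max_l//.
  have := eint_transport lip0 hE1 (mean_force_per perK G) hP cl vlasov_transport s0
    continuous_id (@continuous_force_at _ _ _ cK c x) (periodic_shift c x).
  by rewrite initE => /(congr1 fine).
have eF : phase_integral (fun y => phi y * F t y) = mean F0 (fun y => phi (P y t, Q y t)).
  have := eint_transport lip0 hE1 (mean_force_per perK G) hP cl vlasov_transport t0
    continuous_id cphi pphi.
  by rewrite initE => /(congr1 fine).
pose phi0 (z : phase R N d) := phi (particle z ord0).
have cphi0 : continuous phi0 by exact: (@cont_particle _ _ _ ord0 _ cphi).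
have pphi0 : phase_periodic phi0.
  move=> v k x; rewrite /phi0 /particle /=.
  have -> : row ord0 (x + map_mx intr k) = row ord0 x + map_mx intr (row ord0 k).
    by apply/matrixP => i c; rewrite !mxE.
  exact: pphi.
have eFN : phase_integral (fun z => phi (particle z ord0) * FN t z) =
    expect F0 (fun z => phi (particle (X z t, W z t) ord0)).
  have := eint_transport lip0 hEN (fun _ => @pair_force_per _ _ _ perK n) hX clN liouville_transport t0
    continuous_id cphi0 pphi0.
  by rewrite initNE => /(congr1 fine).
have iF : (phase_eint (fun y => `|F t y|%R) < +oo)%E.
  have [_ F0' _ Fi] := dens t t0; under eq_fun do rewrite ger0_norm//.
  by rewrite /phase_eint Fi ltry.
have iFN : (phase_eint (fun z => `|FN t z|%R) < +oo)%E by rewrite eint_liouville// ltry.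
rewrite (marginal_integral (classical_continuous clN t0) iFN (classical_continuous cl t0) iF bcphi).
rewrite eFN eF lee_fin.
have bZ j : bc (fun z => phi (particle (X z t, W z t) j)).
  exact: (bc_comp (cX t t0) (bc_particle j bcphi)).
have bY : bc (fun y => phi (P y t, Q y t)) by exact: (bc_comp (cP t t0) bcphi).
have bYj (j : 'I_N) : bc (fun z => phi (P (particle z j) t, Q (particle z j) t)).
  exact: (bc_particle j bY).
have exch (j : 'I_N) : expect F0 (fun z => phi (particle (X z t, W z t) j)) =
    expect F0 (fun z => phi (particle (X z t, W z t) ord0)).
  have bs : bijective (tperm ord0 j) by exists (tperm ord0 j) => k; rewrite tpermK.
  rewrite -[RHS](expect_perm cF0 bs)//; congr expect; apply/funext => z.
  by rewrite (flow_perm lip0 hEN hX bs)// particle_perm_rows tpermL.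
(* By exchangeability the first particle may be replaced by the average over all particles, the
   quantity that [coupling_bound] controls. *)
have avg : expect F0 (fun z => phi (particle (X z t, W z t) ord0)) - mean F0 (fun y => phi (P y t, Q y t)) =
    expect F0 (fun z => N%:R^-1 * \sum_(j < N) (phi (particle (X z t, W z t) j) -
      phi (P (particle z j) t, Q (particle z j) t))).
  rewrite expect_average//; last by move=> j; exact: bc_sub.
  rewrite -[LHS](@average_cst _ n); congr (_ * _); apply: eq_bigr => j _.
  by rewrite (expectB cF0 F00 F01)// exch (expect_particle cF0 F00 F01 _ bY).
rewrite avg; apply: le_trans (ler_norm _) _.
rewrite mulrA [_^-1 * _]mulrC.
apply: (coupling_bound cF0 F00 F01 L1 (K := K) _ _ _ _ _ _ _ hX hP) => //.
- by move=> c e; exact: (potential_force_smooth Vsm c [:: e]).1.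
- by move=> c x e f; exact: (potential_force_smooth Vsm c [:: e]).2.
- by move=> c x e f; exact: (potential_force_bound (s := [:: f; e]) Vper Vsm c x r2).
- by move=> a; exact: (sphi [:: a]).1.
- by move=> y a; exact: (sphi [::]).2.
- by move=> y a b; exact: (sphi [:: a]).2.
- by move=> y a; exact: (bphi [:: a]).
- by move=> y a b; exact: (bphi [:: b; a]).
Qed.

End MeanField.

Unset Implicit Arguments.
Set Strict Implicit.
Set Printing Implicit Defensive.

Theorem corollary1 (R : realType) (d : nat) (hd : (1 <= d)%N)
    (delta : R) (hdelta : 0 < delta) :
  exists C : \bar R -> \bar R -> set (phase R 1 d) -> R,
  forall (V : 'rV[R]_d -> R) (F0 : phase R 1 d -> R),
    torus_periodic V ->
    smooth (@torus_dir R d) V ->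
    (forall x, V (- x) = V x) ->
    probability_density F0 ->
    smooth (@phase_dir R d) F0 ->
    compactly_supported F0 ->
  forall (n : nat) (FN : R -> phase R n.+1 d -> R) (F : R -> phase R 1 d -> R),
    Liouville_solution V F0 FN ->
    Vlasov_solution V F0 F ->
  forall t : R, 0 <= t ->
  let C_delta := C (gradient_sobolev_norm (2 + delta) V)
                   (phase_Lnorm (1 + delta) F0)
                   (phase_support F0) in
  (negative_sobolev_norm (2 + delta)
     (fun z => first_marginal (FN t) z - F t z)%R
   <= (n.+1%:R^-1 * (C_delta * expR (C_delta * t `^ (1 + delta))))%R%:E)%E.
Proof.
(* The summand 1 is that of [force_const]: at the norm of the gradient, [1 + fine G] is the force
   bound of the mean-field estimate. The witness below has the shape given by [exp_rate_le]. *)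
pose a (G : \bar R) := @coupling_const R d (1 + fine G).
pose r (G : \bar R) := @rate R d (1 + fine G).
exists (fun G _ _ => a G * expR (r G) + r G) => V F0 Vper Vsm Vev pF0 sF0 _ n FN F hFN hF t t0 /=.
have r2 : 2 <= 2 + delta by rewrite lerDl ltW.
have rpos : 0 <= 2 + delta by apply: le_trans r2.
have cF0 : continuous F0 by exact: (sF0 [::]).1.
apply: ge_ereal_sup => _ [phi [pphi sphi nphi ->]].
have bphi s x : (size s <= 2)%N -> `|partials (@phase_dir R d) s phi x| <= 1.
  move=> s2; pose i0 := Ordinal hd.
  (* As d >= 1 there are a coordinate direction and a nonzero phase point, so the Hoelder seminorm
     is a supremum over a nonempty set. *)
  have x0 : x_dir R ord0 i0 != 0 :> phase R 1 d.
    apply/eqP => /(congr1 fst)/matrixP/(_ ord0 i0); rewrite !mxE !eqxx => /eqP.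
    by rewrite oner_eq0.
  have := sup_norm_le_sobolev (@phase_dir R d) (2 + delta) phi (inl i0) x0.
  move=> /le_trans/(_ nphi) h; apply: (sup_norm_uptoP h).
  by apply: leq_trans s2 _; rewrite truncn_ge_nat.
apply: le_trans (first_marginal_bound Vper Vsm Vev pF0 cF0 r2 hFN hF t0 pphi sphi bphi) _.
rewrite lee_fin ler_wpM2l ?invr_ge0//.
have L1 := force_const_ge1 V rpos.
by apply: exp_rate_le => //; [exact: coupling_const_ge0|by apply: ltW; exact: rate_gt0].
Qed.
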